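(* Let $p>\frac12$, $0\le s\le p$ and $p\le t\le 2p$. (i) If $\lambda\in[0,\frac{s}{t})$, then there is a constant $C>0$, independent of $J$ and $u$, such that for all integers $J\ge1$ and all $u\in H_{\mathrm{mix}}^t(\mathbb{T}^2)$ $$\big\|u-\widehat{\boldsymbol Q}_J^\lambda u\big\|_{H_{\mathrm{iso}}^s(\mathbb{T}^2)}\le C\,2^{-J(t-s)}\|u\|_{H_{\mathrm{mix}}^t(\mathbb{T}^2)}.$$ (ii) If $\lambda=\frac{s}{t}$ and $\lambda<1$, then there is a constant $C>0$, independent of $J$ and $u$, such that for all integers $J\ge1$ and all $u\in H_{\mathrm{mix}}^t(\mathbb{T}^2)$ $$\big\|u-\widehat{\boldsymbol Q}_J^\lambda u\big\|_{H_{\mathrm{iso}}^s(\mathbb{T}^2)}\le C\,J\,2^{-J(t-s)}\|u\|_{H_{\mathrm{mix}}^t(\mathbb{T}^2)}.$$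
   Context: Univariate spaces. $\mathbb{T}=[0,1]$ with periodic identification of the endpoints. For real $r\ge 0$, $H^r(\mathbb{T})$ is the periodic Sobolev space of (real-valued) functions $f\in L^2(\mathbb{T})$ with Fourier coefficients $\hat f_k=\int_0^1 f(x)e^{-2\pi i kx}\,dx$ and finite norm $\|f\|_{H^r(\mathbb{T})}^2=|\hat f_0|^2+\sum_{k\in\mathbb{Z}\setminus\{0\}}(2\pi|k|)^{2r}|\hat f_k|^2$; $H^0(\mathbb{T})=L^2(\mathbb{T})$. For $r>\frac12$ this is a reproducing kernel Hilbert space. Univariate kernel interpolation. Fix $p>\frac12$ and let $\kappa(x,y)=1+\sum_{k\in\mathbb{Z}\setminus\{0\}}(2\pi|k|)^{-2p}\exp(2\pi i k(x-y))$ be the reproducing kernel of $H^p(\mathbb{T})$. For $j\in\mathbb{N}_0$ let $X_j=\{2^{-j}k: k=0,\dots,2^j-1\}$ and $V_j=\mathrm{span}\{\kappa(\cdot,x):x\in X_j\}\subset H^p(\mathbb{T})$. Let $P_j:H^p(\mathbb{T})\to V_j$ be the $H^p(\mathbb{T})$-orthogonal projection onto $V_j$ (equivalently, $P_ju$ is the unique element of $V_j$ interpolating $u$ on $X_j$). Put $P_{-1}:=0$ and $Q_j:=P_j-P_{j-1}$ for $j\in\mathbb{N}_0$. Bivariate spaces (Hilbert space tensor products). For $s,t\ge0$, $H_{\mathrm{mix}}^t(\mathbb{T}^2):=H^t(\mathbb{T})\otimes H^t(\mathbb{T})$ and $$H_{\mathrm{iso}}^s(\mathbb{T}^2):=\big(H^{s}(\mathbb{T})\otimes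 L^2(\mathbb{T})\big)\cap\big(L^2(\mathbb{T})\otimes H^{s}(\mathbb{T})\big),$$ the latter equipped with the intersection norm (the square root of the sum of the squares of the two tensor product norms). Sparse grid projection. For $\boldsymbol j=(j_1,j_2)\in\mathbb{N}_0^2$ let $\boldsymbol Q_{\boldsymbol j}:=Q_{j_1}\otimes Q_{j_2}$, acting on $H_{\mathrm{mix}}^p(\mathbb{T}^2)$. For $\lambda\in(-\infty,1)$ let $$\mathcal{I}_J^\lambda=\{\boldsymbol j\in\mathbb{N}_0^2:\ \|\boldsymbol j\|_1-\lambda\|\boldsymbol j\|_\infty\le J(1-\lambda)\},\qquad \widehat{\boldsymbol Q}_J^\lambda=\sum_{\boldsymbol j\in\mathcal{I}_J^\lambda}\boldsymbol Q_{\boldsymbol j}.$$ *)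

(* Defs.v *)
From HB Require Import structures.
From mathcomp Require Import all_boot all_order all_algebra.
From mathcomp Require Import complex.
From mathcomp Require Import all_classical all_reals all_analysis.

Set Implicit Arguments.
Unset Strict Implicit.
Unset Printing Implicit Defensive.

Import Order.TTheory GRing.Theory Num.Theory.
Import numFieldNormedType.Exports.

Local Open Scope classical_set_scope.
Local Open Scope ring_scope.

(* Elements of L^2(T) and L^2(T^2) are represented by measurable functions on R
   and R * R, considered up to equality almost everywhere for the measures
   [muT] and [muT2]; in particular only the values on [0,1] and [0,1]^2 matter,
   and the identification of 0 and 1 is invisible. *)

Section Torus.
Context {R : realType}.

Lemma lebesgue_unit_fin : (@lebesgue_measure R `[0%R, 1%R] < +oo)%E.
Proof. by rewrite lebesgue_measure_itv /= lte01 oppr0 adde0 ltry. Qed.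

Definition muT : set (measurableTypeR R) -> \bar R :=
  @mfrestr _ (measurableTypeR R) R `[0%R, 1%R] lebesgue_measure
    (measurable_itv `[0%R, 1%R]) lebesgue_unit_fin.

HB.instance Definition _ := FiniteMeasure.on muT.

Definition muT2 : {measure set (measurableTypeR R * measurableTypeR R) -> \bar R} :=
  (muT \x muT)%E.

Definition expi (x : R) : R[i] := (cos x +i* sin x)%C.

Definition Cintegral (f : R -> R[i]) : R[i] :=
  ((\int[muT]_x complex.Re (f x)) +i* (\int[muT]_x complex.Im (f x)))%C.

Definition fourier (f : R -> R) (k : int) : R[i] :=
  Cintegral (fun x => (f x)%:C%C * expi (- (2 * pi * k%:~R * x))).

Definition fourier_abs2 (f : R -> R) (k : int) : R :=
  ComplexField.Normc.normc (fourier f k) ^+ 2.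

Definition Hnorm2 (r : R) (f : R -> R) : \bar R :=
  ((fourier_abs2 f 0%R)%:E +
   \esum_(k in [set k : int | k != 0%R])
     ((2 * pi * `|k%:~R|) `^ (2 * r) * fourier_abs2 f k)%R%:E)%E.

Definition Hsob (r : R) : set (R -> R) :=
  [set f | f \in Lfun muT 2%:E /\ (Hnorm2 r f < +oo)%E].

(* The inner product of the (real) Hilbert space H^r(T), recovered from its norm
   by polarization. *)
Definition Hinner (r : R) (f g : R -> R) : R :=
  (fine (Hnorm2 r (f \+ g)) - fine (Hnorm2 r (f \- g))) / 4.

(* The sum over k <> 0 is the limit of its symmetric partial sums; the terms of
   index k and - k are conjugate, so the sum is real. *)
Definition kappa (p x y : R) : R :=
  1 + limn (fun n => \sum_(1 <= k < n.+1)
        (2 * pi * k%:R) `^ (- (2 * p)) *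
        complex.Re (expi (2 * pi * k%:R * (x - y)) +
                    expi (2 * pi * - k%:R * (x - y)))).

Definition grid (j : nat) (k : 'I_(2 ^ j)) : R := k%:R / 2 ^+ j.

Definition Vspan (p : R) (j : nat) : set (R -> R) :=
  [set v | exists c : 'I_(2 ^ j) -> R,
     v = fun y => \sum_k c k * kappa p y (grid k)].

Definition projV (p : R) (j : nat) (u : R -> R) : R -> R :=
  xget (fun=> 0) [set v | Vspan p j v /\
                          forall w, Vspan p j w -> Hinner p (u \- v) w = 0].

Definition Qdetail (p : R) (j : nat) (u : R -> R) : R -> R :=
  projV p j u \- (if j is i.+1 then projV p i u else fun=> 0).

(* A list [:: (f_1, g_1); ...; (f_m, g_m)] stands for the element
   \sum_i f_i (x) g_i of the algebraic tensor product. *)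
Definition tensor := seq ((R -> R) * (R -> R)).

Definition tensor_fun (U : tensor) : R * R -> R :=
  fun z => \sum_(f <- U) f.1 z.1 * f.2 z.2.

Definition tensor_sub (U W : tensor) : tensor :=
  U ++ [seq (\- f.1, f.2) | f <- W].

Definition tensor_map (A B : (R -> R) -> (R -> R)) (U : tensor) : tensor :=
  [seq (A f.1, B f.2) | f <- U].

(* The norm of the algebraic tensor product of H^a(T) and H^b(T), for the inner
   product determined by <f (x) g, f' (x) g'> = <f, f'> <g, g'>. *)
Definition cross_norm (a b : R) (U : tensor) : R :=
  Num.sqrt (\sum_(f <- U) \sum_(g <- U) Hinner a f.1 g.1 * Hinner b f.2 g.2).

(* The Hilbert tensor product of H^a(T) and H^b(T) is the completion of the
   algebraic one for [cross_norm]; as [cross_norm a b] dominates the norm of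
   L^2(T^2), it is realized inside L^2(T^2): the class of a Cauchy sequence U
   is its limit u in L^2(T^2). *)
Definition tensor_represents (a b : R) (u : R * R -> R) (U : nat -> tensor) :=
  [/\ u \in Lfun muT2 2%:E,
      forall n f, f \in U n -> Hsob a f.1 /\ Hsob b f.2,
      forall e : R, 0 < e -> exists N : nat, forall m n : nat,
        (N <= m)%N -> (N <= n)%N ->
        cross_norm a b (tensor_sub (U m) (U n)) < e &
      'N[muT2]_2%:E[EFin \o (u \- tensor_fun (U n))%R]%E @[n --> \oo] --> 0%E].

Definition Htensor (a b : R) : set (R * R -> R) :=
  [set u | exists U, tensor_represents a b u U].

Definition Htensor_norm (a b : R) (u : R * R -> R) : R :=
  xget 0 [set N : R | exists2 U, tensor_represents a b u U &
                       cross_norm a b (U n) @[n --> \oo] --> N].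

(* The tensor product of two bounded operators on H^p(T): the continuous
   extension of \sum_i f_i (x) g_i |-> \sum_i A f_i (x) B g_i to the Hilbert
   tensor product of H^p(T) with itself. *)
Definition tensor_op (p : R) (A B : (R -> R) -> (R -> R)) (u : R * R -> R) :
    R * R -> R :=
  xget (fun=> 0) [set v | forall U, tensor_represents p p u U ->
     tensor_represents p p v (fun n => tensor_map A B (U n))].

Definition Hmix (t : R) : set (R * R -> R) := Htensor t t.

Definition Hmix_norm (t : R) (u : R * R -> R) : R := Htensor_norm t t u.

Definition Hiso (s : R) : set (R * R -> R) := Htensor s 0 `&` Htensor 0 s.

Definition Hiso_norm (s : R) (u : R * R -> R) : R :=
  Num.sqrt (Htensor_norm s 0 u ^+ 2 + Htensor_norm 0 s u ^+ 2).

Definition sparse_index (lambda : R) (J : nat) : set (nat * nat) :=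
  [set j | (j.1 + j.2)%:R - lambda * (maxn j.1 j.2)%:R
           <= J%:R * (1 - lambda)].

Definition sparse_proj (p lambda : R) (J : nat) (u : R * R -> R) : R * R -> R :=
  fun z => \sum_(j \in sparse_index lambda J)
             tensor_op p (Qdetail p j.1) (Qdetail p j.2) u z.

End Torus.

(* Main.v *)
(* In the real trigonometric basis the norm of [H^r] is a weighted l2 norm of the
   coefficients. If [e] vanishes on the [2 ^ j] nodes, its low coefficients are aliases
   of the high ones, so that [|e|_s <= C 2 ^ (- j (p - s)) |e|_p] for [0 <= s <= p];
   since [e = u - P_j u] is also [H^p]-orthogonal to [V_j], Aubin--Nitsche duality
   yields [|u - P_j u|_s <= C 2 ^ (- j (t - s)) |u|_t] for [p <= t <= 2 p].

   Let [h_b] be the height of the column [b] of the index set. Summing the details of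
   each column, the sparse grid error telescopes to
   [\sum_b (I - P_(h_b - 1)) (x) Q_b], plus a last term [I (x) (I - P_J)]. The
   univariate bounds, applied to the rows and to the columns of the coefficient array,
   bound the [b]-th term in [H^s (x) L^2] by [2 ^ (- (t - s) h_b - t b) |u|_(t,t)].
   Since [(1 - lambda) h_b + b > J (1 - lambda)], this is at most
   [2 ^ (- J (t - s)) 2 ^ (- b (s - t lambda) / (1 - lambda))]: a geometric series in
   [b] if [lambda < s / t], and [J + 2] equal terms if [lambda = s / t]. The index set
   is symmetric, hence the same bound holds in [L^2 (x) H^s]. *)

Require Import Defs.
From mathcomp Require Import all_boot all_order all_algebra.
From mathcomp Require Import ring lra zify complex.
From mathcomp Require Import all_classical all_reals all_analysis.
From mathcomp Require Import measurable_realfun.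
Import Order.TTheory GRing.Theory Num.Theory.
Import numFieldNormedType.Exports.
Local Open Scope classical_set_scope.
Local Open Scope ring_scope.
Set Implicit Arguments.
Unset Strict Implicit.
Unset Printing Implicit Defensive.

(** * Weighted l2 norms *)

(** The projections, the tensor operators and the tensor norms are choices made by [xget]. Each has
    to be shown to exist and is then handled through its trigonometric coefficients: [isproj] and
    [isprev] state interpolation as a linear relation between coefficient sequences, and this
    replaces linearity of maps between functions. Infinite sums are mostly avoided: a norm bound is
    a bound on all partial sums of squares, uniform in the cutoff [M]. The completion shapes the
    step to two variables. An element of a tensor product is a limit of lists, so estimates are
    proved for the coefficient arrays of lists and passed to the limit by a Fatou argument. The
    condition [p > 1/2] enters twice: it makes the inverse weights summable, which gives finite
    aliasing constants, and it bounds combinations of products of kernel functions at every point,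
    so that the operators extend by uniform limits and one function serves all the sequences that
    represent the same element. *)

Section FiniteSums.
Context {R : realType}.

Lemma sum_sqr_cauchy_schwarz (I : Type) (r : seq I) (a b : I -> R) :
  (\sum_(i <- r) a i * b i) ^+ 2 <=
  (\sum_(i <- r) a i ^+ 2) * (\sum_(i <- r) b i ^+ 2).
Proof.
have step (x A B c d : R) : 0 <= A -> 0 <= B -> x ^+ 2 <= A * B ->
    (c * d + x) ^+ 2 <= (c ^+ 2 + A) * (d ^+ 2 + B).
  move=> A0 B0 xAB.
  (* The inequality between the arithmetic and geometric means of [A * d ^+ 2] and [B * c ^+ 2], in
     squared form because only [x ^+ 2 <= A * B] is known. *)
  have H : 2 * x * (c * d) <= A * d ^+ 2 + B * c ^+ 2.
    apply: le_trans (ler_norm _) _.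
    have S0 : 0 <= A * d ^+ 2 + B * c ^+ 2 by rewrite addr_ge0// mulr_ge0// sqr_ge0.
    rewrite -ler_sqr ?nnegrE ?normr_ge0//.
    rewrite -normrX ger0_norm ?sqr_ge0 //.
    have h2 : x ^+ 2 * (c * d) ^+ 2 <= A * B * (c * d) ^+ 2.
      by rewrite ler_wpM2r // sqr_ge0.
    have h3 : 0 <= (A * d ^+ 2 - B * c ^+ 2) ^+ 2 by rewrite sqr_ge0.
    nra.
  rewrite -subr_ge0.
  rewrite (_ : _ - _ =
    (A * B - x ^+ 2) + (A * d ^+ 2 + B * c ^+ 2 - 2 * x * (c * d))); last by ring.
  by rewrite addr_ge0 ?subr_ge0.
elim: r => [|i r IH]; first by rewrite !big_nil expr0n /= mulr0.
rewrite !big_cons; apply: step => //;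
  by apply: sumr_ge0 => j _; rewrite sqr_ge0.
Qed.

(* Gives the triangle inequality without square roots: if [S_b] has norm at most
   [be_b], then summing over coordinates bounds the squared norm of [\sum_b S_b]
   by [(\sum_b be_b) ^+ 2]. *)
Lemma sqr_sum_weighted (I : Type) (r : seq I) (x be : I -> R) :
  (forall i, 0 < be i) ->
  (\sum_(i <- r) x i) ^+ 2 <=
  (\sum_(i <- r) be i) * (\sum_(i <- r) x i ^+ 2 / be i).
Proof.
move=> be0.
have := sum_sqr_cauchy_schwarz r (fun i => Num.sqrt (be i))
  (fun i => x i / Num.sqrt (be i)).
rewrite (eq_bigr x); last first.
  by move=> i _; rewrite mulrCA divff ?mulr1// gt_eqF// sqrtr_gt0.
rewrite [X in _ <= X * _ -> _](eq_bigr be); last first.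
  by move=> i _; rewrite sqr_sqrtr// ltW.
rewrite [X in _ <= _ * X -> _](eq_bigr (fun i => x i ^+ 2 / be i))//.
by move=> i _; rewrite expr_div_n sqr_sqrtr// ltW.
Qed.

(** Minkowski's inequality in squared form: it applies to partial sums for which only upper bounds
    of the norms are available. *)
Lemma sqr_sumD (I : Type) (r : seq I) (w a b : I -> R) (A B : R) :
  (forall i, 0 <= w i) -> 0 <= A -> 0 <= B ->
  \sum_(i <- r) w i * a i ^+ 2 <= A ^+ 2 ->
  \sum_(i <- r) w i * b i ^+ 2 <= B ^+ 2 ->
  \sum_(i <- r) w i * (a i + b i) ^+ 2 <= (A + B) ^+ 2.
Proof.
move=> w0 A0 B0 hA hB.
have := sum_sqr_cauchy_schwarz r (fun i => Num.sqrt (w i) * a i)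
  (fun i => Num.sqrt (w i) * b i).
rewrite [X in X ^+ 2 <= _ -> _](eq_bigr (fun i => w i * (a i * b i))); last first.
  by move=> i _; rewrite mulrACA -expr2 sqr_sqrtr.
rewrite [X in _ <= X * _ -> _](eq_bigr (fun i => w i * a i ^+ 2)); last first.
  by move=> i _; rewrite exprMn sqr_sqrtr.
rewrite [X in _ <= _ * X -> _](eq_bigr (fun i => w i * b i ^+ 2)); last first.
  by move=> i _; rewrite exprMn sqr_sqrtr.
rewrite [X in _ -> X <= _](_ : _ = \sum_(i <- r) w i * a i ^+ 2 +
   2 * (\sum_(i <- r) w i * (a i * b i)) + \sum_(i <- r) w i * b i ^+ 2);
  last first.
  by rewrite mulr_sumr -!big_split /=; apply: eq_bigr => i _; ring.
set X := \sum_(i <- r) w i * a i ^+ 2 in hA *.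
set Y := \sum_(i <- r) w i * b i ^+ 2 in hB *.
set Z := \sum_(i <- r) _ => hZ.
have X0 : 0 <= X by apply: sumr_ge0 => i _; rewrite mulr_ge0 ?sqr_ge0.
have Y0 : 0 <= Y by apply: sumr_ge0 => i _; rewrite mulr_ge0 ?sqr_ge0.
have ZAB : Z <= A * B.
  apply: le_trans (ler_norm _) _.
  rewrite -ler_sqr ?nnegrE ?mulr_ge0 // -normrX ger0_norm ?sqr_ge0 //.
  apply: le_trans hZ _; rewrite exprMn ler_pM //.
nra.
Qed.

End FiniteSums.

Section SquareSums.
Context {R : realType} {T : Type}.
Variable E : nat -> seq T.
Hypothesis Emono : forall F : T -> R, (forall i, 0 <= F i) ->
  nondecreasing_seq (fun M => \sum_(i <- E M) F i).

Implicit Types (w x y : T -> R).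

(** The exhaustion [E] is [index_iota 0] for sequences and [square] for double arrays; monotonicity
    of the partial sums of nonnegative terms is all that is asked of it, so both kinds of norm share
    one theory. The limit [nrm2] is meaningful under [fin2]. *)
Definition sqsum w x (M : nat) : R := \sum_(i <- E M) w i * x i ^+ 2.

Definition fin2 w x := exists B, forall M, sqsum w x M <= B.

Definition nrm2 w x : R := limn (sqsum w x).

Definition nrm w x : R := Num.sqrt (nrm2 w x).

Variable w : T -> R.
Hypothesis w0 : forall i, 0 <= w i.

Lemma sqsum_ge0 x M : 0 <= sqsum w x M.
Proof. by apply: sumr_ge0 => i _; rewrite mulr_ge0 ?sqr_ge0. Qed.

Lemma sqsum_nd x : nondecreasing_seq (sqsum w x).
Proof. by apply: Emono => i; rewrite mulr_ge0 ?sqr_ge0. Qed.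

Lemma sqsumN x M : sqsum w (fun i => - x i) M = sqsum w x M.
Proof. by apply: eq_bigr => i _; rewrite sqrrN. Qed.

Lemma fin2_cvg x : fin2 w x -> cvgn (sqsum w x).
Proof.
move=> [B hB]; apply: nondecreasing_is_cvgn; first exact: sqsum_nd.
by exists B => _ [M _ <-].
Qed.

Lemma nrm2_cvg x : fin2 w x -> sqsum w x @ \oo --> nrm2 w x.
Proof. exact: fin2_cvg. Qed.

Lemma sqsum_le_nrm2 x M : fin2 w x -> sqsum w x M <= nrm2 w x.
Proof.
move=> hx; apply: nondecreasing_cvgn_le; [exact: sqsum_nd | exact: fin2_cvg].
Qed.

Lemma nrm2_le x B : (forall M, sqsum w x M <= B) -> nrm2 w x <= B.
Proof.
move=> hB; apply: limr_le; first by apply: fin2_cvg; exists B.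
by near=> M; exact: hB.
Unshelve. all: by end_near. Qed.

Lemma nrm2_ge0 x : fin2 w x -> 0 <= nrm2 w x.
Proof. by move=> hx; exact: le_trans (sqsum_ge0 x 0) (sqsum_le_nrm2 0 hx). Qed.

Lemma sqr_nrm x : fin2 w x -> nrm w x ^+ 2 = nrm2 w x.
Proof. by move=> hx; rewrite /nrm sqr_sqrtr// nrm2_ge0. Qed.

Lemma nrm_ge0 x : 0 <= nrm w x. Proof. exact: sqrtr_ge0. Qed.

Lemma sqsum_le_nrm x M : fin2 w x -> sqsum w x M <= nrm w x ^+ 2.
Proof. by move=> hx; rewrite sqr_nrm// sqsum_le_nrm2. Qed.

Lemma nrm_le x B : 0 <= B -> (forall M, sqsum w x M <= B ^+ 2) -> nrm w x <= B.
Proof.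
move=> B0 hB; rewrite -(ger0_norm B0) -sqrtr_sqr ler_sqrt ?sqr_ge0//.
exact: nrm2_le.
Qed.

Lemma sqsumD x y M : fin2 w x -> fin2 w y ->
  sqsum w (fun i => x i + y i) M <= (nrm w x + nrm w y) ^+ 2.
Proof. by move=> hx hy; apply: sqr_sumD; rewrite ?nrm_ge0 ?sqsum_le_nrm. Qed.

Lemma fin2D x y : fin2 w x -> fin2 w y -> fin2 w (fun i => x i + y i).
Proof. by move=> hx hy; eexists => M; exact: sqsumD. Qed.

Lemma nrmD x y : fin2 w x -> fin2 w y ->
  nrm w (fun i => x i + y i) <= nrm w x + nrm w y.
Proof.
by move=> hx hy; apply: nrm_le => [|M]; rewrite ?addr_ge0 ?nrm_ge0 ?sqsumD.
Qed.

Lemma fin2N x : fin2 w x -> fin2 w (fun i => - x i).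
Proof. by move=> [B hB]; exists B => M; rewrite sqsumN. Qed.

Lemma nrmN x : nrm w (fun i => - x i) = nrm w x.
Proof. by rewrite /nrm /nrm2; congr (Num.sqrt (limn _)); apply/funext => M; exact: sqsumN. Qed.

Lemma fin2B x y : fin2 w x -> fin2 w y -> fin2 w (fun i => x i - y i).
Proof. by move=> hx hy; apply: fin2D => //; exact: fin2N. Qed.

Lemma nrmB x y : fin2 w x -> fin2 w y ->
  nrm w (fun i => x i - y i) <= nrm w x + nrm w y.
Proof. by move=> hx hy; rewrite -(nrmN y); apply: nrmD => //; exact: fin2N. Qed.

Lemma fin2_eq x y : x =1 y -> fin2 w x -> fin2 w y.
Proof. by move=> /funext ->. Qed.

Lemma nrm_dist x y : fin2 w x -> fin2 w y ->
  `|nrm w x - nrm w y| <= nrm w (fun i => x i - y i).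
Proof.
move=> hx hy.
have h a b : fin2 w a -> fin2 w b -> nrm w a <= nrm w b + nrm w (fun i => a i - b i).
  move=> ha hb; rewrite {1}(_ : a = fun i => b i + (a i - b i)).
    by apply: nrmD => //; exact: fin2B.
  by apply/funext => i; rewrite addrC subrK.
rewrite ler_distl; apply/andP; split.
  by rewrite lerBlDr -[X in _ <= _ + X]nrmN; under eq_fun do rewrite opprB; exact: h.
exact: h.
Qed.

Lemma sqsum_cvg (x : nat -> T -> R) y M : (forall i, x n i @[n --> \oo] --> y i) ->
  sqsum w (x n) M @[n --> \oo] --> sqsum w y M.
Proof.
move=> h; rewrite /sqsum; elim: (E M) => [|i s IH].
  by rewrite big_nil; under eq_fun do rewrite big_nil; exact: cvg_cst.
rewrite big_cons; under eq_fun do rewrite big_cons.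
apply: cvgD => //; apply: cvgM; first exact: cvg_cst.
exact: cvgM.
Qed.

(* Fatou: a pointwise limit that is Cauchy in norm is a limit in norm. *)
Lemma nrm_cauchy_cvg0 (x : nat -> T -> R) y :
  (forall n, fin2 w (x n)) ->
  (forall e : R, 0 < e -> exists N, forall m n, (N <= m)%N -> (N <= n)%N ->
     nrm w (fun i => x m i - x n i) < e) ->
  (forall i, x n i @[n --> \oo] --> y i) ->
  fin2 w y /\ nrm w (fun i => x n i - y i) @[n --> \oo] --> 0.
Proof.
move=> hx hc hp.
have key (e : R) : 0 < e -> exists N, forall n, (N <= n)%N ->
    forall M, sqsum w (fun i => x n i - y i) M <= e ^+ 2.
  move=> e0; have [N hN] := hc _ e0; exists N => n Nn M.
  (* For fixed [n] and [M] the sum is finite, so the Cauchy bound passes to the limit in [m]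
     coordinate by coordinate. *)
  have : sqsum w (fun i => x n i - x m i) M @[m --> \oo] -->
         sqsum w (fun i => x n i - y i) M.
    by apply: sqsum_cvg => i; apply: cvgB => //; exact: cvg_cst.
  move=> h; rewrite -(cvg_lim _ h)//; apply: limr_le; first exact: cvgP h.
  near=> m; apply: (le_trans (sqsum_le_nrm M _)); first exact: fin2B.
  have Nm : (N <= m)%N by near: m; exact: nbhs_infty_ge.
  by rewrite ler_sqr ?nnegrE ?nrm_ge0 ?(ltW e0)// ltW// hN.
have fy : fin2 w y.
  have [N hN] := key _ ltr01.
  rewrite (_ : y = fun i => x N i - (x N i - y i)); last first.
    by apply/funext => i; rewrite opprB addrC subrK.
  by apply: fin2B => //; exists (1 ^+ 2); exact: hN.
split=> //; apply/cvgrPdist_le => e e0; have [N hN] := key _ e0.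
near=> n; rewrite sub0r normrN ger0_norm ?nrm_ge0//.
apply: nrm_le; [exact: ltW | apply: hN; near: n; exact: nbhs_infty_ge].
Unshelve. all: by end_near. Qed.

Lemma nrm_cauchy_cvg (x : nat -> T -> R) y :
  (forall n, fin2 w (x n)) ->
  (forall e : R, 0 < e -> exists N, forall m n, (N <= m)%N -> (N <= n)%N ->
     nrm w (fun i => x m i - x n i) < e) ->
  (forall i, x n i @[n --> \oo] --> y i) ->
  nrm w (x n) @[n --> \oo] --> nrm w y.
Proof.
move=> hx hc hp; have [fy cy] := nrm_cauchy_cvg0 hx hc hp.
apply/cvgrPdist_le => e e0; move/cvgrPdist_le: cy => /(_ _ e0) cy.
near=> n; rewrite distrC; apply: le_trans (nrm_dist _ _) _ => //.
suff : `|0 - nrm w (fun i => x n i - y i)| <= e.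
  by rewrite sub0r normrN ger0_norm ?nrm_ge0.
by near: n.
Unshelve. all: by end_near. Qed.

End SquareSums.

Lemma iota_mono (R : realType) (F : nat -> R) : (forall i, 0 <= F i) ->
  nondecreasing_seq (fun M => \sum_(i <- index_iota 0 M) F i).
Proof.
move=> F0 a b ab; rewrite (big_cat_nat (leq0n a) ab)//= lerDl.
exact: sumr_ge0.
Qed.

(** * Partial sums of the zeta series *)

Section Zeta.
Context {R : realType}.

Lemma powR_lt1 (a x : R) : 1 < a -> x < 0 -> a `^ x < 1.
Proof.
move=> a1 x0; rewrite /powR gt_eqF ?(lt_trans ltr01)// expR_lt1.
by rewrite nmulr_rlt0// ln_gt0.
Qed.

(** Cauchy condensation: in the partial sum of order [2 m + 1] the terms of [2 k] and [2 k + 1] are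
    together at most [q] times the term of [k], whence [S (2 m + 1) <= 1 + q * S m]. As [S] is
    nondecreasing, [S M <= 1 + q * S M], which is solved for [S M] since [q < 1]. *)
Lemma zeta_partial_le (a : R) (M : nat) : 1 < a ->
  \sum_(0 <= k < M) k.+1%:R `^ (- a) <= (1 - 2 `^ (1 - a))^-1.
Proof.
move=> a1; set q := 2 `^ (1 - a); set S := fun M => \sum_(0 <= k < M) k.+1%:R `^ (- a).
have q1 : q < 1 by rewrite powR_lt1 ?ltr1n// subr_lt0.
have q0 : 0 <= q by exact: powR_ge0.
have term0 k : 0 <= k.+1%:R `^ (- a) :> R by exact: powR_ge0.
have Snd : nondecreasing_seq S by apply: iota_mono => k; exact: term0.
have S0 : S 0%N = 0 by rewrite /S big_geq.
have SS m : S m.+1 = S m + m.+1%:R `^ (- a) by rewrite /S big_nat_recr.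
have key m : S m.*2.+1 <= 1 + q * S m.
  elim: m => [|m IH]; first by rewrite SS !S0 mulr0 addr0 add0r powR1.
  rewrite doubleS (SS m) mulrDr [leRHS]addrA 2!(SS _.+1) -[leLHS]addrA lerD//.
  have -> : q * m.+1%:R `^ (- a) = 2 * m.*2.+2%:R `^ (- a).
    rewrite -doubleS -muln2 mulnC natrM powRM ?ler0n// mulrA; congr (_ * _).
    by rewrite /q powRD ?powRr1 ?ler0n//; apply/implyP => _; rewrite pnatr_eq0.
  rewrite mulr2n mulrDl !mul1r lerD2l.
  by rewrite !powRN lef_pV2 ?posrE ?powR_gt0 ?ltr0n// ge0_ler_powR ?nnegrE ?ler0n ?ler_nat ?(ltW (lt_trans ltr01 a1)).
have hS : S M <= 1 + q * S M.
  apply: le_trans (key M); apply: Snd; rewrite -addnn; exact: leq_trans (leq_addr _ _) (leqnSn _).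
by rewrite -/(S M) -[leRHS]mul1r ler_pdivlMr ?subr_gt0//; nra.
Qed.

End Zeta.

(** * The trigonometric basis *)

Section Weights.
Context {R : realType}.
Implicit Types (a b r s : R) (n : nat).

(** The maximum only matters at the frequency [0], to which the norm of [H^r] gives the weight [1].
    It also keeps the base at least [1], so that [wt r n] is nondecreasing in [r]. *)
Definition omega n : R := Num.max 1 (2 * pi * (n./2)%:R).

Definition wt r n : R := omega n `^ (2 * r).

Lemma omega_ge1 n : 1 <= omega n. Proof. by rewrite /omega le_max lexx. Qed.

Lemma omega_gt0 n : 0 < omega n. Proof. exact: lt_le_trans (omega_ge1 n). Qed.

Lemma wt_gt0 r n : 0 < wt r n. Proof. by rewrite powR_gt0// omega_gt0. Qed.

Lemma wt_ge0 r n : 0 <= wt r n. Proof. exact: ltW (wt_gt0 r n). Qed.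

Lemma wtD a b n : wt (a + b) n = wt a n * wt b n.
Proof.
rewrite /wt mulrDr powRD//; apply/implyP => _.
by rewrite gt_eqF// omega_gt0.
Qed.

Lemma wt0 n : wt 0 n = 1. Proof. by rewrite /wt mulr0 powRr0. Qed.

Lemma wtN a n : wt (- a) n = (wt a n)^-1.
Proof. by rewrite /wt mulrN powRN. Qed.

Lemma wtNK a n : wt a n * wt (- a) n = 1.
Proof. by rewrite -wtD subrr wt0. Qed.

Lemma ler_wt a b n : a <= b -> wt a n <= wt b n.
Proof. by move=> ab; rewrite /wt ler_powR ?omega_ge1// ler_pM2l. Qed.

Lemma sum_halves_le (M : nat) (F : nat -> R) (G : nat -> R) :
  (forall n, F n <= G n./2) -> (forall k, 0 <= F k) ->
  \sum_(0 <= n < M) F n <= 2 * \sum_(0 <= k < M) G k.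
Proof.
move=> FG F0; apply: (@le_trans _ _ (\sum_(0 <= n < M.*2) F n)).
  by apply: iota_mono => //; rewrite -addnn leq_addr.
elim: M => [|M IH]; first by rewrite !big_geq// mulr0.
rewrite doubleS !big_nat_recr//= mulrDr -addrA lerD//.
have h1 := FG M.*2; have h2 := FG M.*2.+1.
rewrite doubleK in h1; rewrite -addn1 halfD doubleK odd_double /= addn0 addn1 in h2.
lra.
Qed.

Lemma wtN_half_le (p : R) n : 0 <= p ->
  wt (- p) n <= (maxn 1 n./2)%:R `^ (- (2 * p)).
Proof.
move=> p0; have m0 : 0 < (maxn 1 n./2)%:R :> R by rewrite ltr0n leq_max.
rewrite wtN /wt powRN lef_pV2 ?posrE ?powR_gt0 ?omega_gt0//.
apply: ge0_ler_powR; rewrite ?nnegrE ?mulr_ge0 ?(ltW (omega_gt0 n)) ?(ltW m0)//.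
rewrite /omega le_max; case: (posnP n./2) => [->|h]; first by rewrite maxn0 lexx.
rewrite (maxn_idPr h) [X in _ || X](_ : _ = true) ?orbT//.
have := @pi_ge2 R; have : 0 <= n./2%:R :> R by rewrite ler0n.
nra.
Qed.

(** The factor [2] counts a cosine and a sine for each frequency, the [1] is the frequency [0], and
    the inverse is the zeta bound at the exponent [2 * p > 1]. *)
Definition zetaC (p : R) : R := 2 * (1 + (1 - 2 `^ (1 - 2 * p))^-1).

Lemma sum_wtN_le (p : R) M : 2^-1 < p ->
  \sum_(0 <= n < M) wt (- p) n <= zetaC p.
Proof.
move=> hp.
have p0 : 0 <= p by lra.
apply: le_trans (@sum_halves_le M _ (fun k => (maxn 1 k)%:R `^ (- (2 * p)))
  (fun n => wtN_half_le n p0) (wt_ge0 _)) _.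
rewrite ler_pM2l//.
case: M => [|M].
  by rewrite big_geq// addr_ge0// invr_ge0 subr_ge0 -[X in _ <= X](powRr0 2) ler_powR ?ler1n//; lra.
rewrite big_nat_recl//= (_ : maxn 1 0 = 1%N)// powR1 lerD2l.
rewrite (eq_bigr (fun i => i.+1%:R `^ (- (2 * p)))); last by move=> i _; rewrite (maxn_idPr _).
by apply: zeta_partial_le; lra.
Qed.

Lemma zetaC_gt0 (p : R) : 2^-1 < p -> 0 < zetaC p.
Proof.
move=> hp; apply: lt_le_trans (sum_wtN_le 1 hp).
by rewrite big_nat1 wt_gt0.
Qed.

(* Cosines at the even and sines at the odd indices: [n./2] is the frequency. The index
   [1] carries the zero function. *)
Definition psi n (x : R) : R :=
  (if n./2 == 0%N then 1 else Num.sqrt 2) *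
  (if odd n then sin (2 * pi * (n./2)%:R * x) else cos (2 * pi * (n./2)%:R * x)).

Lemma psi1 x : psi 1 x = 0.
Proof. by rewrite /psi /= mulr0 mul0r sin0 mulr0. Qed.

Lemma sqr_psi_le n x : psi n x ^+ 2 <= 2.
Proof.
rewrite /psi exprMn -[leRHS]mulr1 ler_pM ?sqr_ge0//.
  by case: ifP => _; rewrite ?expr1n ?sqr_sqrtr ?ler0n// ler1n.
have := @cos2Dsin2 R (2 * pi * (n./2)%:R * x).
by case: ifP => _; have := sqr_ge0 (sin (2 * pi * (n./2)%:R * x));
  have := sqr_ge0 (cos (2 * pi * (n./2)%:R * x)); lra.
Qed.

Lemma normr_psi_le n x : `|psi n x| <= 2.
Proof.
rewrite -ler_sqr ?nnegrE// -normrX ger0_norm ?sqr_ge0//.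
by apply: le_trans (sqr_psi_le n x) _; rewrite expr2; lra.
Qed.

End Weights.

(** * Sampling on equispaced nodes *)

Section DiscreteOrthogonality.
Context {R : realType}.
Variable N : nat.
Hypothesis N0 : (0 < N)%N.

Let node (l : nat) : R := l%:R / N%:R.
Let Nneq0 : N%:R != 0 :> R. Proof. by rewrite pnatr_eq0 -lt0n. Qed.

(** After reduction of [d] modulo [N] the half angle lies strictly between [0] and [pi], and the
    cosine is [1] minus twice the squared sine of the half angle. *)
Lemma cos_period_neq1 d : ~~ (N %| d)%N -> cos (2 * pi * d%:R / N%:R) < 1 :> R.
Proof.
move=> Nd; have r0 : (0 < d %% N)%N by rewrite lt0n.
rewrite {1}(divn_eq d N) natrD natrM.
rewrite (_ : _ / _ = 2 * pi * (d %% N)%:R / N%:R + (pi *+ 2) *+ (d %/ N)); last first.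
  by rewrite -mulrnA -(mulr_natr pi) natrM; field.
rewrite (periodicn (@cosD2pi R)).
rewrite (_ : _ / _ = (pi * (d %% N)%:R / N%:R) *+ 2); last by rewrite -mulr_natl; field.
rewrite cos_mulr2n cos2sin2.
have s0 : 0 < sin (pi * (d %% N)%:R / N%:R) :> R.
  apply: sin_gt0_pi; rewrite -mulrA pmulr_rgt0 ?pi_gt0// divr_gt0 ?ltr0n//=.
  by rewrite gtr_pMr ?pi_gt0// ltr_pdivrMr ?ltr0n// mul1r ltr_nat ltn_mod.
have : 0 < sin (pi * (d %% N)%:R / N%:R) ^+ 2 :> R by rewrite exprn_gt0.
by set t := sin _ ^+ 2 => t0; rewrite mulr2n; lra.
Qed.

(** Moving every node one step further rotates the vector [(C, S)] by the angle [th], while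
    periodicity leaves the two sums unchanged. The identity minus this rotation has determinant
    [2 - 2 * cos th], which is nonzero, so the vector is [0]. *)
Lemma sum_cos_sin_node d : ~~ (N %| d)%N ->
  \sum_(0 <= l < N) cos (2 * pi * d%:R * node l) = 0 /\
  \sum_(0 <= l < N) sin (2 * pi * d%:R * node l) = 0.
Proof.
move=> Nd; set th := 2 * pi * d%:R / N%:R : R.
have argE l : 2 * pi * d%:R * node l = th * l%:R by rewrite /node /th; field.
rewrite (eq_bigr (fun l => cos (th * l%:R))); last by move=> l _; rewrite argE.
rewrite [X in _ /\ X = _](eq_bigr (fun l => sin (th * l%:R))); last by move=> l _; rewrite argE.
have thN : th * N%:R = 0 + (pi *+ 2) *+ d.
  by rewrite /th add0r -mulrnA -(mulr_natr pi) natrM; field.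
have shift (F : R -> R) : F (th * N%:R) = F 0 ->
    \sum_(0 <= l < N) F (th * l%:R + th) = \sum_(0 <= l < N) F (th * l%:R).
  move=> FN; have : \sum_(0 <= l < N.+1) F (th * l%:R) =
      \sum_(0 <= l < N) F (th * l%:R) + F (th * N%:R) by rewrite big_nat_recr.
  rewrite big_nat_recl// mulr0 FN addrC => /addIr <-.
  by apply: eq_bigr => l _; rewrite -natr1 mulrDr mulr1.
set C := \sum_(0 <= l < N) cos _; set S := \sum_(0 <= l < N) sin _.
have hC : cos th * C - sin th * S = C.
  rewrite /C /S -[RHS](shift cos); last by rewrite thN (periodicn (@cosD2pi R)).
  by rewrite !mulr_sumr -sumrB; apply: eq_bigr => l _; rewrite cosD; ring.
have hS : sin th * C + cos th * S = S.
  rewrite /C /S -[RHS](shift sin); last by rewrite thN (periodicn (@sinD2pi R)).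
  by rewrite !mulr_sumr -big_split; apply: eq_bigr => l _ /=; rewrite sinD; ring.
have c1 : cos th < 1 by exact: cos_period_neq1.
have cs := cos2Dsin2 th.
have c0 : 2 - 2 * cos th != 0 by rewrite gt_eqF//; lra.
split; apply: (mulfI c0); rewrite mulr0.
  have -> : (2 - 2 * cos th) * C =
     (1 - cos th) * (C - (cos th * C - sin th * S))
      - sin th * (S - (sin th * C + cos th * S)) + (1 - (cos th ^+ 2 + sin th ^+ 2)) * C.
    by ring.
  by rewrite hC hS cs !subrr !mul0r !mulr0; ring.
have -> : (2 - 2 * cos th) * S =
     (1 - cos th) * (S - (sin th * C + cos th * S))
      + sin th * (C - (cos th * C - sin th * S)) + (1 - (cos th ^+ 2 + sin th ^+ 2)) * S.
  by ring.
by rewrite hC hS cs !subrr !mul0r !mulr0; ring.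
Qed.

Definition cosnode (d : nat) : R := N%:R^-1 * \sum_(0 <= l < N) cos (2 * pi * d%:R * node l).

Lemma cosnodeE d : cosnode d = (N %| d)%N%:R.
Proof.
rewrite /cosnode; have [/dvdnP[q ->]|Nd] := boolP (N %| d)%N; last first.
  by rewrite (sum_cos_sin_node Nd).1 mulr0.
rewrite (eq_bigr (fun=> 1)); last first.
  move=> l _; rewrite (_ : _ * _ = 0 + (pi *+ 2) *+ (q * l)).
    by rewrite (periodicn (@cosD2pi R)) cos0.
  by rewrite add0r -mulrnA -(mulr_natr pi) !natrM /node; field.
by rewrite big_const_nat iter_addr_0 subn0 mulVf.
Qed.

Lemma sinnode0 d : \sum_(0 <= l < N) sin (2 * pi * d%:R * node l) = 0.
Proof.
have [/dvdnP[q ->]|Nd] := boolP (N %| d)%N; last exact: (sum_cos_sin_node Nd).2.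
rewrite big1// => l _; rewrite (_ : _ * _ = 0 + (pi *+ 2) *+ (q * l)).
  by rewrite (periodicn (@sinD2pi R)) sin0.
by rewrite add0r -mulrnA -(mulr_natr pi) !natrM /node; field.
Qed.

Definition gram n m : R := N%:R^-1 * \sum_(0 <= l < N) psi n (node l) * psi m (node l).

Let al (k : nat) : R := if k == 0%N then 1 else Num.sqrt 2.

Let dist (k l : nat) : nat := ((k - l) + (l - k))%N.

Let cosdist k l (x : R) :
  cos (2 * pi * (dist k l)%:R * x) =
  cos (2 * pi * k%:R * x) * cos (2 * pi * l%:R * x) +
  sin (2 * pi * k%:R * x) * sin (2 * pi * l%:R * x).
Proof.
rewrite -cosB /dist; have [kl|/ltnW kl] := leqP k l.
  by rewrite (eqP kl) add0n natrB// -cosN; congr cos; ring.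
by rewrite (eqP kl) addn0 natrB//; congr cos; ring.
Qed.

Let cosadd k l (x : R) :
  cos (2 * pi * (k + l)%:R * x) =
  cos (2 * pi * k%:R * x) * cos (2 * pi * l%:R * x) -
  sin (2 * pi * k%:R * x) * sin (2 * pi * l%:R * x).
Proof. by rewrite -cosD natrD; congr cos; ring. Qed.

Lemma gram_same n m : odd n = odd m -> gram n m =
  al n./2 * al m./2 / 2 *
  ((N %| dist n./2 m./2)%N%:R + (if odd n then -1 else 1) * (N %| (n./2 + m./2))%N%:R).
Proof.
move=> onm; rewrite -!cosnodeE /cosnode /gram.
rewrite [X in _ + X]mulrCA -mulrDr [RHS]mulrCA; congr (_ * _).
rewrite !mulr_sumr -big_split mulr_sumr /=; apply: eq_bigr => l _.
rewrite cosdist cosadd /psi -onm -/(al _) -/(al _).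
by case: (odd n); field.
Qed.

Lemma gram_diff n m : odd n != odd m -> gram n m = 0.
Proof.
have key k l : \sum_(0 <= i < N) sin (2 * pi * k%:R * node i) * cos (2 * pi * l%:R * node i) = 0.
  have := sinnode0 (k + l); have hd := sinnode0 (dist k l).
  have -> : \sum_(0 <= i < N) sin (2 * pi * (k + l)%:R * node i) =
   \sum_(0 <= i < N) sin (2 * pi * k%:R * node i) * cos (2 * pi * l%:R * node i) +
   \sum_(0 <= i < N) cos (2 * pi * k%:R * node i) * sin (2 * pi * l%:R * node i).
    by rewrite -big_split; apply: eq_bigr => i _ /=; rewrite -sinD natrD; congr sin; ring.
  have : \sum_(0 <= i < N) sin (2 * pi * k%:R * node i) * cos (2 * pi * l%:R * node i) -
   \sum_(0 <= i < N) cos (2 * pi * k%:R * node i) * sin (2 * pi * l%:R * node i) = 0.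
    rewrite -sumrB (eq_bigr (fun i => sin (2 * pi * k%:R * node i - 2 * pi * l%:R * node i))); last first.
      by move=> i _; rewrite sinB.
    move: hd; rewrite /dist; have [kl|/ltnW kl] := leqP k l.
      rewrite (eqP kl) add0n => hd; rewrite -[RHS]oppr0 -[in RHS]hd -sumrN.
      by apply: eq_bigr => i _; rewrite -sinN natrB//; congr sin; ring.
    rewrite (eqP kl) addn0 => hd; rewrite -[RHS]hd.
    by apply: eq_bigr => i _; rewrite natrB//; congr sin; ring.
  lra.
move=> onm; rewrite /gram.
case on : (odd n); case om : (odd m); rewrite ?on ?om// in onm *.
  rewrite (eq_bigr (fun l => al n./2 * al m./2 * (sin (2 * pi * (n./2)%:R * node l) * cos (2 * pi * (m./2)%:R * node l)))).
    by rewrite -mulr_sumr key !mulr0.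
  by move=> l _; rewrite /psi on om -/(al _) -/(al _); ring.
rewrite (eq_bigr (fun l => al n./2 * al m./2 * (sin (2 * pi * (m./2)%:R * node l) * cos (2 * pi * (n./2)%:R * node l)))).
  by rewrite -mulr_sumr key !mulr0.
by move=> l _; rewrite /psi on om -/(al _) -/(al _); ring.
Qed.

Let al_bnd k : 0 <= al k /\ al k ^+ 2 <= 2.
Proof.
rewrite /al; case: ifP => _; first by split=> //; rewrite expr1n ler1n.
by rewrite sqrtr_ge0 sqr_sqrtr.
Qed.

(** Below the Nyquist frequency [N / 2] the sum and the difference of two distinct frequencies are
    positive and smaller than [N], hence not multiples of [N]. *)
Lemma gram_low_neq n m : (2 * n./2 < N)%N -> (2 * m./2 < N)%N -> n != m -> gram n m = 0.
Proof.
move=> ln lm nm; have [onm|] := eqVneq (odd n) (odd m); last exact: gram_diff.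
have hnm : n./2 != m./2.
  by apply: contraNneq nm => h; rewrite -(odd_double_half n) -(odd_double_half m) h onm.
rewrite gram_same// !gtnNdvd ?mulr0 ?addr0 ?mulr0//; move: hnm; rewrite /dist; lia.
Qed.

Lemma gram_low_eq n : (2 * n./2 < N)%N -> n != 1%N -> gram n n = 1.
Proof.
move=> ln n1; rewrite gram_same// /dist subnn dvdn0. rewrite mulr1n.
have [n0|n0] := eqVneq n./2 0%N.
  have -> : n = 0%N by move: n0 n1; case: n {ln} => [|[|?]].
  by rewrite /= /al /= dvdn0 mulr1n; field.
rewrite gtnNdvd ?mulr0 ?addr0 ?mulr1; last 2 first.
- by rewrite addn_gt0 lt0n n0.
- by rewrite addnn -mul2n.
by rewrite /al (negbTE n0) -expr2 sqr_sqrtr// divff.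
Qed.

(** On the grid the frequencies [k] and [l] cannot be told apart if [k = l] or [k = - l] modulo [N];
    each summand detects one of these cases. *)
Definition alias (k l : nat) : R := (k == l %[mod N])%:R + ((k + l) %% N == 0)%N%:R.

Lemma alias_ge0 k l : 0 <= alias k l. Proof. by rewrite addr_ge0. Qed.

Lemma normr_gram_le n m : `|gram n m| <= alias n./2 m./2.
Proof.
have [onm|/gram_diff ->] := eqVneq (odd n) (odd m); last by rewrite normr0 alias_ge0.
rewrite gram_same// /alias.
have -> : (N %| dist n./2 m./2)%N = (n./2 == m./2 %[mod N]).
  rewrite /dist; have [kl|/ltnW kl] := leqP n./2 m./2.
    by rewrite (eqP kl) add0n eq_sym eqn_mod_dvd.
  by rewrite (eqP kl) addn0 eqn_mod_dvd.
rewrite -/(N %| (n./2 + m./2))%N normrM -[leRHS]mul1r ler_pM ?normr_ge0//.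
  have [a1 a2] := al_bnd n./2; have [b1 b2] := al_bnd m./2.
  rewrite ger0_norm ?divr_ge0 ?mulr_ge0//.
  have := sqr_ge0 (al n./2 - al m./2); rewrite ler_pdivrMr//; nra.
apply: le_trans (ler_normD _ _) _; rewrite lerD ?normr_nat//.
by rewrite normrM normr_nat; case: ifP => _; rewrite ?normrN1 ?normr1 mul1r.
Qed.

Lemma sum_uniq_le1 (P : pred nat) M :
  (forall a b, (a < M)%N -> (b < M)%N -> P a -> P b -> a = b) ->
  \sum_(0 <= r < M) (P r)%:R <= 1 :> R.
Proof.
elim: M => [|M IH] hP; first by rewrite big_geq.
rewrite big_nat_recr//=; case PM : (P M); last first.
  by rewrite addr0; apply: IH => a b aM bM; apply: hP; exact: leqW.
rewrite big_nat big1 ?add0r// => a /= aM.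
case Pa : (P a) => //; have := hP a M (ltnW aM) (ltnSn M) Pa PM.
by move=> aE; rewrite aE ltnn in aM.
Qed.

(** Each of the two congruences has at most one solution in a block of [N] consecutive frequencies.
    Tails are later cut into such blocks. *)
Lemma sum_alias_le2 k q : \sum_(0 <= r < N) alias k (q * N + r) <= 2.
Proof.
rewrite big_split /= -[X in _ <= X]/(1 + 1) lerD//; apply: sum_uniq_le1 => a b aN bN.
  by rewrite !modnMDl (modn_small aN) (modn_small bN) => /eqP -> /eqP.
rewrite !(addnC k) -!addnA !modnMDl => ha hb.
have : (a + k == b + k %[mod N]) by rewrite (eqP ha) (eqP hb).
by rewrite eqn_modDr !modn_small// => /eqP.
Qed.

Lemma aliasC k l : alias k l = alias l k.
Proof. by rewrite /alias eq_sym addnC. Qed.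

End DiscreteOrthogonality.

Lemma cvg_sumr (R : realType) (I : Type) (r : seq I) (P : pred I)
    (F : I -> nat -> R) (a : I -> R) :
  (forall i, P i -> F i n @[n --> \oo] --> a i) ->
  \sum_(i <- r | P i) F i n @[n --> \oo] --> \sum_(i <- r | P i) a i.
Proof.
move=> h; elim: r => [|i r IH].
  by rewrite big_nil; under eq_fun do rewrite big_nil; exact: cvg_cst.
rewrite big_cons; under eq_fun do rewrite big_cons.
by case: ifPn => // Pi; apply: cvgD => //; exact: h.
Qed.

Lemma cvg_sum_nat0 (R : realType) (N : nat) (c : nat -> R) (F : nat -> nat -> R) :
  (forall l, (l < N)%N -> F l n @[n --> \oo] --> 0) ->
  \sum_(0 <= l < N) c l * F l n @[n --> \oo] --> 0.
Proof.
move=> h; rewrite [X in _ --> X](_ : 0 = \sum_(0 <= l < N | (0 <= l < N)%N) c l * 0).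
  under eq_fun do rewrite big_nat.
  by apply: cvg_sumr => l /= lN; apply: cvgM; [exact: cvg_cst|exact: h].
by rewrite big1// => l _; rewrite mulr0.
Qed.

(** * Aliasing estimates and interpolation of coefficient sequences *)

Section Sampling.
Context {R : realType}.
Variables (p : R) (N : nat).
Hypothesis hp : 2^-1 < p.
Hypothesis N0 : (0 < N)%N.

Let node (l : nat) : R := l%:R / N%:R.
(** The value [2 * pi * (N / 2)] that separates the frequencies called [low] from the others. *)
Let H : R := pi * N%:R.
Let zC : R := (1 - 2 `^ (1 - 2 * p))^-1.
Let low n := (2 * n./2 < N)%N.
Let p0 : 0 < p. Proof. by move: hp; lra. Qed.
Let H0 : 0 < H. Proof. by rewrite /H mulr_gt0 ?pi_gt0 ?ltr0n. Qed.
Let zC0 : 0 <= zC.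
Proof. by apply: le_trans (zeta_partial_le 0 _); [rewrite big_geq | move: hp; lra]. Qed.

Lemma big_nat_mul (M : nat) (F : nat -> R) :
  \sum_(0 <= l < M * N) F l = \sum_(0 <= q < M) \sum_(0 <= r < N) F (q * N + r)%N.
Proof.
elim: M => [|M IH]; first by rewrite !big_geq.
rewrite big_nat_recr//= -IH mulSn addnC (big_cat_nat (leq0n (M * N)))/= ?leq_addr//.
congr (_ + _); rewrite -{1}[(M * N)%N]add0n big_addn addKn.
by apply: eq_bigr => r _; rewrite addnC.
Qed.

(** In the block [q = l %/ N] one has [(q + 1) * N <= 2 * l]: for [q = 0] this is the hypothesis,
    and for [q >= 1] it follows from [q + 1 <= 2 * q]. The tail is thus compared, block by block,
    with a zeta series. *)
Lemma high_wt_le l : (N <= 2 * l)%N ->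
  wt (- p) l.*2 <= H `^ (- (2 * p)) * (l %/ N).+1%:R `^ (- (2 * p)).
Proof.
move=> hl; rewrite -powRM ?ler0n ?(ltW H0)// wtN /wt powRN.
have HS : 0 < H * (l %/ N).+1%:R by rewrite mulr_gt0 ?ltr0n.
rewrite lef_pV2 ?posrE ?powR_gt0 ?omega_gt0//.
apply: ge0_ler_powR; rewrite ?nnegrE ?(ltW (omega_gt0 _)) ?(ltW HS) ?mulr_ge0 ?(ltW p0)//.
rewrite /omega le_max doubleK /H; apply/orP; right.
rewrite -mulrA [2 * _]mulrC -!mulrA ler_pM2l ?pi_gt0// mulrC -!natrM ler_nat.
have := divn_eq l N; have := ltn_pmod l N0.
set q := (l %/ N)%N; set r := (l %% N)%N => rN lE.
case: (posnP q) => [->|q0]; first lia.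
have : (N <= q * N)%N by rewrite leq_pmull.
lia.
Qed.

(** The [4] is a factor [2] for cosine and sine times a factor [2] for the two aliases in each
    block; [zC] bounds the sum over the blocks. *)
Lemma high_alias_sum k M :
  \sum_(0 <= m < M | ~~ low m) alias N k m./2 * wt (- p) m <= 4 * zC * H `^ (- (2 * p)).
Proof.
rewrite big_mkcond /=.
pose G (l : nat) : R := if (N <= 2 * l)%N then alias N k l * wt (- p) l.*2 else 0.
have G0 l : 0 <= G l by rewrite /G; case: ifP => // _; rewrite mulr_ge0 ?alias_ge0 ?wt_ge0.
have wtE m : wt (- p) m = wt (- p) (m./2).*2 :> R by rewrite /wt /omega doubleK.
apply: (@le_trans _ _ (2 * \sum_(0 <= l < M) G l)).
  apply: sum_halves_le => m.
    by rewrite /low -leqNgt /G -wtE.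
  by case: ifP => // _; rewrite mulr_ge0 ?alias_ge0 ?wt_ge0.
suff h : \sum_(0 <= l < M) G l <= 2 * zC * H `^ (- (2 * p)) by move: h; lra.
apply: (@le_trans _ _ (\sum_(0 <= l < M * N) G l)).
  by apply: iota_mono => //; rewrite leq_pmulr.
rewrite big_nat_mul.
apply: (@le_trans _ _ (\sum_(0 <= q < M) 2 * H `^ (- (2 * p)) * q.+1%:R `^ (- (2 * p)))).
  apply: ler_sum => q _.
  rewrite -mulrA; set c := H `^ _ * _.
  have c0 : 0 <= c by rewrite mulr_ge0 ?powR_ge0.
  apply: (@le_trans _ _ (\sum_(0 <= r < N) alias N k (q * N + r) * c)).
    rewrite big_nat [X in _ <= X]big_nat; apply: ler_sum => r /= rN.
    rewrite /G; case: ifPn => h; last by rewrite mulr_ge0 ?alias_ge0.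
    rewrite ler_wpM2l ?alias_ge0//; apply: le_trans (high_wt_le h) _.
    by rewrite divnMDl// divn_small// addn0.
  by rewrite -mulr_suml ler_wpM2r// sum_alias_le2.
rewrite -mulr_sumr -!mulrA ler_pM2l// mulrC ler_wpM2r ?powR_ge0//.
by apply: zeta_partial_le; move: hp; lra.
Qed.

(** The low frequencies lie in the single block [q = 0]. Low indices are at most [N], with equality
    for a sine when [N] is odd, hence the range [N.+1]. *)
Lemma low_alias_sum l : \sum_(0 <= n < N.+1 | low n) alias N n./2 l <= 4 :> R.
Proof.
rewrite big_mkcond /=.
pose G (k : nat) : R := if (2 * k < N)%N then alias N k l else 0.
apply: (@le_trans _ _ (2 * \sum_(0 <= k < N.+1) G k)).
  apply: sum_halves_le => m; first by [].
  by case: ifP => // _; rewrite alias_ge0.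
rewrite big_nat_recr//= [G N]/G ltnNge leq_pmull//= addr0.
have -> : 4 = 2 * 2 :> R by ring.
rewrite ler_pM2l//; apply: le_trans (@sum_alias_le2 R N l 0).
apply: ler_sum => k _; rewrite /G mul0n add0n aliasC.
by case: ifP => // _; rewrite alias_ge0.
Qed.

Lemma low_wt_le s n : 0 <= s -> low n -> wt s n <= H `^ (2 * s).
Proof.
move=> s0 ln; apply: ge0_ler_powR; rewrite ?nnegrE ?(ltW (omega_gt0 _)) ?(ltW H0) ?mulr_ge0//.
rewrite /omega ge_max /H; apply/andP; split.
  have := @pi_ge2 R; have : 1 <= N%:R :> R by rewrite ler1n.
  nra.
rewrite -mulrA mulrCA ler_pM2l ?pi_gt0// -natrM ler_nat; exact: ltnW.
Qed.

Lemma high_wt_le' s n : s <= p -> ~~ low n -> wt s n <= H `^ (2 * (s - p)) * wt p n.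
Proof.
move=> sp; rewrite /low -leqNgt => ln.
have -> : wt s n = wt (s - p) n * wt p n by rewrite -wtD subrK.
rewrite ler_wpM2r ?wt_ge0// -(opprB p s) mulrN powRN wtN lef_pV2 ?posrE ?wt_gt0 ?powR_gt0//.
apply: ge0_ler_powR; rewrite ?nnegrE ?(ltW (omega_gt0 _)) ?(ltW H0) ?mulr_ge0 ?subr_ge0//.
rewrite /omega le_max /H; apply/orP; right.
by rewrite -mulrA mulrCA ler_pM2l ?pi_gt0// -natrM ler_nat.
Qed.

(** [16] is the product of the constants [4] in [high_alias_sum] and [low_alias_sum]; the [1] is the
    share of the high frequencies. *)
Definition sampC : R := 16 * zC + 1.

Let sqs (w x : nat -> R) M := sqsum (index_iota 0) w x M.

(* On the grid the low frequencies are aliases of the high ones: testing the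
   samples of [e] against [psi n] expresses [e n] through the tail of [e]. *)
Lemma low_coef_cvg (e : nat -> R) n :
  (forall l, (l < N)%N ->
    \sum_(0 <= m < M) e m * psi m (node l) @[M --> \oo] --> 0) ->
  low n -> n != 1%N ->
  \sum_(0 <= m < M | ~~ low m) gram N n m * e m @[M --> \oo] --> - e n.
Proof.
move=> hv ln n1.
have h : \sum_(0 <= m < M) gram N n m * e m @[M --> \oo] --> 0.
  rewrite (_ : (fun M => _) = (fun M => N%:R^-1 * \sum_(0 <= l < N) psi n (node l) *
      \sum_(0 <= m < M) e m * psi m (node l))); last first.
    apply/funext => M.
    transitivity (N%:R^-1 * \sum_(0 <= m < M) \sum_(0 <= l < N) psi n (node l) * (e m * psi m (node l))).
      rewrite mulr_sumr; apply: eq_bigr => m _; rewrite /gram -mulrA mulr_suml.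
      by congr (_ * _); apply: eq_bigr => l _; rewrite /node; ring.
    by rewrite exchange_big /=; congr (_ * _); apply: eq_bigr => l _; rewrite mulr_sumr.
  rewrite -[X in _ --> X](mulr0 N%:R^-1); apply: cvgM; first exact: cvg_cst.
  exact: cvg_sum_nat0.
rewrite -[X in _ --> X]add0r.
have : \sum_(0 <= m < M) gram N n m * e m - e n @[M --> \oo] --> 0 - e n.
  by apply: cvgB => //; exact: cvg_cst.
apply: cvg_trans; apply: near_eq_cvg; near=> M.
have nM : (n < M)%N by near: M; exact: nbhs_infty_gt.
have lowsum : \sum_(0 <= m < M | low m) gram N n m * e m = e n.
  rewrite big_mkcond (bigD1_seq n)/= ?mem_index_iota ?iota_uniq// ln gram_low_eq// mul1r.
  rewrite big1 ?addr0// => m mn; case: ifP => // lm.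
  by rewrite gram_low_neq ?mul0r// eq_sym.
by rewrite [X in X - _](bigID low)/= lowsum; ring.
Unshelve. all: by end_near. Qed.

(** A Schur test with the kernel [alias]. Cauchy-Schwarz splits [alias * |e m|] with the weights
    [wt (- p)] and [wt p]; the first factor is summed over the high [m] by [high_alias_sum], and the
    second, after exchanging the sums, over the low [n] by [low_alias_sum]. *)
Lemma low_coef_sum (e : nat -> R) (D : R) :
  e 1%N = 0 ->
  (forall l, (l < N)%N ->
    \sum_(0 <= m < M) e m * psi m (node l) @[M --> \oo] --> 0) ->
  (forall M, sqs (wt p) e M <= D) ->
  \sum_(0 <= n < N.+1 | low n) e n ^+ 2 <= 16 * zC * H `^ (- (2 * p)) * D.
Proof.
move=> e1 hv hD.
set A := 4 * zC * H `^ (- (2 * p)).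
have A0 : 0 <= A by rewrite !mulr_ge0 ?powR_ge0.
(* The index [1] is set to [0] by hand: [psi 1] vanishes, so the samples carry no information on
   [e 1]. *)
pose h n M : R := if n == 1%N then 0 else \sum_(0 <= m < M | ~~ low m) gram N n m * e m.
have hc : \sum_(0 <= n < N.+1 | low n) h n M * h n M @[M --> \oo] -->
   \sum_(0 <= n < N.+1 | low n) e n ^+ 2.
  apply: cvg_sumr => n ln.
  have he : h n M @[M --> \oo] --> - e n.
    rewrite /h; have [->|n1] := eqVneq n 1%N; first by rewrite e1 oppr0; exact: cvg_cst.
    exact: low_coef_cvg.
  by rewrite -sqrrN expr2; exact: cvgM.
apply: (cvgr_to_le hc); near=> M.
have step n : h n M * h n M <= A * \sum_(0 <= m < M | ~~ low m) alias N n./2 m./2 * (wt p m * e m ^+ 2).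
  have R0 : 0 <= \sum_(0 <= m < M | ~~ low m) alias N n./2 m./2 * (wt p m * e m ^+ 2).
    apply: sumr_ge0 => m _; apply: mulr_ge0; first exact: alias_ge0.
    by rewrite mulr_ge0 ?wt_ge0 ?sqr_ge0.
  rewrite /h; case: ifP => _; first by rewrite mul0r mulr_ge0.
  rewrite -expr2; apply: (@le_trans _ _ ((\sum_(0 <= m < M | ~~ low m) alias N n./2 m./2 * `|e m|) ^+ 2)).
    rewrite -[leLHS]ger0_norm ?sqr_ge0// normrX ler_sqr ?nnegrE ?normr_ge0//; last first.
      by apply: sumr_ge0 => m _; rewrite mulr_ge0 ?alias_ge0.
    apply: le_trans (ler_norm_sum _ _ _) _; apply: ler_sum => m _.
    by rewrite normrM ler_wpM2r// normr_gram_le.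
  apply: le_trans; last exact: (ler_wpM2r R0 (high_alias_sum n./2 M)).
  rewrite -!(big_filter _ (fun m => ~~ low m)).
  have := sum_sqr_cauchy_schwarz [seq i <- index_iota 0 M | ~~ low i]
    (fun m => Num.sqrt (alias N n./2 m./2 * wt (- p) m))
    (fun m => Num.sqrt (alias N n./2 m./2 * wt p m) * `|e m|).
  rewrite [X in X ^+ 2 <= _ -> _](eq_bigr (fun m => alias N n./2 m./2 * `|e m|)); last first.
    move=> m _; rewrite mulrA -sqrtrM ?mulr_ge0 ?alias_ge0 ?wt_ge0//.
    by rewrite mulrACA [wt _ _ * _]mulrC wtNK mulr1 -expr2 sqrtr_sqr ger0_norm ?alias_ge0.
  rewrite [X in _ <= X * _ -> _](eq_bigr (fun m => alias N n./2 m./2 * wt (- p) m)); last first.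
    by move=> m _; rewrite sqr_sqrtr ?mulr_ge0 ?alias_ge0 ?wt_ge0.
  rewrite [X in _ <= _ * X -> _](eq_bigr (fun m => alias N n./2 m./2 * (wt p m * e m ^+ 2)))//.
  by move=> m _; rewrite exprMn sqr_sqrtr ?mulr_ge0 ?alias_ge0 ?wt_ge0// real_normK ?num_real// mulrA.
apply: (@le_trans _ _ (\sum_(0 <= n < N.+1 | low n)
    A * \sum_(0 <= m < M | ~~ low m) alias N n./2 m./2 * (wt p m * e m ^+ 2))).
  by apply: ler_sum => n _; exact: step.
rewrite -mulr_sumr exchange_big /=.
rewrite (_ : 16 * zC * _ * D = A * (4 * D)); last by rewrite /A; ring.
rewrite ler_wpM2l//.
apply: (@le_trans _ _ (4 * \sum_(0 <= m < M) wt p m * e m ^+ 2)); last first.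
  by rewrite ler_pM2l//; exact: hD.
rewrite mulr_sumr big_mkcond /=; apply: ler_sum => m _.
have w0 : 0 <= wt p m * e m ^+ 2 by rewrite mulr_ge0 ?wt_ge0 ?sqr_ge0.
case: ifP => _; last by rewrite mulr_ge0.
by rewrite -mulr_suml ler_wpM2r// low_alias_sum.
Unshelve. all: by end_near. Qed.

(** The high frequencies gain [H ^ (2 * (s - p))] from the comparison of the weights alone. On the
    low ones [wt s] is at most [H ^ (2 * s)], and [low_coef_sum] supplies the missing factor
    [H ^ (- 2 * p)]. *)
Lemma sampling_bound (e : nat -> R) (D s : R) : 0 <= s -> s <= p ->
  e 1%N = 0 ->
  (forall l, (l < N)%N ->
    \sum_(0 <= m < M) e m * psi m (node l) @[M --> \oo] --> 0) ->
  (forall M, sqs (wt p) e M <= D) ->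
  forall M, sqs (wt s) e M <= sampC * H `^ (2 * (s - p)) * D.
Proof.
move=> s0 sp e1 hv hD M.
have D0 : 0 <= D by apply: le_trans (hD 0%N); rewrite /sqs /sqsum big_geq.
rewrite /sqs /sqsum (bigID low)/= /sampC mulrDl mul1r mulrDl lerD//; last first.
  apply: le_trans (ler_wpM2l (powR_ge0 _ _) (hD M)).
  rewrite /sqs /sqsum mulr_sumr big_mkcond /=; apply: ler_sum => m _; case: ifPn => lm.
    by rewrite [leRHS]mulrA ler_wpM2r ?sqr_ge0 ?high_wt_le'.
  by rewrite mulr_ge0 ?powR_ge0// mulr_ge0 ?wt_ge0 ?sqr_ge0.
rewrite (_ : 16 * zC * _ * D = H `^ (2 * s) * (16 * zC * H `^ (- (2 * p)) * D)); last first.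
  rewrite mulrBr powRD; last by apply/implyP => _; rewrite gt_eqF.
  by ring.
apply: le_trans (ler_wpM2l (powR_ge0 _ _) (low_coef_sum e1 hv hD)).
rewrite mulr_sumr.
apply: (@le_trans _ _ (\sum_(0 <= m < M | low m) H `^ (2 * s) * e m ^+ 2)).
  by apply: ler_sum => m lm; rewrite ler_wpM2r ?sqr_ge0// low_wt_le.
rewrite [leRHS]big_mkcond [leLHS]big_mkcond /=.
have [MN|NM] := leqP M N.+1.
  by apply: (@iota_mono R) => // m; case: ifP => // _; rewrite mulr_ge0 ?powR_ge0 ?sqr_ge0.
rewrite (big_cat_nat (leq0n N.+1) (ltnW NM))/= -[leRHS]addr0 lerD//.
rewrite big_nat big1// => m /andP[Nm _]; case: ifPn => // lm.
by move: lm Nm; rewrite /low; lia.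
Qed.

(* The kernel [kappa(., x_l)] has the coefficients [wt (- p) n * psi n x_l]: [y] is the
   interpolant of [x] on the grid, in terms of coefficients. *)
Definition isproj (x y : nat -> R) :=
  (exists c : nat -> R, forall n, y n = wt (- p) n * \sum_(0 <= l < N) c l * psi n (node l)) /\
  (forall l, (l < N)%N ->
    \sum_(0 <= m < M) (x m - y m) * psi m (node l) @[M --> \oo] --> 0).

Lemma isproj_range_fin2 (y c : nat -> R) :
  (forall n, y n = wt (- p) n * \sum_(0 <= l < N) c l * psi n (node l)) ->
  fin2 (index_iota 0) (wt p) y.
Proof.
move=> hy; pose K := \sum_(0 <= l < N) `|c l| * 2.
exists (K ^+ 2 * zetaC p) => M; apply: le_trans; last first.
  by apply: ler_wpM2l; [exact: sqr_ge0 | exact: (@sum_wtN_le _ _ M)].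
rewrite mulr_sumr; apply: ler_sum => n _.
rewrite hy; set S := \sum_(0 <= l < N) _.
have -> : wt p n * (wt (- p) n * S) ^+ 2 = S ^+ 2 * wt (- p) n.
  transitivity (wt p n * wt (- p) n * (S ^+ 2 * wt (- p) n)); first by ring.
  by rewrite wtNK mul1r.
rewrite ler_wpM2r ?wt_ge0//.
rewrite -[leLHS]ger0_norm ?sqr_ge0// normrX ler_sqr ?nnegrE ?normr_ge0//; last first.
  by apply: sumr_ge0 => l _; rewrite mulr_ge0.
apply: le_trans (ler_norm_sum _ _ _) _; apply: ler_sum => l _.
by rewrite normrM ler_wpM2l// normr_psi_le.
Qed.

(* Aubin--Nitsche duality: [e] is [H^p]-orthogonal to the discrete space, so
   [|e|_p ^ 2 = <e, x>_p <= |e|_(2p-t) |x|_t], and sampling controls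
   [|e|_(2p-t)] by [|e|_p]. *)
Lemma isproj_bound (x y : nat -> R) (B s t : R) :
  p <= t -> t <= 2 * p -> 0 <= s -> s <= p -> x 1%N = 0 -> isproj x y ->
  (forall M, sqs (wt t) x M <= B) ->
  forall M, sqs (wt s) (fun n => x n - y n) M <=
     sampC ^+ 2 * H `^ (2 * (s - t)) * B.
Proof.
move=> pt tp s0 sp x1 [[c hy] ho] hB M.
set e := fun n => x n - y n.
have y1 : y 1%N = 0 by rewrite hy big1 ?mulr0// => l _; rewrite psi1 mulr0.
have e1 : e 1%N = 0 by rewrite /e x1 y1 subrr.
have fx : fin2 (index_iota 0) (wt p) x.
  exists B => M'; apply: le_trans (hB M'); apply: ler_sum => n _.
  by rewrite ler_wpM2r ?sqr_ge0// ler_wt.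
have fe : fin2 (index_iota 0) (wt p) e.
  by apply: fin2B => //; [exact: iota_mono | exact: wt_ge0 | exact: isproj_range_fin2 hy].
set D := nrm2 (index_iota 0) (wt p) e.
have hD M' : sqs (wt p) e M' <= D.
  by apply: sqsum_le_nrm2 => //; [exact: iota_mono | exact: wt_ge0].
have D0 : 0 <= D by apply: nrm2_ge0 => //; [exact: iota_mono | exact: wt_ge0].
have B0 : 0 <= B by apply: le_trans (hB 0%N); rewrite /sqs /sqsum big_geq.
have C0 : 0 <= sampC by rewrite /sampC addr_ge0// mulr_ge0.
have samp r : 0 <= r -> r <= p -> forall M', sqs (wt r) e M' <= sampC * H `^ (2 * (r - p)) * D.
  by move=> r0 rp; exact: sampling_bound.
(* The weight [wt p] is the geometric mean of [wt (2 * p - t)] and [wt t]; the assumption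
   [p <= t <= 2 * p] places [2 * p - t] between [0] and [p], where the sampling bound applies. *)
have ex_sq M' : (\sum_(0 <= n < M') wt p n * (e n * x n)) ^+ 2 <=
    sampC * H `^ (2 * (p - t)) * D * B.
  have := sum_sqr_cauchy_schwarz (index_iota 0 M')
    (fun n => Num.sqrt (wt (2 * p - t) n) * e n) (fun n => Num.sqrt (wt t n) * x n).
  rewrite [X in X ^+ 2 <= _ -> _](eq_bigr (fun n => wt p n * (e n * x n))); last first.
    move=> n _; rewrite mulrACA -sqrtrM ?wt_ge0// -wtD.
    rewrite (_ : 2 * p - t + t = p + p); last by ring.
    by rewrite wtD -expr2 sqrtr_sqr ger0_norm ?wt_ge0.
  rewrite [X in _ <= X * _ -> _](eq_bigr (fun n => wt (2 * p - t) n * e n ^+ 2)); last first.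
    by move=> n _; rewrite exprMn sqr_sqrtr ?wt_ge0.
  rewrite [X in _ <= _ * X -> _](eq_bigr (fun n => wt t n * x n ^+ 2)); last first.
    by move=> n _; rewrite exprMn sqr_sqrtr ?wt_ge0.
  move=> h; apply: le_trans h _; apply: ler_pM.
  - by apply: sumr_ge0 => n _; rewrite mulr_ge0 ?wt_ge0 ?sqr_ge0.
  - by apply: sumr_ge0 => n _; rewrite mulr_ge0 ?wt_ge0 ?sqr_ge0.
  - apply: le_trans (samp (2 * p - t) _ _ M') _; [lra | lra |].
    by rewrite (_ : 2 * (2 * p - t - p) = 2 * (p - t)); last by ring.
  - exact: hB.
(* Here [x = e + y], and the pairing of [e] with [y] is a finite combination of the Fourier sums of
   [e] at the nodes, which tend to [0]. *)
have exD : \sum_(0 <= n < M') wt p n * (e n * x n) @[M' --> \oo] --> D.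
  have ey : \sum_(0 <= n < M') wt p n * (e n * y n) @[M' --> \oo] --> 0.
    rewrite (_ : (fun M' => _) = (fun M' => \sum_(0 <= l < N) c l *
       \sum_(0 <= n < M') e n * psi n (node l))); last first.
      apply/funext => M'.
      transitivity (\sum_(0 <= n < M') \sum_(0 <= l < N) c l * (e n * psi n (node l))).
        apply: eq_bigr => n _; rewrite hy; set S := \sum_(0 <= l < N) _.
        transitivity (wt p n * wt (- p) n * (e n * S)); first by ring.
        rewrite wtNK mul1r mulr_sumr.
        by apply: eq_bigr => l _; rewrite mulrCA.
      by rewrite exchange_big /=; apply: eq_bigr => l _; rewrite mulr_sumr.
    exact: cvg_sum_nat0.
  have ee : sqs (wt p) e @ \oo --> D.
    by apply: nrm2_cvg => //; [exact: iota_mono | exact: wt_ge0].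
  rewrite -[D]addr0; rewrite (_ : (fun M' => _) = (fun M' => sqs (wt p) e M' +
     \sum_(0 <= n < M') wt p n * (e n * y n))); first exact: cvgD.
  apply/funext => M'; rewrite /sqs /sqsum -big_split /=; apply: eq_bigr => n _.
  by rewrite /e; ring.
have DD : D ^+ 2 <= sampC * H `^ (2 * (p - t)) * D * B.
  rewrite expr2; apply: (cvgr_to_le (cvgM exD exD)); near=> M'.
  exact: ex_sq.
have Dle : D <= sampC * H `^ (2 * (p - t)) * B.
  have [->|Dn] := eqVneq D 0; first by rewrite !mulr_ge0 ?powR_ge0.
  have Dp : 0 < D by rewrite lt_neqAle eq_sym Dn.
  have := DD; rewrite expr2 (_ : _ * D * B = sampC * H `^ (2 * (p - t)) * B * D); last by ring.
  by rewrite (ler_pM2r Dp).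
(* Sampling is used a second time, now to pass from the norm of order [p] to that of order [s];
   hence the square of [sampC]. *)
apply: le_trans (samp s s0 sp M) _.
apply: le_trans (ler_wpM2l _ Dle) _; first by rewrite mulr_ge0 ?powR_ge0.
rewrite (_ : 2 * (s - t) = 2 * (s - p) + 2 * (p - t)); last by ring.
rewrite [X in _ <= _ * X * _]powRD; last by apply/implyP => _; rewrite gt_eqF.
rewrite le_eqVlt; apply/orP; left; apply/eqP; ring.
Unshelve. all: by end_near. Qed.

(** A row or column of the coefficient array of a tensor is a finite combination of coefficient
    sequences; linearity of the relation says how interpolation acts on it. *)
Lemma isproj_lin (I : Type) (r : seq I) (a : I -> R) (x y : I -> nat -> R) :
  (forall i, isproj (x i) (y i)) ->
  isproj (fun n => \sum_(i <- r) a i * x i n) (fun n => \sum_(i <- r) a i * y i n).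
Proof.
move=> h; have [c hc] := choice (fun i => (h i).1).
split.
  exists (fun l => \sum_(i <- r) a i * c i l) => n.
  transitivity (\sum_(i <- r) \sum_(0 <= l < N) wt (- p) n * (a i * c i l * psi n (node l))).
    apply: eq_bigr => i _; rewrite hc mulrCA mulr_sumr mulr_sumr.
    by apply: eq_bigr => l _; ring.
  rewrite exchange_big mulr_sumr /=; apply: eq_bigr => l _.
  by rewrite mulr_suml mulr_sumr.
move=> l lN.
rewrite (_ : (fun M => _) = (fun M => \sum_(i <- r) a i *
   \sum_(0 <= m < M) (x i m - y i m) * psi m (node l))); last first.
  apply/funext => M.
  transitivity (\sum_(0 <= m < M) \sum_(i <- r) a i * ((x i m - y i m) * psi m (node l))).
    apply: eq_bigr => m _; rewrite -sumrB mulr_suml; apply: eq_bigr => i _; ring.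
  by rewrite exchange_big /=; apply: eq_bigr => i _; rewrite mulr_sumr.
rewrite [X in _ --> X](_ : 0 = \sum_(i <- r) a i * 0); last first.
  by rewrite big1// => i _; rewrite mulr0.
by apply: cvg_sumr => i _; apply: cvgM; [exact: cvg_cst|exact: (h i).2].
Qed.

End Sampling.

(** * Sobolev norms of coefficient sequences *)

Section L2finite.
Context d (T : measurableType d) (R : realType).
Variable mu : {measure set T -> \bar R}.
Hypothesis mu1 : (mu setT <= 1)%E.
Implicit Types (f g : T -> R).

Let mufin : mu setT \is a fin_num.
Proof. by rewrite ge0_fin_numE// (le_lt_trans mu1)// ltry. Qed.

Lemma Lfun2_measurable f : f \in Lfun mu 2%:E -> measurable_fun setT f.
Proof. by rewrite inE => /andP[]; rewrite inE. Qed.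

Lemma Lfun2_Lnorm_lty f : f \in Lfun mu 2%:E -> ('N[mu]_2%:E[EFin \o f] < +oo)%E.
Proof. by rewrite inE => /andP[_]; rewrite inE. Qed.

Lemma Lfun2D f g : f \in Lfun mu 2%:E -> g \in Lfun mu 2%:E -> f \+ g \in Lfun mu 2%:E.
Proof. exact: (Lfun_addr_closed mu (lee1n 2)).2. Qed.

Lemma Lfun2N f : f \in Lfun mu 2%:E -> \- f \in Lfun mu 2%:E.
Proof. exact: Lfun_oppr_closed. Qed.

Lemma Lfun2B f g : f \in Lfun mu 2%:E -> g \in Lfun mu 2%:E -> f \- g \in Lfun mu 2%:E.
Proof. by move=> hf hg; exact: Lfun2D hf (Lfun2N hg). Qed.

Lemma bounded_Lfun2 f (c : R) : measurable_fun setT f -> (forall x, `|f x| <= c) ->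
  f \in Lfun mu 2%:E.
Proof.
move=> mf fc; rewrite inE; apply/andP; split; rewrite inE//= /finite_norm unlock poweR_lty//.
apply: (@le_lt_trans _ _ (\int[mu]_x (c `^ 2)%:E)%E).
  apply: ge0_le_integral => //.
  - by move=> x _; rewrite lee_fin powR_ge0.
  - apply/measurable_EFinP; apply: (@measurableT_comp _ _ _ _ _ _ (@powR R ^~ 2)) => //.
    exact: measurableT_comp.
  - move=> x _; rewrite lee_fin ge0_ler_powR ?nnegrE//.
    by rewrite (le_trans _ (fc x)).
by rewrite integral_cst// ltey_eq fin_numM.
Qed.

Lemma Lnorm2_bounded f (c : R) : measurable_fun setT f -> (forall x, `|f x| <= c) ->
  ('N[mu]_2%:E[EFin \o f] <= c%:E)%E.
Proof.
move=> mf fc; have c0 : 0 <= c by exact: le_trans (fc point).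
apply: (@le_trans _ _ ((c `^ 2)%:E `^ 2^-1)%E); last first.
  by rewrite poweR_EFin -powRrM divff// powRr1.
rewrite unlock; apply: gt0_ler_poweR => //.
- by rewrite in_itv/= leey integral_ge0// => x _; rewrite lee_fin powR_ge0.
- by rewrite in_itv/= leey lee_fin powR_ge0.
apply: (@le_trans _ _ (\int[mu]_x (c `^ 2)%:E)%E).
  apply: ge0_le_integral => //.
  - by move=> x _; rewrite lee_fin powR_ge0.
  - apply/measurable_EFinP; apply: (@measurableT_comp _ _ _ _ _ _ (@powR R ^~ 2)) => //.
    exact: measurableT_comp.
  - by move=> x _; rewrite lee_fin ge0_ler_powR ?nnegrE.
by rewrite integral_cst// -[leRHS]mule1 lee_wpmul2l// lee_fin powR_ge0.
Qed.

Lemma Lfun2_integrable f : f \in Lfun mu 2%:E -> mu.-integrable setT (EFin \o f).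
Proof. by move=> hf; apply/Lfun1_integrable; exact: Lfun_subset12. Qed.

Lemma Lfun2_mul_integrable f g : f \in Lfun mu 2%:E -> g \in Lfun mu 2%:E ->
  mu.-integrable setT (EFin \o (f \* g)).
Proof. by move=> hf hg; apply/Lfun1_integrable; exact: Lfun2_mul_Lfun1. Qed.

Lemma Lfun2_Lnorm_fin f : f \in Lfun mu 2%:E -> ('N[mu]_2%:E[EFin \o f])%E \is a fin_num.
Proof. by move=> hf; rewrite ge0_fin_numE ?Lnorm_ge0// Lfun2_Lnorm_lty. Qed.

Lemma normr_Rintegral_mul_le f g (c : R) : f \in Lfun mu 2%:E ->
  measurable_fun setT g -> (forall x, `|g x| <= c) ->
  `|\int[mu]_x (f x * g x)| <= c * fine 'N[mu]_2%:E[EFin \o f]%E.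
Proof.
move=> hf mg gc.
have hg : g \in Lfun mu 2%:E by exact: bounded_Lfun2 gc.
have c0 : 0 <= c by exact: le_trans (gc point).
have ifg : mu.-integrable setT (EFin \o (f \* g)) by exact: Lfun2_mul_integrable.
have h1 : (`|\int[mu]_x ((f \* g)%R x)%:E| <= 'N[mu]_1[EFin \o (f \* g)%R])%E.
  by rewrite Lnorm1; apply: le_abse_integral => //; exact: measurable_int ifg.
have h2 : ('N[mu]_1[EFin \o (f \* g)%R] <= c%:E * 'N[mu]_2%:E[EFin \o f])%E.
  apply: le_trans.
    apply: (@hoelder _ _ _ _ _ _ 2 2) => //; first exact: Lfun2_measurable.
    by rewrite [RHS]splitr !div1r.
  by rewrite muleC lee_wpmul2r ?Lnorm_ge0// Lnorm2_bounded.
have := le_trans h1 h2.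
rewrite -(EFin_normr_Rintegral measurableT ifg) -[X in (_ <= _ * X)%E -> _]fineK ?Lfun2_Lnorm_fin//.
Qed.

End L2finite.

Section Coefficients.
Context {R : realType}.
Implicit Types (f g : R -> R).

Lemma muT_setT : @muT R setT = 1%E.
Proof.
rewrite /muT /mfrestr /= /mrestr setTI lebesgue_measure_itv /= lte01.
by rewrite oppr0 adde0.
Qed.

Lemma muT_le1 : (@muT R setT <= 1)%E. Proof. by rewrite muT_setT. Qed.

Lemma continuous_psi n : continuous (@psi R n).
Proof.
move=> x; rewrite /psi; apply: cvgM; first exact: cvg_cst.
have lin : (fun y : R => 2 * pi * (n./2)%:R * y) @ x --> 2 * pi * (n./2)%:R * x.
  by apply: cvgM; [exact: cvg_cst | exact: cvg_id].
by case: (odd n); [apply: continuous_comp lin _; exact: continuous_sin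
                 | apply: continuous_comp lin _; exact: continuous_cos].
Qed.

Lemma measurable_psi n : measurable_fun setT (@psi R n).
Proof. by apply: continuous_measurable_fun; exact: continuous_psi. Qed.

Lemma psi_Lfun2 n : @psi R n \in Lfun muT 2%:E.
Proof.
by apply: bounded_Lfun2; [exact: muT_le1 | exact: measurable_psi | exact: normr_psi_le].
Qed.

Definition fcoef (f : R -> R) (n : nat) : R := \int[muT]_x (f x * psi n x).

Lemma fcoef_integrable f n : f \in Lfun muT 2%:E ->
  muT.-integrable setT (EFin \o (fun x => f x * psi n x)).
Proof. by move=> hf; apply: Lfun2_mul_integrable => //; exact: psi_Lfun2. Qed.

Lemma fcoefD f g n : f \in Lfun muT 2%:E -> g \in Lfun muT 2%:E ->
  fcoef (f \+ g) n = fcoef f n + fcoef g n.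
Proof.
move=> hf hg; rewrite /fcoef -RintegralD//; try exact: fcoef_integrable.
by apply: eq_Rintegral => x _; rewrite mulrDl.
Qed.

Lemma fcoefB f g n : f \in Lfun muT 2%:E -> g \in Lfun muT 2%:E ->
  fcoef (f \- g) n = fcoef f n - fcoef g n.
Proof.
move=> hf hg; rewrite /fcoef -RintegralB//; try exact: fcoef_integrable.
by apply: eq_Rintegral => x _; rewrite mulrBl.
Qed.

Lemma fcoefZ f a n : f \in Lfun muT 2%:E -> fcoef (fun x => a * f x) n = a * fcoef f n.
Proof.
move=> hf; rewrite /fcoef -RintegralZl//; last exact: fcoef_integrable.
by apply: eq_Rintegral => x _; rewrite mulrA.
Qed.

Lemma fcoefN f n : f \in Lfun muT 2%:E -> fcoef (\- f) n = - fcoef f n.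
Proof.
move=> hf; rewrite -mulN1r -fcoefZ//; apply: eq_Rintegral => x _.
by rewrite /= mulN1r.
Qed.

Lemma fcoef0 n : fcoef (fun=> 0) n = 0.
Proof.
by rewrite /fcoef; under eq_Rintegral do rewrite mul0r; rewrite Rintegral_cst// mul0r.
Qed.

Lemma fcoef_psi1 f : fcoef f 1 = 0.
Proof.
by rewrite /fcoef; under eq_Rintegral do rewrite psi1 mulr0; rewrite Rintegral_cst// mul0r.
Qed.

(** The factor [1/2] undoes the normalization [sqrt 2] of [psi]. Passing from [k] to [- k] only
    changes the sign of the sine integral, which is squared. *)
Lemma fourier_abs2E f (k : int) : f \in Lfun muT 2%:E ->
  fourier_abs2 f k = (if k == 0 then 1 else 2^-1) *
    (fcoef f (absz k).*2 ^+ 2 + fcoef f (absz k).*2.+1 ^+ 2).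
Proof.
move=> hf; set m := absz k.
set th := fun x : R => 2 * pi * m%:R * x.
pose A := \int[muT]_x (f x * cos (th x)).
pose B := \int[muT]_x (f x * sin (th x)).
have mth : measurable_fun setT th.
  by apply: measurable_funM => //; exact: measurable_cst.
have bint (g : R -> R) : measurable_fun setT g -> (forall x, `|g x| <= 1) ->
    muT.-integrable setT (EFin \o (fun x => f x * g x)).
  move=> mg gb; apply: Lfun2_mul_integrable => //.
  exact (bounded_Lfun2 muT_le1 mg gb).
have ci : muT.-integrable setT (EFin \o (fun x => f x * cos (th x))).
  apply: bint => [|x]; last exact: cos_max.
  by apply: measurableT_comp => //; apply: continuous_measurable_fun; exact: continuous_cos.
have si : muT.-integrable setT (EFin \o (fun x => f x * sin (th x))).
  apply: bint => [|x]; last exact: sin_max.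
  by apply: measurableT_comp => //; apply: continuous_measurable_fun; exact: continuous_sin.
have kE x : `|2 * pi * k%:~R * x| = `|th x|.
  by rewrite /th !normrM -intr_norm -natr_absz -/m !normr_nat.
have -> : fourier_abs2 f k = A ^+ 2 + B ^+ 2.
  rewrite /fourier_abs2 /fourier /Cintegral /expi /=.
  rewrite sqr_sqrtr ?addr_ge0 ?sqr_ge0//.
  have -> : \int[muT]_x (f x * cos (- (2 * pi * k%:~R * x)) - 0 * sin (- (2 * pi * k%:~R * x))) = A.
    apply: eq_Rintegral => x _; rewrite mul0r subr0 cosN; congr (_ * _).
    by rewrite -cos_norm kE cos_norm.
  suff [->|->] : \int[muT]_x (f x * sin (- (2 * pi * k%:~R * x)) + 0 * cos (- (2 * pi * k%:~R * x))) = B \/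
     \int[muT]_x (f x * sin (- (2 * pi * k%:~R * x)) + 0 * cos (- (2 * pi * k%:~R * x))) = - B.
  - by [].
  - by rewrite sqrrN.
  have nB : \int[muT]_x (f x * - sin (th x)) = - B.
    rewrite -mulN1r -RintegralZl//; apply: eq_Rintegral => x _; ring.
  case: (intP k) @m @th mth {bint ci} si kE @A @B nB => [|n|n] m th mth si kE A B nB.
  - by right; rewrite -nB; apply: eq_Rintegral => x _; rewrite mul0r addr0 sinN.
  - by right; rewrite -nB; apply: eq_Rintegral => x _; rewrite mul0r addr0 sinN.
  - left; apply: eq_Rintegral => x _; rewrite mul0r addr0; congr (_ * sin _).
    by rewrite /th /m abszN absz_nat rmorphN /=; ring.
have [k0|k0] := eqVneq k 0.
  have m0 : m = 0%N by rewrite /m k0.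
  rewrite m0 /= fcoef_psi1 expr0n /= addr0 mul1r.
  have -> : B = 0.
    rewrite /B /th m0; under eq_Rintegral do rewrite mulr0 mul0r sin0 mulr0.
    by rewrite Rintegral_cst// mul0r.
  rewrite expr0n addr0; congr (_ ^+ 2); apply: eq_Rintegral => x _.
  by rewrite /psi /= mul1r /th m0.
have m0 : m != 0%N by rewrite absz_eq0.
have -> : fcoef f m.*2 = Num.sqrt 2 * A.
  rewrite -RintegralZl//; apply: eq_Rintegral => x _.
  by rewrite /psi odd_double doubleK (negbTE m0) -/(th x); ring.
have -> : fcoef f m.*2.+1 = Num.sqrt 2 * B.
  rewrite -RintegralZl//; apply: eq_Rintegral => x _.
  by rewrite /psi /= odd_double uphalf_double (negbTE m0) -/(th x) /=; ring.
by rewrite !exprMn sqr_sqrtr//; field.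
Qed.

End Coefficients.

Section SobolevNorm.
Context {R : realType}.
Implicit Types (f g : R -> R) (r : R).

(** Both sides are grouped by frequency: the indices [2 k] and [2 k + 1] on the right, the integers
    [k] and [- k] on the left, where the two factors [1/2] of [fourier_abs2E] add up to [1]. *)
Lemma Hnorm2E r f : f \in Lfun muT 2%:E ->
  Hnorm2 r f = (\sum_(n <oo) (wt r n * fcoef f n ^+ 2)%:E)%E.
Proof.
move=> hf; set a := fun n => wt r n * fcoef f n ^+ 2.
have a0 n : 0 <= a n by rewrite mulr_ge0 ?wt_ge0 ?sqr_ge0.
pose b k : \bar R := ((a k.*2)%:E + (a k.*2.+1)%:E)%E.
have b0 k : (0 <= b k)%E by rewrite adde_ge0 ?lee_fin.
have -> : (\sum_(n <oo) (a n)%:E = \sum_(k <oo) b k)%E.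
  have cva : cvgn (fun M => \sum_(0 <= n < M) (a n)%:E)%E.
    by apply: is_cvg_nneseries => n _ _; rewrite lee_fin.
  have := cvg_comp _ _ (@cvg_mulnl 2 isT) cva.
  move=> /cvg_lim <- //; congr (lim (_ @ \oo)%classic); apply/funext => M /=.
  elim: M => [|M IH]; first by rewrite !big_geq.
  by rewrite mul2n doubleS !big_nat_recr//= -IH mul2n -addeA.
rewrite (nneseries_split 0 1)//= add0n big_nat1 /Hnorm2; congr (_ + _)%E.
  rewrite /b /= -EFinD fourier_abs2E//= /a fcoef_psi1 expr0n /= mulr0 !addr0 mul1r.
  by rewrite /wt /omega /= mulr0 (max_idPl _)// powR1 mul1r.
set G := fun k : int => ((2 * pi * `|k%:~R|) `^ (2 * r) * fourier_abs2 f k)%R%:E.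
have G0 k : (0 <= G k)%E.
  by rewrite lee_fin mulr_ge0 ?powR_ge0// sqr_ge0.
have Gb n : (G (Posz n.+1) + G (Negz n) = b n.+1)%E.
  rewrite /G /b !fourier_abs2E//= /a -!EFinD; congr EFin.
  have w1 : wt r n.+1.*2 = (2 * pi * n.+1%:R) `^ (2 * r).
    rewrite /wt /omega doubleK (max_idPr _)//.
    by have := @pi_ge2 R; have : 1 <= n.+1%:R :> R by [rewrite ler1n|]; nra.
  have w2 : wt r n.+1.*2.+1 = (2 * pi * n.+1%:R) `^ (2 * r).
    by rewrite -w1 /wt /omega /= uphalf_double doubleK.
  rewrite w1 w2.
  have -> : `|(Negz n)%:~R| = n.+1%:R :> R by rewrite NegzE mulrNz normrN normr_nat.
  rewrite normr_nat; set c := _ `^ _; set x := fcoef f _; set y := fcoef f _.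
  by field.
rewrite (esumID [set k : int | 0 < k]); last by move=> k _; exact: G0.
have -> : [set k : int | k != 0] `&` [set k : int | 0 < k] = (fun n => Posz n.+1) @` setT.
  apply/seteqP; split => [k /= [k0 kp]|k /= [n _ <-]]; last by split.
  by case: k k0 kp => // -[//|n] _ _; exists n.
have -> : [set k : int | k != 0] `&` ~` [set k : int | 0 < k] = Negz @` setT.
  apply/seteqP; split => [k /= [k0 kp]|k /= [n _ <-]]; last by split.
  case: k k0 kp => [[//|n] _ kp|n _ _]; last by exists n.
  by exfalso; apply: kp.
rewrite !esum_image; last 2 first.
- by move=> x y _ _ [].
- by move=> x y _ _ [].
rewrite -nneseries_esumT; last by move=> n; exact: G0.
rewrite -nneseries_esumT; last by move=> n; exact: G0.
rewrite -nneseriesD; [|by move=> n _ _; exact: G0|by move=> n _ _; exact: G0].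
rewrite -(@nneseries_addn _ _ 1%N b0).
by apply: eq_eseriesr => n _; rewrite addn1 -Gb.
Qed.

Lemma HsobP r f : Hsob r f <->
  f \in Lfun muT 2%:E /\ fin2 (index_iota 0) (wt r) (fcoef f).
Proof.
split=> [[hf hlt]|[hf [B hB]]]; split=> //; last first.
  rewrite Hnorm2E//; apply: (@le_lt_trans _ _ B%:E); last exact: ltry.
  apply: lime_le; first by apply: is_cvg_nneseries => n _ _; rewrite lee_fin mulr_ge0 ?wt_ge0 ?sqr_ge0.
  by near=> M; rewrite sumEFin lee_fin; exact: hB.
exists (fine (Hnorm2 r f)) => M.
rewrite -lee_fin fineK; last first.
  rewrite ge0_fin_numE// Hnorm2E// nneseries_ge0// => n _ _.
  by rewrite lee_fin mulr_ge0 ?wt_ge0 ?sqr_ge0.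
rewrite Hnorm2E// /sqsum -sumEFin; apply: nneseries_lim_ge => n _ _.
by rewrite lee_fin mulr_ge0 ?wt_ge0 ?sqr_ge0.
Unshelve. all: by end_near. Qed.

Lemma Hnorm2_nrm2 r f : Hsob r f ->
  fine (Hnorm2 r f) = nrm2 (index_iota 0) (wt r) (fcoef f).
Proof.
move=> /HsobP[hf fin]; rewrite Hnorm2E//.
have cv : cvgn (sqsum (index_iota 0) (wt r) (fcoef f)).
  by apply: fin2_cvg => //; [exact: iota_mono | exact: wt_ge0].
rewrite /nrm2 -[RHS]/(fine (limn (sqsum (index_iota 0) (wt r) (fcoef f)))%:E) -EFin_lim//.
by congr (fine (lim (_ @ \oo)%classic)); apply/funext => M /=; rewrite sumEFin.
Qed.

Lemma HsobD r f g : Hsob r f -> Hsob r g -> Hsob r (f \+ g).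
Proof.
move=> /HsobP[hf ff] /HsobP[hg fg]; apply/HsobP; split; first exact: Lfun2D.
by apply: (fin2_eq _ (fin2D (@iota_mono R) (wt_ge0 r) ff fg)) => n; rewrite fcoefD.
Qed.

Lemma HsobN r f : Hsob r f -> Hsob r (\- f).
Proof.
move=> /HsobP[hf ff]; apply/HsobP; split; first exact: Lfun2N.
by apply: (fin2_eq _ (fin2N ff)) => n; rewrite fcoefN.
Qed.

Lemma HsobB r f g : Hsob r f -> Hsob r g -> Hsob r (f \- g).
Proof. by move=> hf hg; exact: HsobD hf (HsobN hg). Qed.

Lemma Hsob0 r : Hsob r (fun=> 0).
Proof.
apply/HsobP; split.
  by apply: (bounded_Lfun2 (c := 0) muT_le1) => // x; rewrite normr0.
exists 0 => M; rewrite /sqsum big1// => n _; rewrite fcoef0 expr0n mulr0//.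
Qed.

Lemma Hsob_le r s f : r <= s -> Hsob s f -> Hsob r f.
Proof.
move=> rs /HsobP[hf [B hB]]; apply/HsobP; split=> //; exists B => M.
by apply: le_trans (hB M); apply: ler_sum => n _; rewrite ler_wpM2r ?sqr_ge0// ler_wt.
Qed.

Lemma Hsob_Lfun2 r f : Hsob r f -> f \in Lfun muT 2%:E. Proof. by case. Qed.

(** Polarization is undone term by term, by [(x + y) ^ 2 - (x - y) ^ 2 = 4 * x * y]. Symmetry and
    linearity of [Hinner] are then inherited from finite sums. *)
Lemma Hinner_cvg r f g : Hsob r f -> Hsob r g ->
  \sum_(0 <= n < M) wt r n * (fcoef f n * fcoef g n) @[M --> \oo] --> Hinner r f g.
Proof.
move=> hf hg; rewrite (_ : Hinner r f g =
  (nrm2 (index_iota 0) (wt r) (fcoef (f \+ g)) - nrm2 (index_iota 0) (wt r) (fcoef (f \- g))) / 4);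
  last by congr (_ / 4); exact (congr2 (fun x y => x - y)
    (Hnorm2_nrm2 (HsobD hf hg)) (Hnorm2_nrm2 (HsobB hf hg))).
have cv h : Hsob r h -> sqsum (index_iota 0) (wt r) (fcoef h) @ \oo -->
    nrm2 (index_iota 0) (wt r) (fcoef h).
  by move=> /HsobP[_ fh]; apply: nrm2_cvg => //; [exact: iota_mono | exact: wt_ge0].
rewrite (_ : (fun M => _) = (fun M => (sqsum (index_iota 0) (wt r) (fcoef (f \+ g)) M -
   sqsum (index_iota 0) (wt r) (fcoef (f \- g)) M) / 4)).
  by apply: cvgM; [apply: cvgB; [exact: cv (HsobD hf hg)|exact: cv (HsobB hf hg)]|exact: cvg_cst].
apply/funext => M; rewrite /sqsum -sumrB mulr_suml; apply: eq_bigr => n _.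
by rewrite fcoefD ?fcoefB ?(Hsob_Lfun2 hf) ?(Hsob_Lfun2 hg)//; field.
Qed.

End SobolevNorm.

(** * Algebraic tensors and their coefficient arrays *)

Section CrossNorm.
Context {R : realType}.
Implicit Types (U W : @tensor R) (a b : R).

Definition square (M : nat) : seq (nat * nat) :=
  [seq (i, j) | i <- index_iota 0 M, j <- index_iota 0 M].

Lemma sum_square (F : nat * nat -> R) M :
  \sum_(z <- square M) F z = \sum_(0 <= i < M) \sum_(0 <= j < M) F (i, j).
Proof. exact: big_allpairs_dep. Qed.

Lemma square_mono (F : nat * nat -> R) : (forall i, 0 <= F i) ->
  nondecreasing_seq (fun M => \sum_(i <- square M) F i).
Proof.
move=> F0 M N MN; rewrite !sum_square.
apply: (@le_trans _ _ (\sum_(0 <= i < N) \sum_(0 <= j < M) F (i, j))).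
  by apply: iota_mono => // i; exact: sumr_ge0.
by apply: ler_sum => i _; exact: iota_mono.
Qed.

Definition wt2 a b (z : nat * nat) : R := wt a z.1 * wt b z.2.

Lemma wt2_ge0 a b z : 0 <= wt2 a b z. Proof. by rewrite mulr_ge0 ?wt_ge0. Qed.

Definition tcoef U (z : nat * nat) : R := \sum_(f <- U) fcoef f.1 z.1 * fcoef f.2 z.2.

Definition tensor_in a b U := forall f, f \in U -> Hsob a f.1 /\ Hsob b f.2.

(** Parseval for the tensor norm. Summing over squares makes the partial sum of a product array a
    product of two partial sums of the same order, so that each pair of list entries converges to a
    product of inner products. *)
Lemma cross_norm_cvg a b U : tensor_in a b U ->
  sqsum square (wt2 a b) (tcoef U) @ \oo -->
  \sum_(f <- U) \sum_(g <- U) Hinner a f.1 g.1 * Hinner b f.2 g.2.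
Proof.
move=> hU.
rewrite (_ : sqsum _ _ _ = fun M => \sum_(f <- U) \sum_(g <- U)
   (\sum_(0 <= n < M) wt a n * (fcoef f.1 n * fcoef g.1 n)) *
   (\sum_(0 <= m < M) wt b m * (fcoef f.2 m * fcoef g.2 m))).
  rewrite big_seq; under eq_fun do rewrite big_seq.
  apply: cvg_sumr => f /hU[f1 f2].
  rewrite big_seq; under eq_fun do rewrite big_seq.
  apply: cvg_sumr => g /hU[g1 g2].
  exact: (cvgM (Hinner_cvg f1 g1) (Hinner_cvg f2 g2)).
apply/funext => M; rewrite /sqsum sum_square.
transitivity (\sum_(0 <= n < M) \sum_(0 <= m < M) \sum_(f <- U) \sum_(g <- U)
   (wt a n * (fcoef f.1 n * fcoef g.1 n)) * (wt b m * (fcoef f.2 m * fcoef g.2 m))).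
  apply: eq_bigr => n _; apply: eq_bigr => m _.
  rewrite expr2 /tcoef /= mulr_suml mulr_sumr; apply: eq_bigr => f _.
  rewrite !mulr_sumr; apply: eq_bigr => g _; rewrite /wt2 /=; ring.
transitivity (\sum_(0 <= n < M) \sum_(f <- U) \sum_(g <- U) \sum_(0 <= m < M)
   (wt a n * (fcoef f.1 n * fcoef g.1 n)) * (wt b m * (fcoef f.2 m * fcoef g.2 m))).
  apply: eq_bigr => n _; rewrite exchange_big; apply: eq_bigr => f _ /=.
  by rewrite exchange_big.
rewrite exchange_big; apply: eq_bigr => f _ /=.
rewrite exchange_big; apply: eq_bigr => g _ /=.
by rewrite mulr_suml; apply: eq_bigr => n _; rewrite mulr_sumr.
Qed.

Lemma tcoef_fin2 a b U : tensor_in a b U -> fin2 square (wt2 a b) (tcoef U).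
Proof.
move=> /cross_norm_cvg h; eexists => M; apply: nondecreasing_cvgn_le; last exact: cvgP h.
by apply: sqsum_nd; [exact: square_mono | exact: wt2_ge0].
Qed.

Lemma cross_normE a b U : tensor_in a b U ->
  cross_norm a b U = nrm square (wt2 a b) (tcoef U).
Proof. by move=> /cross_norm_cvg h; rewrite /cross_norm /nrm /nrm2 (cvg_lim _ h). Qed.

Lemma tensor_in_sub a b U W : tensor_in a b U -> tensor_in a b W ->
  tensor_in a b (tensor_sub U W).
Proof.
move=> hU hW f; rewrite mem_cat => /orP[/hU//|/mapP[g /hW[g1 g2] ->]].
by split; [exact (HsobN g1)|exact g2].
Qed.

Lemma tensor_in_le a b c d U : a <= c -> b <= d -> tensor_in c d U -> tensor_in a b U.
Proof.
by move=> ac bd hU f /hU[f1 f2]; split; [exact: Hsob_le f1|exact: Hsob_le f2].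
Qed.

Lemma tcoef_sub a b U W : tensor_in a b W ->
  tcoef (tensor_sub U W) = fun z => tcoef U z - tcoef W z.
Proof.
move=> hW; apply/funext => z; rewrite /tcoef big_cat big_map; congr (_ + _).
rewrite -sumrN big_seq [RHS]big_seq; apply: eq_bigr => f /hW[f1 f2] /=.
by rewrite fcoefN ?mulNr//; exact: Hsob_Lfun2 f1.
Qed.

Lemma nrm_wt2_le a b c d (x : nat * nat -> R) : a <= c -> b <= d ->
  fin2 square (wt2 c d) x ->
  fin2 square (wt2 a b) x /\ nrm square (wt2 a b) x <= nrm square (wt2 c d) x.
Proof.
move=> ac bd fx.
have h M : sqsum square (wt2 a b) x M <= nrm square (wt2 c d) x ^+ 2.
  apply: le_trans (sqsum_le_nrm square_mono (wt2_ge0 c d) M fx).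
  apply: ler_sum => z _; rewrite ler_wpM2r ?sqr_ge0//.
  by rewrite ler_pM ?wt_ge0// ler_wt.
split; first by eexists; exact: h.
by apply: nrm_le => //; [exact: square_mono | exact: wt2_ge0 | exact: nrm_ge0].
Qed.

End CrossNorm.

(** * Orthonormality of the trigonometric basis *)

Section Orthonormality.
Context {R : realType}.

Lemma muTE (A : set (measurableTypeR R)) :
  muT A = @lebesgue_measure R (A `&` `[0 : R, 1]%classic).
Proof. by []. Qed.

Lemma Rintegral_muT (f : R -> R) : muT.-integrable setT (EFin \o f) ->
  \int[muT]_x f x = fine (\int[@lebesgue_measure R]_(x in `[0%R, 1%R]) (f x)%:E)%E.
Proof.
move=> fint; rewrite /Rintegral; congr fine.
rewrite (@negligible_integral _ _ _ _ setT (~` (`[0 : R, 1]%classic : set (measurableTypeR R))))//; last 2 first.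
- exact: measurableC.
- by apply: etrans (muTE _) _; rewrite setICl measure0.
rewrite setTD setCK; apply: eq_measure_integral => A mA AI.
by apply: etrans (muTE _) _; rewrite setIidl.
Qed.

Let arg (d : nat) (x : R) : R := 2 * pi * d%:R * x.

Lemma cos_arg_Lfun2 d : (fun x : R => cos (arg d x)) \in Lfun muT 2%:E.
Proof.
apply: (bounded_Lfun2 (c := 1) muT_le1); last by move=> x; exact: cos_max.
apply: (measurableT_comp (f := @cos R)).
  by apply: continuous_measurable_fun; exact: continuous_cos.
by apply: measurable_funM => //; exact: measurable_cst.
Qed.

Lemma sin_arg_Lfun2 d : (fun x : R => sin (arg d x)) \in Lfun muT 2%:E.
Proof.
apply: (bounded_Lfun2 (c := 1) muT_le1); last by move=> x; exact: sin_max.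
apply: (measurableT_comp (f := @sin R)).
  by apply: continuous_measurable_fun; exact: continuous_sin.
by apply: measurable_funM => //; exact: measurable_cst.
Qed.

Lemma muT_FTC (f F : R -> R) : f \in Lfun muT 2%:E -> continuous f ->
  (forall x : R, is_derive x (1 : R) F (f x)) -> \int[muT]_x f x = F 1 - F 0.
Proof.
move=> hf cf dF; rewrite Rintegral_muT; last exact: (Lfun2_integrable muT_le1).
have cF : continuous F.
  move=> x; apply: differentiable_continuous; apply/derivable1_diffP.
  exact: ex_derive.
rewrite (@continuous_FTC2 _ f F)//.
- by apply: continuous_subspaceT.
- split; first by move=> x _; exact: ex_derive.
    by apply: cvg_at_right_filter; exact: cF.
  by apply: cvg_at_left_filter; exact: cF.
- by move=> x _; rewrite derive1E; exact: derive_val.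
Qed.

Lemma cos_2pin d : cos (2 * pi * d%:R : R) = 1.
Proof.
rewrite (_ : _ * _ = 0 + (pi *+ 2) *+ d); first by rewrite (periodicn (@cosD2pi R)) cos0.
by rewrite add0r -mulrnA -(mulr_natr pi) natrM; ring.
Qed.

Lemma sin_2pin d : sin (2 * pi * d%:R : R) = 0.
Proof.
rewrite (_ : _ * _ = 0 + (pi *+ 2) *+ d); first by rewrite (periodicn (@sinD2pi R)) sin0.
by rewrite add0r -mulrnA -(mulr_natr pi) natrM; ring.
Qed.

Let c_neq0 (d : nat) : (0 < d)%N -> 2 * pi * d%:R != 0 :> R.
Proof. by move=> d0; rewrite gt_eqF// !mulr_gt0 ?pi_gt0 ?ltr0n. Qed.

Let continuous_arg d : continuous (arg d).
Proof. by move=> x; apply: cvgM; [exact: cvg_cst|exact: cvg_id]. Qed.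

Lemma Rintegral_cos_arg d : \int[muT]_x cos (arg d x) = (d == 0%N)%:R.
Proof.
have [->|d0] := posnP d.
  under eq_Rintegral do rewrite /arg mulr0 mul0r cos0.
  by rewrite Rintegral_cst// mul1r; exact: (congr1 fine (@muT_setT R)).
apply: etrans; first apply: (@muT_FTC _ (fun x => (2 * pi * d%:R)^-1 * sin (arg d x))); last first.
- by rewrite /arg mulr1 mulr0 sin_2pin sin0 mulr0 subrr.
- move=> x; have -> : cos (arg d x) = (2 * pi * d%:R)^-1 *: (cos (arg d x) * (2 * pi * d%:R) : R).
    by rewrite -[RHS]/(_ * _) mulrCA mulVf ?c_neq0// mulr1.
  have h : is_derive x (1 : R) (fun x => sin (arg d x)) (cos (arg d x) * (2 * pi * d%:R)).
    have ha : is_derive x (1 : R) (arg d) (2 * pi * d%:R).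
      rewrite -[X in is_derive _ _ _ X]mulr1.
      exact: (@is_deriveZ _ _ _ id).
    exact: (is_derive1_comp (is_derive_sin (arg d x)) ha).
  exact: is_deriveZ.
- by move=> x; apply: continuous_comp; [exact: continuous_arg|exact: continuous_cos].
- exact: cos_arg_Lfun2.
Qed.

Lemma Rintegral_sin_arg d : \int[muT]_x sin (arg d x) = 0.
Proof.
have [->|d0] := posnP d.
  under eq_Rintegral do rewrite /arg mulr0 mul0r sin0.
  by rewrite Rintegral_cst// mul0r.
apply: etrans; first apply: (@muT_FTC _ (fun x => - (2 * pi * d%:R)^-1 * cos (arg d x))); last first.
- by rewrite /arg mulr1 mulr0 cos_2pin cos0 subrr.
- move=> x; have -> : sin (arg d x) = - (2 * pi * d%:R)^-1 *: (- sin (arg d x) * (2 * pi * d%:R) : R).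
    by rewrite -[RHS]/(_ * _) !mulNr mulrN opprK mulrCA mulVf ?c_neq0// mulr1.
  have h : is_derive x (1 : R) (fun x => cos (arg d x)) (- sin (arg d x) * (2 * pi * d%:R)).
    have ha : is_derive x (1 : R) (arg d) (2 * pi * d%:R).
      rewrite -[X in is_derive _ _ _ X]mulr1.
      exact: (@is_deriveZ _ _ _ id).
    exact: (is_derive1_comp (is_derive_cos (arg d x)) ha).
  exact: is_deriveZ.
- by move=> x; apply: continuous_comp; [exact: continuous_arg|exact: continuous_sin].
- exact: sin_arg_Lfun2.
Qed.

Let al (k : nat) : R := if k == 0%N then 1 else Num.sqrt 2.

Let dist (k l : nat) : nat := ((k - l) + (l - k))%N.

Let lin2 (f g h : R -> R) (a b : R) : f \in Lfun muT 2%:E -> g \in Lfun muT 2%:E ->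
  (forall x, h x = a * f x + b * g x) ->
  \int[muT]_x h x = a * \int[muT]_x f x + b * \int[muT]_x g x.
Proof.
move=> hf hg hE; under eq_Rintegral do rewrite hE.
have fi := Lfun2_integrable muT_le1 hf; have gi := Lfun2_integrable muT_le1 hg.
have sc (q : R -> R) (c : R) : q \in Lfun muT 2%:E -> muT.-integrable setT (EFin \o (fun x => c * q x)).
  move=> hq; apply: (Lfun2_mul_integrable (f := fun=> c)) => //; exact: Lfun_cst.
rewrite RintegralD//; [|exact: sc|exact: sc].
by rewrite !RintegralZl.
Qed.

Lemma Rintegral_psiM n m : \int[muT]_x (psi n x * psi m x : R) = ((n == m) && (n != 1))%N%:R.
Proof.
have cosdist k l (x : R) : cos (arg (dist k l) x) =
    cos (arg k x) * cos (arg l x) + sin (arg k x) * sin (arg l x).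
  rewrite -cosB /dist /arg; have [kl|/ltnW kl] := leqP k l.
    by rewrite (eqP kl) add0n natrB// -cosN; congr cos; ring.
  by rewrite (eqP kl) addn0 natrB//; congr cos; ring.
have cosadd k l (x : R) : cos (arg (k + l) x) =
    cos (arg k x) * cos (arg l x) - sin (arg k x) * sin (arg l x).
  by rewrite -cosD /arg natrD; congr cos; ring.
(* The absolute difference [dist] forgets the sign of [k - l], which the sine, being odd, needs
   back. *)
have sindist k l (x : R) : (if (k <= l)%N then -1 else 1) * sin (arg (dist k l) x) =
    sin (arg k x) * cos (arg l x) - cos (arg k x) * sin (arg l x).
  rewrite -sinB /dist /arg; have [kl|/ltnW kl] := leqP k l.
    by rewrite (eqP kl) add0n natrB// mulN1r -sinN; congr sin; ring.
  by rewrite (eqP kl) addn0 natrB// mul1r; congr sin; ring.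
have sinadd k l (x : R) : sin (arg (k + l) x) =
    sin (arg k x) * cos (arg l x) + cos (arg k x) * sin (arg l x).
  by rewrite -sinD /arg natrD; congr sin; ring.
have mixed i j : odd i -> ~~ odd j -> \int[muT]_x (psi i x * psi j x : R) = 0.
  move=> oi oj.
  rewrite (@lin2 (fun x => sin (arg (i./2 + j./2) x)) (fun x => sin (arg (dist i./2 j./2) x)) _
    (al i./2 * al j./2 / 2) (al i./2 * al j./2 / 2 * (if (i./2 <= j./2)%N then -1 else 1))).
  - by rewrite !Rintegral_sin_arg !mulr0 addr0.
  - exact: sin_arg_Lfun2.
  - exact: sin_arg_Lfun2.
  - move=> x; rewrite -[X in _ + X]mulrA sindist sinadd /psi oi (negbTE oj) -/(al _) -/(al _) -/(arg _ _) -/(arg _ _).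
    by field.
have [onm|onm] := eqVneq (odd n) (odd m); last first.
  have -> /= : (n == m) = false by apply: contraNF onm => /eqP ->.
  case on : (odd n); case om : (odd m); rewrite ?on ?om// in onm *.
    by rewrite mixed ?on ?om.
  by under eq_Rintegral do rewrite mulrC; rewrite mixed ?on ?om.
rewrite (@lin2 (fun x => cos (arg (dist n./2 m./2) x)) (fun x => cos (arg (n./2 + m./2) x)) _
    (al n./2 * al m./2 / 2) (al n./2 * al m./2 / 2 * (if odd n then -1 else 1))); last 3 first.
- exact: cos_arg_Lfun2.
- exact: cos_arg_Lfun2.
- move=> x; rewrite -[X in _ + X]mulrA cosdist cosadd /psi -onm -/(al _) -/(al _) -/(arg _ _) -/(arg _ _).
  by case: (odd n); field.
rewrite !Rintegral_cos_arg.
have [<-|nm] := eqVneq n m; last first.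
  have hnm : n./2 != m./2.
    by apply: contraNneq nm => h; rewrite -(odd_double_half n) -(odd_double_half m) h onm.
  have -> : (dist n./2 m./2 == 0)%N = false by apply/negP; move: hnm; rewrite /dist; lia.
  have -> : (n./2 + m./2 == 0)%N = false by apply/negP; move: hnm; lia.
  by rewrite !mulr0 addr0.
rewrite /dist subnn addn0 eqxx addnn double_eq0.
have [n0|n0] := eqVneq n./2 0%N.
  have : n = 0%N \/ n = 1%N by move: n0; case: n {onm} => [|[|?]]; [left|right|].
  by case=> ->; rewrite /al /= ?mulr1n ?mulr0n; field.
rewrite mulr0 addr0 mulr1 /al (negbTE n0) -expr2 sqr_sqrtr// divff//.
by have -> : n != 1%N by apply: contraNneq n0 => ->.
Qed.

Lemma fcoef_psi n m : fcoef (psi n : R -> R) m = ((n == m) && (n != 1))%N%:R.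
Proof. exact: Rintegral_psiM. Qed.

End Orthonormality.

(** * Kernel interpolation *)

Section Kernel.
Context {R : realType}.
Variable p : R.
Hypothesis hp : 2^-1 < p.

Let zC0 : 0 < zetaC p. Proof. exact: zetaC_gt0. Qed.

Definition kterm (x y : R) (n : nat) : R := wt (- p) n * psi n x * psi n y.

Lemma normr_kterm_le x y n : `|kterm x y n| <= 4 * wt (- p) n.
Proof.
rewrite /kterm normrM (normrM (wt (- p) n)) ger0_norm ?wt_ge0// -mulrA mulrC ler_wpM2r ?wt_ge0//.
have -> : 4 = 2 * 2 :> R by ring.
by apply: ler_pM => //; exact: normr_psi_le.
Qed.

Lemma kpart_le x y M : `|\sum_(0 <= n < M) kterm x y n| <= 4 * zetaC p.
Proof.
apply: le_trans (ler_norm_sum _ _ _) _.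
apply: le_trans (ler_sum _ (fun n _ => normr_kterm_le x y n)) _.
by rewrite -mulr_sumr ler_pM2l// sum_wtN_le.
Qed.

Lemma kpart_is_cvg x y : cvgn (fun M => \sum_(0 <= n < M) kterm x y n).
Proof.
apply: (@normed_cvg R R^o (kterm x y)); apply: nondecreasing_is_cvgn.
  exact: (@iota_mono R (fun n => `|kterm x y n|) (fun n => normr_ge0 _)).
exists (4 * zetaC p) => _ [M _ <-] /=.
apply: le_trans (ler_sum _ (fun n _ => normr_kterm_le x y n)) _.
by rewrite -mulr_sumr ler_pM2l// sum_wtN_le.
Qed.

Lemma kpart_cvg x y : \sum_(0 <= n < M) kterm x y n @[M --> \oo] --> kappa p y x.
Proof.
set S := fun M => \sum_(0 <= n < M) kterm x y n.
have cS : S @ \oo --> limn S by exact: kpart_is_cvg.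
suff -> : kappa p y x = limn S by [].
rewrite /kappa; set g := (X in limn X).
(* The frequencies up to [n] fill the indices below [2 * (n + 1)]; the subtracted [1] is the index
   [0], which [kappa] adds separately. A limit along these even cutoffs is enough because the full
   series is already known to converge. *)
have gS n : g n = S (2 * n.+1)%N - 1.
  elim: n => [|n IH].
    rewrite /g /S big_geq// muln1 !big_nat_recr//= big_geq// /kterm !psi1 !mulr0 addr0 add0r.
    by rewrite /wt /omega /psi /= !mulr0 !mul0r cos0 (max_idPl _)// powR1 !mulr1 subrr.
  have -> : g n.+1 = g n + (2 * pi * n.+1%:R) `^ (- (2 * p)) * complex.Re
     (expi (2 * pi * n.+1%:R * (y - x)) + expi (2 * pi * - n.+1%:R * (y - x))).
    by rewrite /g big_nat_recr.
  rewrite IH (_ : 2 * n.+2 = (2 * n.+1).+2)%N; last by rewrite !mul2n -doubleS.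
  have SS m : S m.+2 = S m + (kterm x y m + kterm x y m.+1).
    by rewrite /S !big_nat_recr//= addrA.
  rewrite SS addrAC; congr (_ + _ + _); rewrite /expi /= /kterm mul2n.
  have w1 : wt (- p) n.+1.*2 = (2 * pi * n.+1%:R) `^ (- (2 * p)).
    rewrite /wt /omega doubleK (max_idPr _) ?mulrN//.
    by have := @pi_ge2 R; have : 1 <= n.+1%:R :> R by [rewrite ler1n|]; nra.
  have w2 : wt (- p) n.+1.*2.+1 = (2 * pi * n.+1%:R) `^ (- (2 * p)).
    by rewrite -w1 /wt /omega /= uphalf_double doubleK.
  rewrite w1 w2 /psi /= odd_double uphalf_double doubleK /=.
  set c := _ `^ _.
  have -> : 2 * pi * - n.+1%:R * (y - x) = - (2 * pi * n.+1%:R * (y - x)) by ring.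
  rewrite cosN mulrBr cosB.
  set a := 2 * pi * n.+1%:R * y; set b := 2 * pi * n.+1%:R * x.
  transitivity (c * (Num.sqrt 2 ^+ 2 * (cos a * cos b + sin a * sin b))); last by ring.
  by rewrite sqr_sqrtr//; ring.
have cg : g @ \oo --> limn S - 1.
  rewrite (_ : g = fun n => S (2 * n.+1)%N - 1); last by apply/funext => n; exact: gS.
  apply: cvgB; last exact: cvg_cst.
  apply: (cvg_comp (fun n => (2 * n.+1)%N) S) cS.
  apply: (cvg_comp (fun n => n.+1) (muln 2)); last exact: cvg_mulnl.
  rewrite (_ : (fun n => n.+1) = addn^~ 1%N); first exact: cvg_addnr.
  by apply/funext => n; rewrite addn1.
by rewrite (cvg_lim _ cg)// addrC subrK.
Qed.

Lemma normr_kappa_le x y : `|kappa p y x| <= 4 * zetaC p.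
Proof.
have h : `|\sum_(0 <= n < M) kterm x y n| @[M --> \oo] --> `|kappa p y x|.
  by apply: cvg_norm; exact: kpart_cvg.
apply: (cvgr_to_le h); near=> M; exact: kpart_le.
Unshelve. all: by end_near. Qed.

Lemma measurable_kpart x M :
  measurable_fun (setT : set (measurableTypeR R)) (fun y => \sum_(0 <= n < M) kterm x y n).
Proof.
apply: measurable_sum => n; apply: measurable_funM => //; exact: measurable_psi.
Qed.

Lemma measurable_kappa x :
  measurable_fun (setT : set (measurableTypeR R)) (fun y => kappa p y x).
Proof.
apply: (@measurable_fun_cvg _ _ _ _ (fun M y => \sum_(0 <= n < M) kterm x y n)).
  by move=> M; exact: measurable_kpart.
by move=> y _; exact: kpart_cvg.
Qed.

Lemma kappa_Lfun2 x : (fun y => kappa p y x) \in Lfun muT 2%:E.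
Proof. exact (bounded_Lfun2 muT_le1 (measurable_kappa x) (normr_kappa_le x)). Qed.

Lemma Lfun2Z (a : R) (g : R -> R) : g \in Lfun muT 2%:E ->
  (fun y => a * g y) \in Lfun muT 2%:E.
Proof.
move=> hg; rewrite (_ : (fun y => _) = a \o* g).
  by apply: Lfun_scale; rewrite ?ler1n.
by apply/funext => y /=; rewrite mulrC.
Qed.

Lemma Lfun2_lincomb (I : Type) (r : seq I) (c : I -> R) (g : I -> R -> R) :
  (forall i, g i \in Lfun muT 2%:E) ->
  (fun y => \sum_(i <- r) c i * g i y) \in Lfun muT 2%:E.
Proof.
move=> hg; elim: r => [|i r IH].
  under eq_fun do rewrite big_nil.
  exact: (Lfun_cst _ 0).
under eq_fun do rewrite big_cons.
apply: Lfun2D => //.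
exact: Lfun2Z.
Qed.

Lemma fcoef_lincomb (I : Type) (r : seq I) (c : I -> R) (g : I -> R -> R) n :
  (forall i, g i \in Lfun muT 2%:E) ->
  fcoef (fun y => \sum_(i <- r) c i * g i y) n = \sum_(i <- r) c i * fcoef (g i) n.
Proof.
move=> hg; elim: r => [|i r IH].
  by under eq_fun do rewrite big_nil; rewrite big_nil; exact: fcoef0.
rewrite big_cons -IH -(fcoefZ _ _ (hg i)) -fcoefD//.
- by congr (fcoef _ n); apply/funext => y; rewrite big_cons.
- exact: Lfun2Z.
- exact: Lfun2_lincomb.
Qed.

(** The partial sums of the kernel are bounded by [4 * zetaC p], so by dominated convergence the
    coefficient can be computed on them; there, by orthonormality, it is constant as soon as
    [n < M]. *)
Lemma fcoef_kappa x n : fcoef (fun y => kappa p y x) n = wt (- p) n * psi n x.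
Proof.
pose F M (y : R) := (\sum_(0 <= m < M) kterm x y m) * psi n y.
have mF M : measurable_fun (setT : set (measurableTypeR R)) (F M).
  by apply: measurable_funM; [exact: measurable_kpart|exact: measurable_psi].
have := @dominated_convergence _ (measurableTypeR R) R muT setT measurableT
  (fun M => EFin \o F M) (EFin \o (fun y => kappa p y x * psi n y))
  (EFin \o cst (4 * zetaC p * 2)).
case.
- by move=> M; exact/measurable_EFinP.
- by apply/measurable_EFinP/measurable_funM; [exact: measurable_kappa|exact: measurable_psi].
- apply: aeW => y _; apply: cvg_EFin; first exact: nearW.
  by apply: cvgM; [exact: kpart_cvg|exact: cvg_cst].
- exact: finite_measure_integrable_cst.
- apply: aeW => y M _; rewrite /= lee_fin normrM ler_pM//; first exact: kpart_le.
  exact: normr_psi_le.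
move=> _ _ cv.
have cvF : \int[muT]_y F M y @[M --> \oo] --> fcoef (fun y => kappa p y x) n.
  apply: fine_cvg; rewrite /fcoef /Rintegral fineK; first exact: cv.
  apply: integrable_fin_num => //; exact: fcoef_integrable (kappa_Lfun2 x).
have cvW : \int[muT]_y F M y @[M --> \oo] --> wt (- p) n * psi n x.
  apply: cvg_near_cst; near=> M.
  transitivity (fcoef (fun y => \sum_(0 <= m < M) (wt (- p) m * psi m x) * psi m y) n).
    by [].
  rewrite fcoef_lincomb; last by move=> m; exact: psi_Lfun2.
  have nM : (n < M)%N by near: M; exact: nbhs_infty_gt.
  rewrite (bigD1_seq n)/= ?mem_index_iota ?iota_uniq// big1 ?addr0; last first.
    by move=> m mn; rewrite fcoef_psi (negbTE mn) mulr0.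
  rewrite fcoef_psi eqxx/=; have [->|_] := eqVneq n 1%N; last by rewrite mulr1.
  by rewrite psi1 !mulr0.
exact: cvg_unique cvF cvW.
Unshelve. all: by end_near. Qed.

Lemma Hsob_kappa x : Hsob p (fun y => kappa p y x).
Proof.
apply/HsobP; split; first exact: kappa_Lfun2.
exists (2 * zetaC p) => M; apply: (@le_trans _ _ (2 * \sum_(0 <= n < M) wt (- p) n)).
  rewrite mulr_sumr; apply: ler_sum => n _; rewrite fcoef_kappa.
  rewrite (_ : _ * _ = wt p n * wt (- p) n * (psi n x ^+ 2 * wt (- p) n)); last by ring.
  by rewrite wtNK mul1r ler_wpM2r ?wt_ge0// sqr_psi_le.
by rewrite ler_pM2l// sum_wtN_le.
Qed.

(* Reproducing property: the functions of [H^p] that agree everywhere, and not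
   only almost everywhere, with their Fourier series. *)
Definition repro (f : R -> R) :=
  Hsob p f /\ forall y, \sum_(0 <= n < M) fcoef f n * psi n y @[M --> \oo] --> f y.

Lemma repro_kappa x : repro (fun y => kappa p y x).
Proof.
split=> [|y]; first exact: Hsob_kappa.
by under eq_fun do under eq_bigr do rewrite fcoef_kappa; exact: kpart_cvg.
Qed.

Lemma repro0 : repro (fun=> 0).
Proof.
split=> [|y]; first exact: Hsob0.
by under eq_fun do (rewrite big1; last by move=> n _; rewrite fcoef0 mul0r); exact: cvg_cst.
Qed.

Lemma reproB f g : repro f -> repro g -> repro (f \- g).
Proof.
move=> [hf cf] [hg cg]; split=> [|y]; first exact: HsobB.
rewrite (_ : (fun M => _) = (fun M => \sum_(0 <= n < M) fcoef f n * psi n y -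
   \sum_(0 <= n < M) fcoef g n * psi n y)); first by apply: cvgB.
apply/funext => M; rewrite -sumrB; apply: eq_bigr => n _.
by rewrite (fcoefB _ (Hsob_Lfun2 hf) (Hsob_Lfun2 hg)) mulrBl.
Qed.

Lemma repro_lincomb (I : Type) (r : seq I) (c : I -> R) (g : I -> R -> R) :
  (forall i, repro (g i)) -> repro (fun y => \sum_(i <- r) c i * g i y).
Proof.
move=> hg; have hL i : g i \in Lfun muT 2%:E by exact: Hsob_Lfun2 (hg i).1.
split; first last.
  move=> y; rewrite (_ : (fun M => _) = fun M => \sum_(i <- r) c i *
      \sum_(0 <= n < M) fcoef (g i) n * psi n y).
    by apply: cvg_sumr => i _; apply: cvgM; [exact: cvg_cst|exact: (hg i).2].
  apply/funext => M.
  transitivity (\sum_(0 <= n < M) \sum_(i <- r) c i * (fcoef (g i) n * psi n y)).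
    apply: eq_bigr => n _; rewrite fcoef_lincomb// mulr_suml.
    by apply: eq_bigr => i _; rewrite mulrA.
  by rewrite exchange_big /=; apply: eq_bigr => i _; rewrite mulr_sumr.
apply/HsobP; split; first exact: Lfun2_lincomb.
elim: r => [|i r [B hB]].
  exists 0 => M; rewrite /sqsum big1// => n _.
  by under eq_fun do rewrite big_nil; rewrite fcoef0 expr0n mulr0.
have [B' hB'] := ((HsobP p (g i)).1 (hg i).1).2.
apply: (fin2_eq _ (fin2D (@iota_mono R) (wt_ge0 p)
  (x := fun n => c i * fcoef (g i) n) _ (ex_intro _ B hB))).
  by move=> n; rewrite !fcoef_lincomb// big_cons.
exists (c i ^+ 2 * B') => M; apply: le_trans (ler_wpM2l (sqr_ge0 _) (hB' M)).
by rewrite /sqsum mulr_sumr; apply: ler_sum => n _; rewrite exprMn mulrCA.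
Qed.

End Kernel.

Lemma eq_cvgn (R : realType) (u v : nat -> R) (l : R) :
  u =1 v -> u @ \oo --> l -> v @ \oo --> l.
Proof. by move=> /funext ->. Qed.

Lemma cvgn_unique (R : realType) (u : nat -> R) (a b : R) :
  u @ \oo --> a -> u @ \oo --> b -> a = b.
Proof. exact: cvg_unique. Qed.

(* The Gram matrix of a positive semidefinite form: a vector in its kernel represents
   a function orthogonal to everything, in particular to the right-hand side, so that
   the normal equations are solvable. *)
Lemma normal_equations (R : realType) (S : (R -> R) -> Prop)
    (ip : (R -> R) -> (R -> R) -> R) (m : nat) (k : 'I_m -> R -> R)
    (lc := fun c : 'I_m -> R => (fun y => \sum_i c i * k i y) : R -> R) u :
  (forall f g, S f -> S g -> ip f g = ip g f) ->
  (forall f g, S f -> S g -> S (f \- g)) ->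
  (forall f g h, S f -> S g -> S h -> ip (f \- g) h = ip f h - ip g h) ->
  (forall i, S (k i)) -> (forall c, S (lc c)) ->
  (forall c h, S h -> ip (lc c) h = \sum_i c i * ip (k i) h) ->
  (forall f h, S f -> S h -> ip h h = 0 -> ip f h = 0) ->
  S u -> exists c, forall d, ip (u \- lc c) (lc d) = 0.
Proof.
move=> ipC SB ipB Sk Slc ip_lc ip0 hu.
have ip_lcr f c : S f -> ip f (lc c) = \sum_i c i * ip f (k i).
  by move=> hf; rewrite ipC// ip_lc//; apply: eq_bigr => i _; rewrite ipC.
pose G : 'M[R]_m := \matrix_(i, l) ip (k i) (k l).
pose b : 'rV[R]_m := \row_i ip u (k i).
(* Membership of [b] in the row space of [G] amounts to [b] being annihilated by each column [z] of
   the cokernel matrix, and such a [z] lies in the kernel of the Gram matrix. *)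
have /submxP[D bD] : (b <= G)%MS.
  rewrite submxE; apply/eqP/rowP => l; rewrite mxE [RHS]mxE.
  pose z i := cokermx G i l.
  have hG i : \sum_n z n * ip (k i) (k n) = 0.
    have /matrixP/(_ i l) := mulmx_coker G; rewrite mxE [RHS]mxE => hz; rewrite -[RHS]hz.
    by apply: eq_bigr => n _; rewrite mxE mulrC.
  have h0 : ip (lc z) (lc z) = 0.
    by rewrite ip_lc// big1// => i _; rewrite ip_lcr ?hG ?mulr0.
  have : ip u (lc z) = 0 by exact: ip0.
  by rewrite ip_lcr// => hz; rewrite -[RHS]hz; apply: eq_bigr => i _; rewrite mxE mulrC.
exists (fun i => D ord0 i) => d; rewrite ip_lcr; last exact: SB.
rewrite big1// => i _; rewrite ipB//.
have /rowP/(_ i) := bD; rewrite !mxE => ->.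
rewrite ip_lc// (_ : \sum_n D ord0 n * G n i = \sum_n D ord0 n * ip (k n) (k i)).
  by rewrite subrr mulr0.
by apply: eq_bigr => n _; rewrite mxE.
Qed.

(** * The projections onto the kernel spaces *)

Section Projection.
Context {R : realType}.
Variable p : R.
Hypothesis hp : 2^-1 < p.

Lemma HinnerC (r : R) (f g : R -> R) : Hsob r f -> Hsob r g ->
  Hinner r f g = Hinner r g f.
Proof.
move=> hf hg; apply: (cvgn_unique (Hinner_cvg hf hg)).
apply: (eq_cvgn _ (Hinner_cvg hg hf)) => M /=.
by apply: eq_bigr => n _; rewrite [fcoef g n * _]mulrC.
Qed.

Lemma HinnerB (r : R) (f g h : R -> R) : Hsob r f -> Hsob r g -> Hsob r h ->
  Hinner r (f \- g) h = Hinner r f h - Hinner r g h.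
Proof.
move=> hf hg hh; apply: (cvgn_unique (Hinner_cvg (HsobB hf hg) hh)).
apply: (eq_cvgn _ (cvgB (Hinner_cvg hf hh) (Hinner_cvg hg hh))) => M.
transitivity (\sum_(0 <= n < M) wt r n * (fcoef f n * fcoef h n) -
  \sum_(0 <= n < M) wt r n * (fcoef g n * fcoef h n)); first by [].
rewrite -sumrB; apply: eq_bigr => n _.
by rewrite (fcoefB _ (Hsob_Lfun2 hf) (Hsob_Lfun2 hg)); ring.
Qed.

Lemma Hinner_lincomb (I : Type) (s : seq I) (c : I -> R) (g : I -> R -> R) (h : R -> R) :
  (forall i, repro p (g i)) -> Hsob p h ->
  Hinner p (fun y => \sum_(i <- s) c i * g i y) h = \sum_(i <- s) c i * Hinner p (g i) h.
Proof.
move=> hg hh; have hl := (repro_lincomb s c hg).1.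
apply: (cvgn_unique (Hinner_cvg hl hh)).
have cv : \sum_(i <- s) c i * \sum_(0 <= n < M) wt p n * (fcoef (g i) n * fcoef h n) @[M --> \oo] -->
   \sum_(i <- s) c i * Hinner p (g i) h.
  by apply: cvg_sumr => i _; apply: cvgM; [exact: cvg_cst|exact: (Hinner_cvg (hg i).1 hh)].
apply: (eq_cvgn _ cv) => M /=.
transitivity (\sum_(i <- s) \sum_(0 <= n < M) c i * (wt p n * (fcoef (g i) n * fcoef h n))).
  by apply: eq_bigr => i _; rewrite mulr_sumr.
rewrite exchange_big /=; apply: eq_bigr => n _.
rewrite fcoef_lincomb; last by move=> i; exact: Hsob_Lfun2 (hg i).1.
by rewrite mulr_suml mulr_sumr; apply: eq_bigr => i _; ring.
Qed.

Lemma Hinner_kappa f x : Hsob p f ->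
  \sum_(0 <= n < M) fcoef f n * psi n x @[M --> \oo] --> Hinner p f (fun y => kappa p y x).
Proof.
move=> hf; apply: (eq_cvgn _ (Hinner_cvg hf (Hsob_kappa hp x))) => M /=; apply: eq_bigr => n _.
rewrite fcoef_kappa// (_ : _ * _ = wt p n * wt (- p) n * (fcoef f n * psi n x)); last by ring.
by rewrite wtNK mul1r.
Qed.

Lemma Hinner_self_eq0 (r : R) (f : R -> R) n : Hsob r f -> Hinner r f f = 0 -> fcoef f n = 0.
Proof.
move=> hf h0; have := Hinner_cvg hf hf; rewrite h0 => cv.
set S := (fun M => _) in cv.
have Snd : nondecreasing_seq S.
  by apply: iota_mono => i; rewrite -expr2 mulr_ge0 ?wt_ge0 ?sqr_ge0.
have S0 : S n.+1 <= 0.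
  by rewrite -(cvg_lim _ cv)//; apply: nondecreasing_cvgn_le => //; exact: cvgP cv.
have : wt r n * fcoef f n ^+ 2 <= 0.
  apply: le_trans S0; rewrite /S big_nat_recr//= -expr2 lerDr.
  by apply: sumr_ge0 => i _; rewrite -expr2 mulr_ge0 ?wt_ge0 ?sqr_ge0.
by rewrite pmulr_rle0 ?wt_gt0// => h; apply/eqP; rewrite -sqrf_eq0 eq_le h sqr_ge0.
Qed.

Lemma Hinner_eq0r (r : R) (f h : R -> R) : Hsob r f -> Hsob r h ->
  (forall n, fcoef h n = 0) -> Hinner r f h = 0.
Proof.
move=> hf hh h0; apply: (cvgn_unique (Hinner_cvg hf hh)).
have cv : (fun _ : nat => 0 : R) @ \oo --> (0 : R) by exact: cvg_cst.
apply: (eq_cvgn _ cv) => M /=.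
by rewrite big1// => n _; rewrite h0 !mulr0.
Qed.

Section Level.
Variable j : nat.
Let kap (i : 'I_(2 ^ j)) : R -> R := fun y => kappa p y (grid i).

Let repro_kap i : repro p (kap i). Proof. exact: repro_kappa. Qed.

Lemma projection_exists u : Hsob p u ->
  exists v, Vspan p j v /\ forall w, Vspan p j w -> Hinner p (u \- v) w = 0.
Proof.
move=> hu; have [c hc] : exists c : 'I_(2 ^ j) -> R, forall d : 'I_(2 ^ j) -> R,
    Hinner p (u \- (fun y => \sum_i c i * kap i y)) (fun y => \sum_i d i * kap i y) = 0.
  apply: (@normal_equations R (Hsob p) (Hinner p)); last exact hu.
  - exact (@HinnerC p).
  - exact (@HsobB R p).
  - exact (@HinnerB p).
  - by move=> i; exact (repro_kap i).1.
  - by move=> d; exact (repro_lincomb _ d repro_kap).1.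
  - by move=> d h; exact (Hinner_lincomb _ d repro_kap).
  - move=> f h hf hh h0; apply: (Hinner_eq0r hf hh) => n.
    exact (Hinner_self_eq0 n hh h0).
exists (fun y => \sum_i c i * kap i y); split; first by exists c.
by move=> _ [d ->]; exact (hc d).
Qed.

Lemma projVP u : Hsob p u -> Vspan p j (projV p j u) /\
  forall w, Vspan p j w -> Hinner p (u \- projV p j u) w = 0.
Proof. by move=> hu; exact: (xgetPex (fun=> 0) (projection_exists hu)). Qed.

Lemma repro_Vspan v : Vspan p j v -> repro p v.
Proof. by move=> [c ->]; exact: repro_lincomb. Qed.

Let nodeE (i : 'I_(2 ^ j)) : grid i = i%:R / (2 ^ j)%N%:R :> R.
Proof. by rewrite /grid natrX. Qed.

(** By [Hinner_kappa], orthogonality of the error to the kernel centred at a node says that the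
    Fourier series of the error converges to [0] at that node. *)
Lemma isproj_projV u : Hsob p u -> isproj p (2 ^ j) (fcoef u) (fcoef (projV p j u)).
Proof.
move=> hu; have [hv ho] := projVP hu; split.
  case: hv => c ->.
  (* [isproj] takes coefficients indexed by [nat]; they are extended by [0] beyond the ordinals. *)
  exists (fun l => if insub l is Some i then c i else 0) => n.
  rewrite fcoef_lincomb; last by move=> i; exact: Hsob_Lfun2 (repro_kap i).1.
  rewrite big_mkord mulr_sumr; apply: eq_bigr => i _.
  by rewrite fcoef_kappa// valK nodeE; ring.
move=> l lN; pose i := Ordinal lN.
have hv' := (repro_Vspan hv).1.
have := Hinner_kappa (x := grid i) (HsobB hu hv').
rewrite ho => [cv|]; last first.
  exists (fun k => (k == i)%:R); apply/funext => y.
  rewrite (bigD1 i)//= eqxx mul1r big1 ?addr0// => k ki.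
  by rewrite (negbTE ki) mul0r.
apply: (eq_cvgn _ cv) => M; apply: eq_bigr => n _.
by rewrite (fcoefB _ (Hsob_Lfun2 hu) (Hsob_Lfun2 hv')) nodeE.
Qed.

End Level.

(* [prevproj j] is [P_(j-1)], with [P_(-1) = 0]; the error of [prevproj j] on
   [H^t] is of order [2 ^ (- j (t - s))] in [H^s] for every [j : nat]. *)
Definition prevproj (j : nat) (u : R -> R) : R -> R :=
  if j is i.+1 then projV p i u else fun=> 0.

Definition isprev (j : nat) (x y : nat -> R) : Prop :=
  if j is i.+1 then isproj p (2 ^ i) x y else forall n, y n = 0.

Lemma QdetailE j u : Qdetail p j u = prevproj j.+1 u \- prevproj j u.
Proof. by case: j. Qed.

Lemma repro_prevproj j u : Hsob p u -> repro p (prevproj j u).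
Proof.
by case: j => [|j] hu; [exact: repro0 | exact: repro_Vspan (projVP j hu).1].
Qed.

Lemma isprev_prevproj j u : Hsob p u -> isprev j (fcoef u) (fcoef (prevproj j u)).
Proof. by case: j => [|j] hu; [exact: fcoef0 | exact: isproj_projV]. Qed.

Lemma isprev_lin (I : Type) (r : seq I) (a : I -> R) (x y : I -> nat -> R) j :
  (forall i, isprev j (x i) (y i)) ->
  isprev j (fun n => \sum_(i <- r) a i * x i n) (fun n => \sum_(i <- r) a i * y i n).
Proof.
case: j => [|j] h; last exact: isproj_lin.
by move=> n; rewrite big1// => i _; rewrite h mulr0.
Qed.

(** The constant of [isproj_bound]. Being at least [1], it also covers level [0], where the
    projection is [0] and the error is the function itself. *)
Definition projC : R := sampC p ^+ 2.

Lemma projC_ge1 : 1 <= projC.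
Proof.
have z0 : 0 <= (1 - 2 `^ (1 - 2 * p))^-1 :> R.
  by apply: le_trans (zeta_partial_le 0 _); [rewrite big_geq | move: hp; lra].
by rewrite /projC exprn_ege1// /sampC lerDr mulr_ge0.
Qed.

Let sqs (w x : nat -> R) M := sqsum (index_iota 0) w x M.

Lemma isprev_bound j (x y : nat -> R) (B s t : R) :
  p <= t -> t <= 2 * p -> 0 <= s -> s <= p -> x 1%N = 0 -> isprev j x y ->
  (forall M, sqs (wt t) x M <= B) ->
  forall M, sqs (wt s) (fun n => x n - y n) M <=
     projC * 2 `^ (j%:R * (2 * (s - t))) * B.
Proof.
move=> pt tp s0 sp x1 hxy hB M.
have B0 : 0 <= B by apply: le_trans (hB 0%N); rewrite /sqs /sqsum big_geq.
case: j hxy => [|j] hxy.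
  rewrite mul0r powRr0 mulr1; apply: (@le_trans _ _ B).
    apply: le_trans (hB M); apply: ler_sum => n _.
    by rewrite hxy subr0 ler_wpM2r ?sqr_ge0// ler_wt//; lra.
  by rewrite -[leLHS]mul1r ler_wpM2r// projC_ge1.
have Nj : (0 < 2 ^ j)%N by rewrite expn_gt0.
apply: le_trans (isproj_bound hp Nj pt tp s0 sp x1 hxy hB M) _.
(* Level [j.+1] only has [2 ^ j] nodes, and [pi >= 2] pays for the shift:
   [2 ^ j.+1 <= pi * 2 ^ j]. *)
rewrite ler_wpM2r// ler_wpM2l ?sqr_ge0//.
have -> : 2 * (s - t) = - (2 * (t - s)) by ring.
rewrite mulrN !powRN (powRrM 2 j.+1%:R) powR_mulrn// lef_pV2 ?posrE; last 2 first.
- by rewrite powR_gt0// mulr_gt0 ?pi_gt0// ltr0n.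
- by rewrite powR_gt0// exprn_gt0.
apply: ge0_ler_powR; rewrite ?nnegrE ?exprn_ge0//; first lra.
  by rewrite mulr_ge0 ?pi_ge0.
by rewrite exprS natrX ler_wpM2r ?exprn_ge0// pi_ge2.
Qed.

(** By linearity the difference of two interpolants of [x] is an interpolant of [0], and the error
    bound with [B = 0] makes it vanish. *)
Lemma isprev_uniq j (x y y' : nat -> R) : isprev j x y -> isprev j x y' -> y =1 y'.
Proof.
move=> h h'.
have := @isprev_lin bool [:: true; false] (fun b => if b then 1 else -1) (fun=> x)
  (fun b => if b then y else y') j.
move=> /(_ (fun b => if b as b0 return isprev j x (if b0 then y else y') then h else h')).
set x0 := (fun n => _); set z := (fun n => _) => hz n.
have x00 : x0 =1 fun=> 0 by move=> i; rewrite /x0 big_cons big_seq1 mul1r mulN1r subrr.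
have hB M : sqs (wt p) x0 M <= 0.
  by rewrite /sqs /sqsum big1// => i _; rewrite x00 expr0n mulr0.
have := @isprev_bound j x0 z 0 p p (lexx _) _ _ (lexx _) (x00 1%N) hz hB n.+1.
rewrite mulr0 => /(_ ltac:(move: hp; lra) ltac:(move: hp; lra)).
rewrite /sqs /sqsum big_nat_recr//= => hn.
have : wt p n * (x0 n - z n) ^+ 2 <= 0.
  apply: le_trans hn; rewrite lerDr.
  by apply: sumr_ge0 => i _; rewrite mulr_ge0 ?wt_ge0 ?sqr_ge0.
rewrite pmulr_rle0 ?wt_gt0// x00 sub0r sqrrN => h0.
have : z n == 0 by rewrite -sqrf_eq0 eq_le h0 sqr_ge0.
by rewrite /z big_cons big_seq1 mul1r mulN1r subr_eq0 => /eqP.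
Qed.

(** [tensor_sub] writes the minus sign into the first factor, so the operators must commute with the
    sign; for a projection obtained by choice this is established on coefficients. *)
Lemma fcoef_prevprojN j f n : Hsob p f ->
  fcoef (prevproj j (\- f)) n = - fcoef (prevproj j f) n.
Proof.
move=> hf.
apply: (isprev_uniq (isprev_prevproj j (HsobN hf)) (y' := fun n => - fcoef (prevproj j f) n)).
have := @isprev_lin unit [:: tt] (fun=> -1) (fun=> fcoef f) (fun=> fcoef (prevproj j f)) j
  (fun=> isprev_prevproj j hf).
rewrite (_ : (fun n => _) = fcoef (\- f)); last first.
  by apply/funext => i; rewrite big_seq1 mulN1r (fcoefN _ (Hsob_Lfun2 hf)).
by rewrite (_ : (fun n => _) = fun n => - fcoef (prevproj j f) n)//; apply/funext => i; rewrite big_seq1 mulN1r.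
Qed.

End Projection.

(** * Tensor products of bounded operators *)

Section OperatorBounds.
Context {R : realType}.

(** This is a univariate operator tensored with the identity. For each column the univariate bound
    is applied with [B] equal to the full squared norm of that column, the limit of its partial
    sums; the weighted sum of these limits is still at most [D]. *)
Lemma column_bound (w w' v : nat -> R) (K D : R) (X Y : nat -> nat -> R) :
  (forall n, 0 <= w n) -> (forall m, 0 < v m) -> 0 <= K ->
  (forall m B, (forall M, \sum_(0 <= n < M) w n * X n m ^+ 2 <= B) ->
     forall M, \sum_(0 <= n < M) w' n * Y n m ^+ 2 <= K * B) ->
  (forall M, \sum_(0 <= n < M) \sum_(0 <= m < M) w n * v m * X n m ^+ 2 <= D) ->
  forall M, \sum_(0 <= n < M) \sum_(0 <= m < M) w' n * v m * Y n m ^+ 2 <= K * D.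
Proof.
move=> w0 v0 K0 hA hD M.
pose S m M' := \sum_(0 <= n < M') w n * X n m ^+ 2.
have term0 n m : 0 <= w n * X n m ^+ 2 by rewrite mulr_ge0 ?sqr_ge0.
have Snd m : nondecreasing_seq (S m) by apply: iota_mono => n.
have vS M' : \sum_(0 <= m < M) v m * S m M' <= D.
  apply: le_trans (hD (maxn M M')); rewrite exchange_big /=.
  apply: (@le_trans _ _ (\sum_(0 <= m < maxn M M') v m * S m M')).
    apply: (@iota_mono R (fun m => v m * S m M')); last exact: leq_maxl.
    by move=> m; rewrite mulr_ge0 ?(ltW (v0 m))// sumr_ge0.
  apply: ler_sum => m _; apply: (@le_trans _ _ (v m * S m (maxn M M'))).
    by rewrite ler_wpM2l ?(ltW (v0 m))// Snd// leq_maxr.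
  by rewrite mulr_sumr; apply: ler_sum => n _; rewrite mulrA [v m * _]mulrC.
have Sub m : (m < M)%N -> has_ubound (range (S m)).
  move=> mM; exists (D / v m) => _ [M' _ <-]; rewrite ler_pdivlMr// mulrC.
  apply: le_trans (vS M'); rewrite (bigD1_seq m) ?mem_index_iota ?iota_uniq//= lerDl.
  by apply: sumr_ge0 => i _; rewrite mulr_ge0 ?(ltW (v0 i))// sumr_ge0.
have Scv m : (m < M)%N -> S m @ \oo --> limn (S m).
  by move=> mM; apply: nondecreasing_is_cvgn => //; exact: Sub.
have limD : \sum_(0 <= m < M) v m * limn (S m) <= D.
  have cv : \sum_(0 <= m < M | (0 <= m < M)%N) v m * S m M' @[M' --> \oo] -->
      \sum_(0 <= m < M | (0 <= m < M)%N) v m * limn (S m).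
    by apply: cvg_sumr => m /= mM; apply: cvgM; [exact: cvg_cst|exact: Scv].
  rewrite big_nat; apply: (cvgr_to_le cv); near=> M'.
  by rewrite -big_nat; exact: vS.
rewrite exchange_big /=.
apply: (@le_trans _ _ (K * \sum_(0 <= m < M) v m * limn (S m))); last exact: ler_wpM2l.
rewrite mulr_sumr big_nat [leRHS]big_nat; apply: ler_sum => m /= mM.
have h := hA m (limn (S m)) (fun M' => nondecreasing_cvgn_le (Snd m) (cvgP _ (Scv m mM)) M') M.
rewrite [leRHS]mulrCA; apply: le_trans (ler_wpM2l (ltW (v0 m)) h).
by rewrite mulr_sumr; apply: ler_sum => n _; rewrite [leRHS]mulrA [v m * _]mulrC.
Unshelve. all: by end_near. Qed.

Let sqs (w x : nat -> R) M := sqsum (index_iota 0) w x M.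

(** Stating the bound for combinations of coefficient sequences builds in the linearity of [A]. In
    use, the scalars [a i] are the coefficients, at a fixed index, of the other factors of a list of
    tensors. *)
Definition bounded_op (A : (R -> R) -> R -> R) (t s K : R) : Prop :=
  forall (I : Type) (r : seq I) (a : I -> R) (f : I -> R -> R),
  (forall i, Hsob t (f i)) -> forall B,
  (forall M, sqs (wt t) (fun n => \sum_(i <- r) a i * fcoef (f i) n) M <= B) ->
  forall M, sqs (wt s) (fun n => \sum_(i <- r) a i * fcoef (A (f i)) n) M <= K * B.

(** [A (x) B] is factored as [(A (x) I) (I (x) B)]: [B] acts along the second index first, and the
    intermediate array is measured with [wt t] in the first index and [wt s'] in the second. *)
Lemma tensor_map_bound A B (t s s' KA KB D : R) (U : tensor) :
  0 <= KA -> 0 <= KB -> bounded_op A t s KA -> bounded_op B t s' KB ->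
  tensor_in t t U -> (forall M, sqsum square (wt2 t t) (tcoef U) M <= D) ->
  forall M, sqsum square (wt2 s s') (tcoef (tensor_map A B U)) M <= KA * KB * D.
Proof.
move=> KA0 KB0 hA hB hU hD M.
(* The list is reindexed by ordinals because [bounded_op] requires regularity for every index,
   whereas [tensor_in] speaks only of members of the list. *)
pose d0 : (R -> R) * (R -> R) := (fun=> 0, fun=> 0).
pose f1 (i : 'I_(size U)) := (nth d0 U i).1.
pose f2 (i : 'I_(size U)) := (nth d0 U i).2.
have h1 i : Hsob t (f1 i) by exact: (hU _ (mem_nth d0 (ltn_ord i))).1.
have h2 i : Hsob t (f2 i) by exact: (hU _ (mem_nth d0 (ltn_ord i))).2.
have sumE (G : (R -> R) * (R -> R) -> R) : \sum_(f <- U) G f = \sum_(i < size U) G (f1 i, f2 i).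
  by rewrite (big_nth d0) big_mkord; apply: eq_bigr => i _; rewrite /f1 /f2 -surjective_pairing.
have XU M' : \sum_(0 <= n < M') \sum_(0 <= m < M') wt t n * wt t m *
    (\sum_(i < size U) fcoef (f1 i) n * fcoef (f2 i) m) ^+ 2 <= D.
  move: (hD M'); rewrite /sqsum sum_square; congr (is_true (_ <= _)).
  by apply: eq_bigr => n _; apply: eq_bigr => m _; rewrite /wt2 /tcoef sumE.
rewrite /sqsum sum_square.
have step1 : forall M', \sum_(0 <= m < M') \sum_(0 <= n < M') wt s' m * wt t n *
    (\sum_(i < size U) fcoef (f1 i) n * fcoef (B (f2 i)) m) ^+ 2 <= KB * D.
  apply: (@column_bound (wt t) (wt s') (wt t) KB D
    (fun m n => \sum_(i < size U) fcoef (f1 i) n * fcoef (f2 i) m)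
    (fun m n => \sum_(i < size U) fcoef (f1 i) n * fcoef (B (f2 i)) m)) => //.
  - exact: wt_ge0.
  - exact: wt_gt0.
  - move=> n D' hD'.
    exact (hB _ (index_enum _) (fun i => fcoef (f1 i) n) f2 h2 D' hD').
  - move=> M'; apply: le_trans (XU M'); rewrite exchange_big /= le_eqVlt; apply/orP; left; apply/eqP.
    by apply: eq_bigr => n _; apply: eq_bigr => m _; rewrite [wt t m * _]mulrC.
have step2 : forall M', \sum_(0 <= n < M') \sum_(0 <= m < M') wt s n * wt s' m *
    (\sum_(i < size U) fcoef (B (f2 i)) m * fcoef (A (f1 i)) n) ^+ 2 <= KA * (KB * D).
  apply: (@column_bound (wt t) (wt s) (wt s') KA (KB * D)
    (fun n m => \sum_(i < size U) fcoef (B (f2 i)) m * fcoef (f1 i) n)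
    (fun n m => \sum_(i < size U) fcoef (B (f2 i)) m * fcoef (A (f1 i)) n)) => //.
  - exact: wt_ge0.
  - exact: wt_gt0.
  - move=> m D' hD'.
    exact (hA _ (index_enum _) (fun i => fcoef (B (f2 i)) m) f1 h1 D' hD').
  - move=> M'; apply: le_trans (step1 M'); rewrite exchange_big /= le_eqVlt; apply/orP; left; apply/eqP.
    apply: eq_bigr => m _; apply: eq_bigr => n _; rewrite [wt t n * _]mulrC; congr (_ * _ ^+ 2).
    by apply: eq_bigr => i _; rewrite mulrC.
rewrite -mulrA; apply: le_trans (step2 M); rewrite le_eqVlt; apply/orP; left; apply/eqP.
apply: eq_bigr => n _; apply: eq_bigr => m _; rewrite /wt2 /tcoef big_map sumE; congr (_ * _ ^+ 2).
by apply: eq_bigr => i _; rewrite mulrC.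
Qed.

Variable p : R.
Hypothesis hp : 2^-1 < p.

Section Rates.
Variables (t s : R).
Hypotheses (pt : p <= t) (tp : t <= 2 * p) (s0 : 0 <= s) (sp : s <= p).

Let rate (j : nat) : R := 2 `^ (j%:R * (2 * (s - t))).

Lemma prevproj_err_sum j (I : Type) (r : seq I) (a : I -> R) (f : I -> R -> R) B :
  (forall i, Hsob t (f i)) ->
  (forall M, sqs (wt t) (fun n => \sum_(i <- r) a i * fcoef (f i) n) M <= B) ->
  forall M, sqs (wt s) (fun n => \sum_(i <- r) a i * fcoef (f i) n -
     \sum_(i <- r) a i * fcoef (prevproj p j (f i)) n) M <= projC p * rate j * B.
Proof.
move=> hf hB M; apply: (isprev_bound hp pt tp s0 sp _ _ hB).
  by rewrite big1// => i _; rewrite fcoef_psi1 mulr0.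
by apply: isprev_lin => i; apply: isprev_prevproj => //; exact: Hsob_le (hf i).
Qed.

Lemma bounded_err j : bounded_op (fun u => u \- prevproj p j u) t s (projC p * rate j).
Proof.
move=> I r a f hf B hB M; apply: le_trans (prevproj_err_sum j hf hB M).
rewrite le_eqVlt; apply/orP; left; apply/eqP.
apply: eq_bigr => n _; congr (_ * _ ^+ 2); rewrite -sumrB; apply: eq_bigr => i _.
rewrite fcoefB ?mulrBr//; first exact: Hsob_Lfun2 (hf i).
by apply: (@Hsob_Lfun2 _ p); apply: (repro_prevproj hp _ _).1; exact: Hsob_le (hf i).
Qed.

(** A detail is the difference of the errors of two consecutive projections; the [4] comes from
    [(x + y) ^ 2 <= 2 * x ^ 2 + 2 * y ^ 2] and from enlarging the finer error to the coarser
    rate. *)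
Lemma bounded_Qdetail j : bounded_op (Qdetail p j) t s (4 * projC p * rate j).
Proof.
move=> I r a f hf B hB M.
have B0 : 0 <= B by apply: le_trans (hB 0%N); rewrite /sqs /sqsum big_geq.
have C1 : 0 <= projC p by apply: le_trans (projC_ge1 hp).
have e0 := prevproj_err_sum j hf hB M.
have e1 := prevproj_err_sum j.+1 hf hB M.
have rr : rate j.+1 <= rate j.
  by rewrite ler_powR ?ler1n// -natr1 mulrDl mul1r gerDl; move: pt sp; lra.
have {}e1 := le_trans e1 (ler_wpM2r B0 (ler_wpM2l C1 rr)).
have L2p i k : prevproj p k (f i) \in Lfun muT 2%:E.
  by apply: (@Hsob_Lfun2 _ p); apply: (repro_prevproj hp _ _).1; exact: Hsob_le (hf i).
apply: (@le_trans _ _ (2 * (projC p * rate j * B) + 2 * (projC p * rate j * B))); last by lra.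
apply: le_trans; last exact: lerD (ler_wpM2l (ler0n _ 2) e0) (ler_wpM2l (ler0n _ 2) e1).
rewrite /sqs /sqsum !mulr_sumr -big_split /=; apply: ler_sum => n _.
set x := \sum_(i <- r) a i * fcoef (f i) n.
set y := \sum_(i <- r) a i * fcoef (prevproj p j (f i)) n.
set y' := \sum_(i <- r) a i * fcoef (prevproj p j.+1 (f i)) n.
rewrite (_ : \sum_(i <- r) _ = y' - y); last first.
  rewrite -sumrB; apply: eq_bigr => i _; rewrite QdetailE (fcoefB _ (L2p i j.+1) (L2p i j)).
  by rewrite mulrBr.
rewrite !mulrA ![2 * _]mulrC -!mulrA -mulrDr ler_wpM2l ?wt_ge0//.
have := sqr_ge0 ((x - y) + (x - y')); nra.
Qed.

End Rates.

End OperatorBounds.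

(** * Elements of the completed tensor products *)

Section TorusProduct.
Context {R : realType}.
Implicit Types (U W : nat -> @tensor R) (a b : R) (u v : R * R -> R).

Local Notation T2 := (measurableTypeR R * measurableTypeR R)%type.

Lemma muT2_setT : @muT2 R setT = 1%E.
Proof.
rewrite -setXTT; apply: etrans (@product_measure1E _ _ _ _ R muT muT setT setT measurableT measurableT) _.
by apply: etrans (congr2 mule (@muT_setT R) (@muT_setT R)) _; rewrite mul1e.
Qed.

Lemma muT2_le1 : (@muT2 R setT <= 1)%E. Proof. by rewrite muT2_setT. Qed.

Lemma measurable_prodfun (f g : R -> R) :
  measurable_fun (setT : set (measurableTypeR R)) f ->
  measurable_fun (setT : set (measurableTypeR R)) g ->
  measurable_fun (setT : set T2) (fun z => f z.1 * g z.2).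
Proof.
move=> mf mg; apply: measurable_funM.
  exact: (measurableT_comp mf (@measurable_fst _ _ _ _)).
exact: (measurableT_comp mg (@measurable_snd _ _ _ _)).
Qed.

Lemma integral_prodfun (f g : R -> R) :
  muT.-integrable setT (EFin \o f) -> muT.-integrable setT (EFin \o g) ->
  muT2.-integrable (setT : set T2) (EFin \o (fun z => f z.1 * g z.2)) /\
  \int[muT2]_z (f z.1 * g z.2) = (\int[muT]_x f x) * (\int[muT]_y g y).
Proof.
move=> fi gi.
have mf : measurable_fun (setT : set (measurableTypeR R)) f.
  by apply/measurable_EFinP; exact: measurable_int fi.
have mg : measurable_fun (setT : set (measurableTypeR R)) g.
  by apply/measurable_EFinP; exact: measurable_int gi.
have mfg : measurable_fun (setT : set T2) (EFin \o (fun z : T2 => f z.1 * g z.2)).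
  by apply/measurable_EFinP; exact: measurable_prodfun.
have fgi : (muT \x muT)%E.-integrable (setT : set T2) (EFin \o (fun z : T2 => f z.1 * g z.2)).
  refine ((@integrable12ltyP _ _ _ _ R muT muT _ mfg).2 _).
  have -> : (\int[muT]_x \int[muT]_y `|(EFin \o (fun z : T2 => (f z.1 * g z.2)%R)) (x, y)|
     = \int[muT]_x (`|f x|%:E * \int[muT]_y `|g y|%:E))%E.
    apply: eq_integral => x _ /=.
    rewrite -ge0_integralZl//; last first.
      by apply/measurable_EFinP; exact: measurableT_comp.
    by apply: eq_integral => y _; rewrite normrM EFinM.
  have gf : (\int[muT]_y `|g y|%:E)%E \is a fin_num.
    rewrite ge0_fin_numE ?integral_ge0//.
    by move/integrableP : gi => [].
  rewrite ge0_integralZr//; last 2 first.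
  - by apply/measurable_EFinP; exact: measurableT_comp.
  - by rewrite integral_ge0.
  have fi' : (\int[muT]_x `|f x|%:E < +oo)%E by move/integrableP : fi => [].
  apply: lte_mul_pinfty; first exact: integral_ge0.
    by rewrite ge0_fin_numE ?integral_ge0.
  by rewrite -ge0_fin_numE ?integral_ge0.
split=> //; rewrite /Rintegral.
have gfin := integrable_fin_num measurableT gi.
have ffin := integrable_fin_num measurableT fi.
rewrite -fineM//; congr fine.
rewrite -(integral12_prod_meas1 fgi) /fubini_F.
transitivity (\int[muT]_x ((f x)%:E * \int[muT]_y (g y)%:E))%E.
  by apply: eq_integral => x _ /=; rewrite -integralZl.
by rewrite -{1}(fineK gfin) integralZr// fineK.
Qed.

Definition psi2 (k : nat * nat) (z : R * R) : R := psi k.1 z.1 * psi k.2 z.2.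

Lemma measurable_psi2 k : measurable_fun (setT : set T2) (psi2 k).
Proof. by apply: measurable_prodfun; exact: measurable_psi. Qed.

Lemma normr_psi2_le k z : `|psi2 k z| <= 4.
Proof.
rewrite /psi2 normrM (_ : 4 = 2 * 2 :> R); last by ring.
by apply: ler_pM => //; exact: normr_psi_le.
Qed.

Definition fcoef2 u (k : nat * nat) : R := \int[muT2]_z (u z * psi2 k z).

Definition tensor_L2 (W : @tensor R) :=
  forall f, f \in W -> f.1 \in Lfun muT 2%:E /\ f.2 \in Lfun muT 2%:E.

Lemma tensor_in_L2 a b (W : @tensor R) : tensor_in a b W -> tensor_L2 W.
Proof. by move=> hW f /hW[h1 h2]; split; [exact: Hsob_Lfun2 h1|exact: Hsob_Lfun2 h2]. Qed.

Lemma measurable_tensor_fun (W : @tensor R) : tensor_L2 W ->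
  measurable_fun (setT : set T2) (tensor_fun W).
Proof.
elim: W => [|f W IH] hW.
  rewrite (_ : tensor_fun _ = cst 0); first exact: measurable_cst.
  by apply/funext => z; rewrite /tensor_fun big_nil.
rewrite (_ : tensor_fun _ = fun z => f.1 z.1 * f.2 z.2 + tensor_fun W z); last first.
  by apply/funext => z; rewrite /tensor_fun big_cons.
have [f1 f2] := hW f (mem_head _ _).
apply: measurable_funD.
  by apply: measurable_prodfun; [exact: Lfun2_measurable f1|exact: Lfun2_measurable f2].
by apply: IH => g gW; apply: hW; rewrite in_cons gW orbT.
Qed.

Lemma fcoef2_tensor (W : @tensor R) k : tensor_L2 W ->
  muT2.-integrable (setT : set T2) (EFin \o (fun z => tensor_fun W z * psi2 k z)) /\
  fcoef2 (tensor_fun W) k = tcoef W k.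
Proof.
rewrite /fcoef2 /tcoef; elim: W => [|f W IH] hW.
  rewrite big_nil (_ : (fun z => _) = cst 0); last first.
    by apply/funext => z; rewrite /tensor_fun big_nil mul0r.
  split; first exact: integrable0.
  by rewrite Rintegral_cst// mul0r.
have [f1 f2] := hW f (mem_head _ _).
have /IH[ih1 ih2] : tensor_L2 W by move=> g gW; apply: hW; rewrite in_cons gW orbT.
have [i1 i2] := integral_prodfun (fcoef_integrable k.1 f1) (fcoef_integrable k.2 f2).
rewrite (_ : (fun z => _) = (fun z => f.1 z.1 * psi k.1 z.1 * (f.2 z.2 * psi k.2 z.2) +
    tensor_fun W z * psi2 k z)); last first.
  by apply/funext => z; rewrite /tensor_fun big_cons /psi2; ring.
split; first exact: (integrableD measurableT i1 ih1).
by rewrite RintegralD// i2 ih2 big_cons.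
Qed.

Lemma fcoef2_cvg u U k : u \in Lfun muT2 2%:E -> (forall n, tensor_L2 (U n)) ->
  'N[muT2]_2%:E[EFin \o (u \- tensor_fun (U n))%R]%E @[n --> \oo] --> 0%E ->
  tcoef (U n) k @[n --> \oo] --> fcoef2 u k.
Proof.
move=> hu hU cN.
have /fine_cvgP[hfin hc] := cN.
apply/cvgrPdist_le => e e0.
have e4 : 0 < e / 4 by rewrite divr_gt0.
move/cvgrPdist_le : hc => /(_ _ e4) hc; near=> n.
have mT : measurable_fun (setT : set T2) (tensor_fun (U n)).
  exact: measurable_tensor_fun.
have hd : (u \- tensor_fun (U n)) \in Lfun muT2 2%:E.
  rewrite inE; apply/andP; split; rewrite inE/=.
    by apply: measurable_funB => //; exact: Lfun2_measurable hu.
  by rewrite /finite_norm -ge0_fin_numE ?Lnorm_ge0//; near: n.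
have [ti tE] := fcoef2_tensor k (hU n).
have ui : muT2.-integrable (setT : set T2) (EFin \o (fun z => u z * psi2 k z)).
  apply: (Lfun2_mul_integrable hu).
  exact (bounded_Lfun2 muT2_le1 (measurable_psi2 k) (normr_psi2_le k)).
have -> : fcoef2 u k - tcoef (U n) k = \int[muT2]_z ((u \- tensor_fun (U n)) z * psi2 k z).
  by rewrite -tE /fcoef2 -RintegralB//; apply: eq_Rintegral => z _; rewrite mulrBl.
have h1 := normr_Rintegral_mul_le muT2_le1 hd (measurable_psi2 k) (normr_psi2_le k).
apply: le_trans h1 _; rewrite -ler_pdivlMl// mulrC.
apply: le_trans (ler_norm _) _; rewrite -[X in `|X|]opprK normrN -sub0r.
by near: n.
Unshelve. all: by end_near. Qed.

Lemma tensor_represents_in a b u U : tensor_represents a b u U ->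
  forall n, tensor_in a b (U n).
Proof. by move=> [_ hU _ _] n f fU; exact: (hU n). Qed.

Lemma represents_cauchy a b u U : tensor_represents a b u U ->
  forall e : R, 0 < e -> exists N, forall m n, (N <= m)%N -> (N <= n)%N ->
    nrm square (wt2 a b) (fun z => tcoef (U m) z - tcoef (U n) z) < e.
Proof.
move=> hr e e0; have hin := tensor_represents_in hr.
case: hr => _ _ /(_ e e0)[N hN] _; exists N => m n Nm Nn.
rewrite -(tcoef_sub _ (hin n)) -cross_normE; first exact: hN.
by apply: tensor_in_sub.
Qed.

Lemma represents_fcoef2 a b u U k : tensor_represents a b u U ->
  tcoef (U n) k @[n --> \oo] --> fcoef2 u k.
Proof.
move=> hr; have hin := tensor_represents_in hr; case: hr => hu _ _ hc.
by apply: fcoef2_cvg => // n; exact: tensor_in_L2 (hin n).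
Qed.

(** Convergence in [L^2] identifies the limit of each coefficient, and [nrm_cauchy_cvg0] upgrades
    this to convergence in the weighted norm. *)
Lemma represents_dist0 a b u U : tensor_represents a b u U ->
  fin2 square (wt2 a b) (fcoef2 u) /\
  nrm square (wt2 a b) (fun z => tcoef (U n) z - fcoef2 u z) @[n --> \oo] --> 0.
Proof.
move=> hr; have hin := tensor_represents_in hr; apply: nrm_cauchy_cvg0.
- exact: square_mono.
- exact: wt2_ge0.
- by move=> n; exact: tcoef_fin2 (hin n).
- exact: represents_cauchy hr.
- by move=> k; exact: represents_fcoef2 hr.
Qed.

Lemma represents_cross_norm a b u U : tensor_represents a b u U ->
  cross_norm a b (U n) @[n --> \oo] --> nrm square (wt2 a b) (fcoef2 u).
Proof.
move=> hr; have hin := tensor_represents_in hr.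
under eq_fun do rewrite (cross_normE (hin _)).
apply: nrm_cauchy_cvg.
- exact: square_mono.
- exact: wt2_ge0.
- by move=> n; exact: tcoef_fin2 (hin n).
- exact: represents_cauchy hr.
- by move=> k; exact: represents_fcoef2 hr.
Qed.

(** The norm is well defined: along every representing sequence the cross norms tend to the same
    value, determined by the coefficients of [u], so the choice in [Htensor_norm] returns it. *)
Lemma Htensor_normE a b u : Htensor a b u ->
  Htensor_norm a b u = nrm square (wt2 a b) (fcoef2 u).
Proof.
move=> [U hU].
have : exists N, [set N : R | exists2 U, tensor_represents a b u U &
    cross_norm a b (U n) @[n --> \oo] --> N] N.
  by exists (nrm square (wt2 a b) (fcoef2 u)), U => //; exact: represents_cross_norm.
move=> /(xgetPex 0)[W hW cW]; apply: cvgn_unique cW _.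
exact: represents_cross_norm.
Qed.

Lemma represents_sub a b u v U W :
  tensor_represents a b u U -> tensor_represents a b v W ->
  tensor_represents a b (u \- v) (fun n => tensor_sub (U n) (W n)).
Proof.
move=> hu hv; have iU := tensor_represents_in hu; have iW := tensor_represents_in hv.
have cU := represents_cauchy hu; have cW := represents_cauchy hv.
case: hu => u2 _ _ uN; case: hv => v2 _ _ vN; split.
- exact: Lfun2B.
- by move=> n f; exact: (tensor_in_sub (iU n) (iW n)).
- move=> e e0; have e2 : 0 < e / 2 by rewrite divr_gt0.
  have [N1 h1] := cU _ e2; have [N2 h2] := cW _ e2.
  exists (maxn N1 N2) => m n; rewrite !geq_max => /andP[m1 m2] /andP[n1 n2].
  have iS k : tensor_in a b (tensor_sub (U k) (W k)) by exact: tensor_in_sub.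
  rewrite cross_normE; last exact: tensor_in_sub.
  rewrite (tcoef_sub _ (iS n)) (tcoef_sub _ (iW m)) (tcoef_sub _ (iW n)).
  rewrite (_ : (fun z => _) = fun z => (tcoef (U m) z - tcoef (U n) z) -
     (tcoef (W m) z - tcoef (W n) z)); last by apply/funext => z; ring.
  have fin (V : nat -> @tensor R) k l : (forall k, tensor_in a b (V k)) ->
      fin2 square (wt2 a b) (fun z => tcoef (V k) z - tcoef (V l) z).
    by move=> iV; apply: fin2B => //; [exact: square_mono|exact: wt2_ge0|exact: tcoef_fin2|exact: tcoef_fin2].
  apply: (@le_lt_trans _ _ (nrm square (wt2 a b) (fun z => tcoef (U m) z - tcoef (U n) z) +
     nrm square (wt2 a b) (fun z => tcoef (W m) z - tcoef (W n) z))).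
    by apply: nrmB; [exact: square_mono|exact: wt2_ge0|exact: fin|exact: fin].
  by rewrite [ltRHS]splitr; exact (ltrD (h1 m n m1 n1) (h2 m n m2 n2)).
- have sum0 : ('N[muT2]_2%:E[EFin \o (u \- tensor_fun (U n))%R] +
      'N[muT2]_2%:E[EFin \o (v \- tensor_fun (W n))%R])%E @[n --> \oo] --> 0%E.
    by rewrite -[X in _ --> X](adde0 0%E); apply: cvgeD.
  apply: (squeeze_cvge _ (cvg_cst 0%E) sum0).
  near=> n; rewrite Lnorm_ge0/= -[X in (_ <= _ + X)%E]oppe_Lnorm.
  have mu' : measurable_fun (setT : set T2) (u \- tensor_fun (U n)).
    apply: measurable_funB; first exact: Lfun2_measurable u2.
    by apply: measurable_tensor_fun; exact: tensor_in_L2 (iU n).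
  have mv' : measurable_fun (setT : set T2) (v \- tensor_fun (W n)).
    apply: measurable_funB; first exact: Lfun2_measurable v2.
    by apply: measurable_tensor_fun; exact: tensor_in_L2 (iW n).
  have mN : measurable_fun (setT : set T2) (\- (v \- tensor_fun (W n))).
    exact: measurableT_comp mv'.
  have := minkowski_EFin muT2 mu' mN (ler1n _ 2).
  apply: le_trans; rewrite le_eqVlt; apply/orP; left; apply/eqP; apply: eq_Lnorm => z /=.
  congr EFin; rewrite /tensor_fun big_cat big_map /=.
  have -> : \sum_(f <- W n) (- f.1 z.1) * f.2 z.2 = - \sum_(f <- W n) f.1 z.1 * f.2 z.2.
    by rewrite -sumrN; apply: eq_bigr => f _; rewrite mulNr.
  ring.
Unshelve. all: by end_near. Qed.

Lemma represents_le a b c d u U : a <= c -> b <= d ->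
  tensor_represents c d u U -> tensor_represents a b u U.
Proof.
move=> ac bd hu; have iU := tensor_represents_in hu; have cU := represents_cauchy hu.
have iU' n : tensor_in a b (U n) by exact: tensor_in_le ac bd (iU n).
case: hu => u2 _ _ uN; split=> //.
move=> e e0; have [N hN] := cU _ e0; exists N => m n Nm Nn.
apply: le_lt_trans (hN m n Nm Nn).
rewrite cross_normE; last exact: tensor_in_sub.
rewrite (tcoef_sub _ (iU' n)).
apply: (nrm_wt2_le ac bd _).2.
by apply: fin2B => //; [exact: square_mono|exact: wt2_ge0|exact: tcoef_fin2|exact: tcoef_fin2].
Qed.

Lemma represents_ext a b u v U W : u =1 v -> (forall n, U n = W n) ->
  tensor_represents a b u U -> tensor_represents a b v W.
Proof. by move=> /funext -> /funext ->. Qed.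

End TorusProduct.

Lemma cauchy_is_cvgn (R : realType) (u : nat -> R) :
  (forall e : R, 0 < e -> exists N, forall m n, (N <= m)%N -> (N <= n)%N ->
     `|u m - u n| <= e) -> cvgn u.
Proof.
move=> h; apply/cauchy_cvgP; apply: cauchy_exP => e e0.
have e2 : 0 < e / 2 by rewrite divr_gt0.
have [N hN] := h _ e2; exists (u N); exists N => // n /= Nn.
rewrite /ball /=; apply: (@le_lt_trans _ _ (e / 2)); first exact: hN.
by rewrite ltr_pdivrMr// mulr2n mulrDr mulr1 ltrDl.
Qed.

(** * Extension of tensor operators by continuity *)

Section TensorOperators.
Context {R : realType}.
Variable p : R.
Hypothesis hp : 2^-1 < p.
Implicit Types (A B : (R -> R) -> R -> R) (u v : R * R -> R) (U W : nat -> @tensor R).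

Local Notation T2 := (measurableTypeR R * measurableTypeR R)%type.

Let zC0 : 0 < zetaC p. Proof. exact: zetaC_gt0. Qed.

Definition tensor_repro (T : @tensor R) :=
  forall f, f \in T -> repro p f.1 /\ repro p f.2.

Lemma tensor_repro_in T : tensor_repro T -> tensor_in p p T.
Proof. by move=> hT f /hT[h1 h2]; split; [exact: h1.1|exact: h2.1]. Qed.

Lemma tensor_fun_repro_cvg T z : tensor_repro T ->
  \sum_(k <- square M) tcoef T k * psi2 k z @[M --> \oo] --> tensor_fun T z.
Proof.
move=> hT; have cv : \sum_(f <- T) (\sum_(0 <= n < M) fcoef f.1 n * psi n z.1) *
     (\sum_(0 <= m < M) fcoef f.2 m * psi m z.2) @[M --> \oo] --> tensor_fun T z.
  rewrite /tensor_fun big_seq; under eq_fun do rewrite big_seq.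
  by apply: cvg_sumr => f /hT[f1 f2]; apply: cvgM; [exact: f1.2|exact: f2.2].
apply: (eq_cvgn _ cv) => M; rewrite sum_square.
transitivity (\sum_(f <- T) \sum_(0 <= n < M) \sum_(0 <= m < M)
   fcoef f.1 n * fcoef f.2 m * psi2 (n, m) z).
  apply: eq_bigr => f _; rewrite mulr_suml; apply: eq_bigr => n _.
  by rewrite mulr_sumr; apply: eq_bigr => m _; rewrite /psi2 /=; ring.
rewrite exchange_big; apply: eq_bigr => n _; rewrite exchange_big; apply: eq_bigr => m _ /=.
by rewrite /tcoef mulr_suml.
Qed.

(** A Sobolev embedding: Cauchy-Schwarz against the weights [wt2 (- p) (- p)], whose sum is finite
    since [p > 1/2], with [psi ^ 2 <= 2] in each variable. It holds at every point because the
    factors equal their Fourier series everywhere. *)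
Lemma normr_tensor_fun_le T z : tensor_repro T ->
  `|tensor_fun T z| <= 2 * zetaC p * nrm square (wt2 p p) (tcoef T).
Proof.
move=> hT; have fT := tcoef_fin2 (tensor_repro_in hT).
set N := nrm _ _ _; have N0 : 0 <= N by exact: nrm_ge0.
have cv : `|\sum_(k <- square M) tcoef T k * psi2 k z| @[M --> \oo] --> `|tensor_fun T z|.
  by apply: cvg_norm; exact: tensor_fun_repro_cvg.
apply: (cvgr_to_le cv); near=> M.
have Z0 : 0 <= 2 * zetaC p * N by apply: mulr_ge0 => //; apply: mulr_ge0 => //; exact: ltW.
rewrite -ler_sqr ?nnegrE// -normrX ger0_norm ?sqr_ge0//.
have := sum_sqr_cauchy_schwarz (square M)
  (fun k => Num.sqrt (wt2 p p k) * tcoef T k) (fun k => Num.sqrt (wt2 (- p) (- p) k) * psi2 k z).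
rewrite [X in X ^+ 2 <= _ -> _](eq_bigr (fun k => tcoef T k * psi2 k z)); last first.
  move=> k _; rewrite mulrACA -sqrtrM ?wt2_ge0// /wt2 mulrACA !wtNK.
  by rewrite mulr1 sqrtr1 mul1r.
rewrite [X in _ <= X * _ -> _](eq_bigr (fun k => wt2 p p k * tcoef T k ^+ 2)); last first.
  by move=> k _; rewrite exprMn sqr_sqrtr ?wt2_ge0.
move=> h; apply: le_trans h _; rewrite exprMn mulrC; apply: ler_pM.
- by apply: sumr_ge0 => k _; rewrite sqr_ge0.
- by apply: sumr_ge0 => k _; rewrite mulr_ge0 ?wt2_ge0 ?sqr_ge0.
- rewrite sum_square.
  apply: (@le_trans _ _ ((\sum_(0 <= n < M) 2 * wt (- p) n) * (\sum_(0 <= m < M) 2 * wt (- p) m))).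
    rewrite mulr_suml; apply: ler_sum => n _; rewrite mulr_sumr; apply: ler_sum => m _.
    rewrite exprMn sqr_sqrtr ?wt2_ge0// /wt2 /psi2 /= exprMn mulrACA.
    have wpsi k x : wt (- p) k * psi k x ^+ 2 <= 2 * wt (- p) k.
      by rewrite mulrC ler_wpM2r ?wt_ge0 ?sqr_psi_le.
    by apply: ler_pM => //; exact: mulr_ge0 (wt_ge0 _ _) (sqr_ge0 _).
  have zz : 0 <= \sum_(0 <= n < M) 2 * wt (- p) n.
    by apply: sumr_ge0 => n _; rewrite mulr_ge0 ?wt_ge0.
  have zle : \sum_(0 <= n < M) 2 * wt (- p) n <= 2 * zetaC p.
    by rewrite -mulr_sumr ler_pM2l// sum_wtN_le.
  by rewrite expr2; apply: ler_pM.
- exact: (sqsum_le_nrm square_mono (wt2_ge0 p p) M fT).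
Unshelve. all: by end_near. Qed.

Lemma tensor_fun_sub (T T' : @tensor R) z :
  tensor_fun (tensor_sub T T') z = tensor_fun T z - tensor_fun T' z.
Proof.
rewrite /tensor_fun big_cat big_map; congr (_ + _); rewrite -sumrN.
by apply: eq_bigr => f _ /=; rewrite mulNr.
Qed.

Lemma tensor_repro_sub T T' : tensor_repro T -> tensor_repro T' ->
  tensor_repro (tensor_sub T T').
Proof.
move=> hT hT' f; rewrite mem_cat => /orP[/hT//|/mapP[g /hT' [g1 g2] ->]].
split=> //=; have := reproB (repro0 p) g1.
by congr (repro p _); apply/funext => y /=; rewrite sub0r.
Qed.

Lemma represents_dist_cvg0 u U W : tensor_represents p p u U ->
  tensor_represents p p u W -> forall e : R, 0 < e -> exists N, forall m n,
  (N <= m)%N -> (N <= n)%N ->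
  nrm square (wt2 p p) (fun z => tcoef (U m) z - tcoef (W n) z) <= e.
Proof.
move=> hU hW e e0; have e2 : 0 < e / 2 by rewrite divr_gt0.
have iU := tensor_represents_in hU; have iW := tensor_represents_in hW.
have [fu cU] := represents_dist0 hU; have [_ cW] := represents_dist0 hW.
move/cvgrPdist_le : cU => /(_ _ e2)[N1 _ h1].
move/cvgrPdist_le : cW => /(_ _ e2)[N2 _ h2].
have fB (V : nat -> @tensor R) k : (forall k, tensor_in p p (V k)) ->
    fin2 square (wt2 p p) (fun z => tcoef (V k) z - fcoef2 u z).
  by move=> iV; apply: fin2B => //; [exact: square_mono|exact: wt2_ge0|exact: tcoef_fin2].
exists (maxn N1 N2) => m n; rewrite !geq_max => /andP[m1 _] /andP[_ n2].
have {}h1 := h1 m m1; have {}h2 := h2 n n2.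
rewrite sub0r normrN ger0_norm ?nrm_ge0// in h1.
rewrite sub0r normrN ger0_norm ?nrm_ge0// in h2.
rewrite (_ : (fun z => _) = fun z => (tcoef (U m) z - fcoef2 u z) -
     (tcoef (W n) z - fcoef2 u z)); last by apply/funext => z; ring.
apply: (@le_trans _ _ (e / 2 + e / 2)); last by rewrite -splitr.
apply: le_trans (lerD h1 h2).
by apply: nrmB; [exact: square_mono|exact: wt2_ge0|exact: fB|exact: fB].
Qed.

Section Op.
Variables (A B : (R -> R) -> R -> R) (KA KB : R).
Hypotheses (KA0 : 0 <= KA) (KB0 : 0 <= KB).
Hypotheses (rA : forall f, Hsob p f -> repro p (A f))
           (rB : forall f, Hsob p f -> repro p (B f)).
Hypotheses (bA : bounded_op A p p KA) (bB : bounded_op B p p KB).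
Hypothesis oA : forall f n, Hsob p f -> fcoef (A (\- f)) n = - fcoef (A f) n.

Lemma tensor_map_repro T : tensor_in p p T -> tensor_repro (tensor_map A B T).
Proof. by move=> hT f /mapP[g /hT[g1 g2] ->]; split; [exact (rA g1)|exact (rB g2)]. Qed.

Lemma tcoef_map_sub T T' : tensor_in p p T' ->
  tcoef (tensor_map A B (tensor_sub T T')) =
  (fun z => tcoef (tensor_map A B T) z - tcoef (tensor_map A B T') z).
Proof.
move=> hT'; apply/funext => z.
rewrite /tcoef !big_map big_cat big_map; congr (_ + _); rewrite -sumrN.
rewrite big_seq [RHS]big_seq; apply: eq_bigr => f /hT'[f1 _] /=.
by rewrite oA// mulNr.
Qed.

Lemma nrm_tensor_map_le T : tensor_in p p T ->
  nrm square (wt2 p p) (tcoef (tensor_map A B T)) <=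
  Num.sqrt (KA * KB) * nrm square (wt2 p p) (tcoef T).
Proof.
move=> hT; have fT := tcoef_fin2 hT.
apply: nrm_le.
- exact: square_mono.
- exact: wt2_ge0.
- by rewrite mulr_ge0 ?sqrtr_ge0 ?nrm_ge0.
- rewrite exprMn sqr_sqrtr ?mulr_ge0//.
  apply: (tensor_map_bound KA0 KB0 bA bB hT) => M.
  exact: (sqsum_le_nrm square_mono (wt2_ge0 p p) M fT).
Qed.

Lemma tensor_map_dist_le T T' : tensor_in p p T -> tensor_in p p T' ->
  nrm square (wt2 p p) (fun z => tcoef (tensor_map A B T) z - tcoef (tensor_map A B T') z) <=
  Num.sqrt (KA * KB) * nrm square (wt2 p p) (fun z => tcoef T z - tcoef T' z).
Proof.
move=> hT hT'; rewrite -tcoef_map_sub// -(tcoef_sub _ hT').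
by apply: nrm_tensor_map_le; exact: tensor_in_sub.
Qed.

Let SK : R := 2 * zetaC p * Num.sqrt (KA * KB).

Let SK0 : 0 <= SK.
Proof. by apply: mulr_ge0; [apply: mulr_ge0 => //; exact: ltW|exact: sqrtr_ge0]. Qed.

Lemma tensor_map_sup_le T T' z : tensor_in p p T -> tensor_in p p T' ->
  `|tensor_fun (tensor_map A B T) z - tensor_fun (tensor_map A B T') z| <=
  SK * nrm square (wt2 p p) (fun z => tcoef T z - tcoef T' z).
Proof.
move=> hT hT'; rewrite -tensor_fun_sub.
have rT := tensor_map_repro hT; have rT' := tensor_map_repro hT'.
apply: le_trans (normr_tensor_fun_le z (tensor_repro_sub rT rT')) _.
rewrite (tcoef_sub _ (tensor_repro_in rT')) /SK -[leRHS]mulrA.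
apply: ler_wpM2l; last exact: tensor_map_dist_le.
by apply: mulr_ge0 => //; exact: ltW.
Qed.

Lemma tensor_map_unif u U W : tensor_represents p p u U -> tensor_represents p p u W ->
  forall e : R, 0 < e -> exists N, forall m n, (N <= m)%N -> (N <= n)%N -> forall z,
  `|tensor_fun (tensor_map A B (U m)) z - tensor_fun (tensor_map A B (W n)) z| <= e.
Proof.
move=> hU hW e e0.
have d0 : 0 < e / (SK + 1) by rewrite divr_gt0// ltr_wpDl.
have [N hN] := represents_dist_cvg0 hU hW d0; exists N => m n Nm Nn z.
have iU := tensor_represents_in hU; have iW := tensor_represents_in hW.
apply: le_trans (tensor_map_sup_le z (iU m) (iW n)) _.
apply: le_trans (ler_wpM2l SK0 (hN m n Nm Nn)) _.
rewrite mulrCA -[leRHS]mulr1 ler_wpM2l ?(ltW e0)//.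
by rewrite ler_pdivrMr ?ltr_wpDl// mul1r lerDl.
Qed.

(** A single [v] must serve all sequences representing [u]. Two such sequences approach each other
    in norm, so by the Sobolev embedding their images do so uniformly; the pointwise limit along [U]
    is therefore the uniform limit along every [W]. On a space of total mass [1] this implies
    convergence in [L^2]. *)
Lemma tensor_op_exists u U : tensor_represents p p u U ->
  exists v, forall W, tensor_represents p p u W ->
    tensor_represents p p v (fun n => tensor_map A B (W n)).
Proof.
move=> hU; have iU := tensor_represents_in hU.
pose v z := limn (fun n => tensor_fun (tensor_map A B (U n)) z).
have cv z : tensor_fun (tensor_map A B (U n)) z @[n --> \oo] --> v z.
  apply: cauchy_is_cvgn => e e0.
  by have [N hN] := tensor_map_unif hU hU e0; exists N => m n Nm Nn; exact: hN.
have unif W : tensor_represents p p u W -> forall e : R, 0 < e ->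
    exists N, forall n, (N <= n)%N -> forall z,
    `|(v \- tensor_fun (tensor_map A B (W n))) z| <= e.
  move=> hW e e0; have [N hN] := tensor_map_unif hU hW e0; exists N => n Nn z.
  have c : `|tensor_fun (tensor_map A B (U m)) z - tensor_fun (tensor_map A B (W n)) z|
      @[m --> \oo] --> `|v z - tensor_fun (tensor_map A B (W n)) z|.
    by apply: cvg_norm; apply: cvgB; [exact: cv|exact: cvg_cst].
  apply: (cvgr_to_le c); near=> m; apply: hN => //; near: m; exact: nbhs_infty_ge.
have mW W n : tensor_represents p p u W ->
    measurable_fun (setT : set T2) (tensor_fun (tensor_map A B (W n))).
  move=> hW; have iW := tensor_represents_in hW; apply: measurable_tensor_fun.
  exact: tensor_in_L2 (tensor_repro_in (tensor_map_repro (iW n))).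
have mv : measurable_fun (setT : set T2) v.
  apply: (@measurable_fun_cvg _ _ _ _ (fun n => tensor_fun (tensor_map A B (U n)))).
    by move=> n; exact: mW.
  by move=> z _; exact: cv.
exists v => W hW; have iW := tensor_represents_in hW; split.
- have [N hN] := unif U hU 1 ltr01.
  have rN := tensor_map_repro (iU N).
  apply (@bounded_Lfun2 _ _ _ _ muT2_le1 v
    (1 + 2 * zetaC p * nrm square (wt2 p p) (tcoef (tensor_map A B (U N)))) mv) => z.
  rewrite -[v z](subrK (tensor_fun (tensor_map A B (U N)) z)).
  apply: le_trans (ler_normD _ _) _; apply: lerD; first exact: (hN N (leqnn N) z).
  exact: normr_tensor_fun_le.
- by move=> n; exact: (tensor_repro_in (tensor_map_repro (iW n))).
- move=> e e0.
  have d0 : 0 < e / (Num.sqrt (KA * KB) + 1) by rewrite divr_gt0// ltr_wpDl ?sqrtr_ge0.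
  have [N hN] := represents_cauchy hW d0; exists N => m n Nm Nn.
  have rm := tensor_repro_in (tensor_map_repro (iW m)).
  have rn := tensor_repro_in (tensor_map_repro (iW n)).
  rewrite cross_normE; last exact: tensor_in_sub.
  rewrite (tcoef_sub _ rn).
  apply: le_lt_trans (tensor_map_dist_le (iW m) (iW n)) _.
  have s1 : 0 < Num.sqrt (KA * KB) + 1 by rewrite ltr_wpDl ?sqrtr_ge0.
  apply: (@le_lt_trans _ _ ((Num.sqrt (KA * KB) + 1) *
     nrm square (wt2 p p) (fun z => tcoef (W m) z - tcoef (W n) z))).
    by rewrite ler_wpM2r ?nrm_ge0// lerDl.
  by rewrite -ltr_pdivlMl// mulrC hN.
- apply/fine_cvgP.
  have bnd e : 0 < e -> \forall n \near \oo,
     ('N[muT2]_2%:E[EFin \o (v \- tensor_fun (tensor_map A B (W n)))%R] <= e%:E)%E.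
    move=> e0; have [N hN] := unif W hW e e0; near=> n.
    apply: (Lnorm2_bounded muT2_le1).
      by apply: measurable_funB => //; exact: mW.
    by apply: hN; near: n; exact: nbhs_infty_ge.
  split.
    have := bnd 1 ltr01; apply: filterS => n h.
    by rewrite ge0_fin_numE ?Lnorm_ge0//; exact: le_lt_trans h (ltry _).
  apply/cvgrPdist_le => e e0; have := bnd e e0; apply: filterS => n h.
  rewrite sub0r normrN ger0_norm ?fine_ge0 ?Lnorm_ge0//.
  rewrite -lee_fin fineK// ge0_fin_numE ?Lnorm_ge0//; exact: le_lt_trans h (ltry _).
Unshelve. all: by end_near. Qed.

Lemma tensor_opP u U : tensor_represents p p u U ->
  tensor_represents p p (tensor_op p A B u) (fun n => tensor_map A B (U n)).
Proof. by move=> hU; exact: (xgetPex (fun=> 0) (tensor_op_exists hU) U hU). Qed.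

End Op.

Lemma repro_Qdetail j f : Hsob p f -> repro p (Qdetail p j f).
Proof. by move=> hf; rewrite QdetailE; apply: reproB; exact: repro_prevproj. Qed.

Lemma fcoef_QdetailN j f n : Hsob p f ->
  fcoef (Qdetail p j (\- f)) n = - fcoef (Qdetail p j f) n.
Proof.
move=> hf; have L k g : Hsob p g -> prevproj p k g \in Lfun muT 2%:E.
  by move=> hg; exact: Hsob_Lfun2 (repro_prevproj hp k hg).1.
have E g : Hsob p g ->
    fcoef (Qdetail p j g) n = fcoef (prevproj p j.+1 g) n - fcoef (prevproj p j g) n.
  by move=> hg; rewrite QdetailE; exact: fcoefB (L _ _ hg) (L _ _ hg).
have P k : fcoef (prevproj p k (\- f)) n = - fcoef (prevproj p k f) n.
  exact: fcoef_prevprojN.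
apply: etrans (E _ (HsobN hf)) _.
apply: etrans (congr2 (fun x y => x - y) (P j.+1) (P j)) _.
apply: etrans _ (congr1 -%R (esym (E _ hf))).
by rewrite opprB opprK addrC.
Qed.

Lemma tensor_op_QdetailP a b u U : tensor_represents p p u U ->
  tensor_represents p p (tensor_op p (Qdetail p a) (Qdetail p b) u)
    (fun n => tensor_map (Qdetail p a) (Qdetail p b) (U n)).
Proof.
have p0 : 0 <= p by move: hp; lra.
have p2 : p <= 2 * p by move: hp; lra.
have K0 j : 0 <= 4 * projC p * 2 `^ (j%:R * (2 * (p - p))).
  apply: mulr_ge0; last exact: powR_ge0.
  by apply: mulr_ge0 => //; exact: le_trans ler01 (projC_ge1 hp).
have bQ j := @bounded_Qdetail R p hp p p (lexx p) p2 p0 (lexx p) j.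
apply: (tensor_opP (K0 a) (K0 b) _ _ (bQ a) (bQ b)).
- by move=> f; exact: repro_Qdetail.
- by move=> f; exact: repro_Qdetail.
- by move=> f n; exact: fcoef_QdetailN.
Qed.

End TensorOperators.

(** * The sparse grid error *)

Section SparseGrid.
Context {R : realType}.
Variables (p s t lambda : R).
Hypotheses (hp : 2^-1 < p) (s0 : 0 <= s) (sp : s <= p) (pt : p <= t) (tp : t <= 2 * p).
Hypotheses (l0 : 0 <= lambda) (l1 : lambda < 1).
Variable J : nat.

Let p0 : 0 <= p. Proof. by move: hp; lra. Qed.
Let st : s <= t. Proof. by move: sp pt; lra. Qed.
Let lam1 : 0 < 1 - lambda. Proof. by rewrite subr_gt0. Qed.

Definition sparse (j : nat * nat) : bool :=
  (j.1 + j.2)%:R - lambda * (maxn j.1 j.2)%:R <= J%:R * (1 - lambda).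

Lemma sparseC a b : sparse (a, b) = sparse (b, a).
Proof. by rewrite /sparse /= addnC maxnC. Qed.

Lemma sparse_le a b : sparse (a, b) -> (a <= J)%N.
Proof.
rewrite /sparse /= -(ler_nat R) => h.
have ab : a%:R <= (maxn a b)%:R :> R by rewrite ler_nat leq_maxl.
have mab : (maxn a b)%:R <= (a + b)%:R :> R by rewrite ler_nat geq_max leq_addr leq_addl.
rewrite -(ler_pM2r lam1); apply: le_trans h; move: l0 ab mab lam1; nra.
Qed.

(** Lowering [a] lowers the maximum by at most as much, and [0 <= lambda < 1], so the left-hand side
    of the defining inequality does not increase. Each column of the index set is thus an initial
    segment, described by its [height] alone. *)
Lemma sparse_mono a a' b : (a <= a')%N -> sparse (a', b) -> sparse (a, b).
Proof.
rewrite /sparse /= => aa; apply: le_trans; rewrite !natrD.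
have h1 : a%:R <= a'%:R :> R by rewrite ler_nat.
have h2 : (maxn a' b)%:R - (maxn a b)%:R <= a'%:R - a%:R :> R.
  rewrite lerBlDr addrAC -lerBlDr opprK -!natrD ler_nat.
  by clear -aa; lia.
have h3 : 0 <= (maxn a' b)%:R - (maxn a b)%:R :> R.
  by rewrite subr_ge0 ler_nat geq_max leq_maxr andbT (leq_trans aa)// leq_maxl.
move: l0 l1 h1 h2 h3; nra.
Qed.

Lemma nsparse_lt a b : ~~ sparse (a, b) -> J%:R * (1 - lambda) < (1 - lambda) * a%:R + b%:R.
Proof.
rewrite /sparse /= -ltNge natrD => h; apply: lt_le_trans h _.
have h1 : a%:R <= (maxn a b)%:R :> R by rewrite ler_nat leq_maxl.
move: l0 h1; nra.
Qed.

Let ex_nsparse b : exists a, ~~ sparse (a, b).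
Proof. by exists J.+1; apply/negP => /sparse_le; rewrite ltnn. Qed.

(* The number of indices of the column [b] of the sparse grid; they are
   [(0, b), ..., (height b - 1, b)]. *)
Definition height (b : nat) : nat := ex_minn (ex_nsparse b).

Lemma height_nsparse b : ~~ sparse (height b, b).
Proof. by rewrite /height; case: ex_minnP. Qed.

Lemma heightP a b : (a < height b)%N = sparse (a, b).
Proof.
rewrite /height; case: ex_minnP => m nm hm; apply/idP/idP => [am|sa].
  by apply: contraLR am => /hm; rewrite -leqNgt.
by rewrite ltnNge; apply: contra nm => ma; exact: sparse_mono sa.
Qed.

Lemma height_le b : (height b <= J.+1)%N.
Proof.
rewrite leqNgt; apply/negP => h.
by have := heightP J.+1 b; rewrite h => /esym/sparse_le; rewrite ltnn.
Qed.

Lemma height_top : height J.+1 = 0%N.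
Proof.
apply/eqP; rewrite -leqn0 leqNgt heightP sparseC; apply/negP => /sparse_le.
by rewrite ltnn.
Qed.

Definition sparse_seq : seq (nat * nat) := [seq j <- square J.+1 | sparse j].

Lemma sparse_indexE : sparse_index lambda J = [set` sparse_seq].
Proof.
apply/seteqP; split => -[a b] /=; rewrite /sparse_seq mem_filter.
  move=> h; have sab : sparse (a, b) by [].
  rewrite sab /=; apply/allpairsP; exists (a, b) => /=.
  rewrite !mem_index_iota /= !ltnS (sparse_le sab); split=> //.
  by rewrite sparseC in sab; exact: sparse_le sab.
by move=> /andP[].
Qed.

Lemma sparse_seq_uniq : uniq sparse_seq.
Proof.
apply: filter_uniq; apply: allpairs_uniq; rewrite ?iota_uniq//.
by move=> [a b] [c d] _ _ /= [-> ->].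
Qed.

Lemma sum_sparse (F : nat * nat -> R) :
  \sum_(j <- sparse_seq) F j = \sum_(0 <= b < J.+1) \sum_(0 <= a < height b) F (a, b).
Proof.
rewrite big_filter big_mkcond sum_square exchange_big /=; apply: eq_bigr => b _.
rewrite (big_cat_nat (leq0n (height b)) (height_le b))/= [X in _ + X](_ : _ = 0) ?addr0.
  by rewrite [LHS]big_nat [RHS]big_nat; apply: eq_bigr => a /=; rewrite heightP => ->.
by rewrite big_nat big1// => a /andP[ha _]; rewrite -heightP ltnNge ha.
Qed.

Lemma sum_sparse_sym (F : nat -> nat -> R) :
  \sum_(j <- sparse_seq) F j.1 j.2 = \sum_(j <- sparse_seq) F j.2 j.1.
Proof.
rewrite !big_filter big_mkcond [RHS]big_mkcond !sum_square exchange_big /=.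
by apply: eq_bigr => b _; apply: eq_bigr => a _; rewrite sparseC.
Qed.

(** The size of the [b]-th term of the telescoped error, up to a constant; it serves as well as the
    weight in [sqr_sum_weighted]. The sum [Gam] runs up to [J + 1] to include the last term of the
    telescoping. *)
Definition gam (b : nat) : R := 2 `^ ((s - t) * (height b)%:R - t * b%:R).

Definition Gam : R := \sum_(0 <= b < J.+2) gam b.

Lemma gam_gt0 b : 0 < gam b. Proof. by rewrite powR_gt0. Qed.

Lemma Gam_ge0 : 0 <= Gam. Proof. by apply: sumr_ge0 => b _; exact: powR_ge0. Qed.

Definition decay : R := (s - t * lambda) / (1 - lambda).

Lemma gam_le b : gam b <= 2 `^ (- (J%:R * (t - s))) * (2 `^ (- decay)) ^+ b.
Proof.
rewrite -powR_mulrn ?powR_ge0// -powRrM -powRD; last by apply/implyP => _; rewrite pnatr_eq0.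
rewrite ler_powR ?ler1n//.
have h := nsparse_lt (height_nsparse b).
have hd : decay * (1 - lambda) = s - t * lambda by rewrite /decay divfK ?gt_eqF.
rewrite -(ler_pM2r lam1).
have ts : 0 <= t - s by rewrite subr_ge0.
have := ler_wpM2l ts (ltW h).
move: hd; move: decay (height b)%:R (b%:R : R) (J%:R : R) => d m x j hd hh.
rewrite (_ : ((s - t) * m - t * x) * (1 - lambda) =
  - ((t - s) * ((1 - lambda) * m + x)) - (s - t * lambda) * x); last by ring.
rewrite (_ : (- (j * (t - s)) + - d * x) * (1 - lambda) =
  - ((t - s) * (j * (1 - lambda))) - d * (1 - lambda) * x); last by ring.
by rewrite hd lerD2r lerN2.
Qed.

(* The one-dimensional factors of the telescoped error
   [\sum_(b <= J + 1) (I - P_(height b - 1)) (x) colop b]. *)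
Definition colop (b : nat) : (R -> R) -> R -> R :=
  if (b <= J)%N then Qdetail p b else fun u => u \- prevproj p b u.

Definition errop (b : nat) (u : R -> R) : R -> R := u \- prevproj p (height b) u.

Definition errcoef (T : @tensor R) (z : nat * nat) : R :=
  tcoef T z - \sum_(j <- sparse_seq) tcoef (tensor_map (Qdetail p j.1) (Qdetail p j.2) T) z.

Lemma errcoefE (T : @tensor R) z : tensor_in p p T ->
  errcoef T z = \sum_(0 <= b < J.+2) tcoef (tensor_map (errop b) (colop b) T) z.
Proof.
move=> hT; rewrite /errcoef sum_sparse /tcoef.
pose P m (f : R -> R) n := fcoef (prevproj p m f) n.
have L k g : Hsob p g -> prevproj p k g \in Lfun muT 2%:E.
  by move=> hg; exact: Hsob_Lfun2 (repro_prevproj hp k hg).1.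
have QE k g n : Hsob p g -> fcoef (Qdetail p k g) n = P k.+1 g n - P k g n.
  by move=> hg; rewrite QdetailE; exact: fcoefB (L _ _ hg) (L _ _ hg).
have EE k g n : Hsob p g -> fcoef (g \- prevproj p k g) n = fcoef g n - P k g n.
  by move=> hg; exact: fcoefB (Hsob_Lfun2 hg) (L _ _ hg).
have P0 g n : P 0%N g n = 0 by exact: fcoef0.
transitivity (\sum_(f <- T) (fcoef f.1 z.1 * fcoef f.2 z.2 -
  \sum_(0 <= b < J.+1) P (height b) f.1 z.1 * (P b.+1 f.2 z.2 - P b f.2 z.2))).
  rewrite sumrB; congr (_ - _); rewrite [RHS]exchange_big /=; apply: eq_bigr => b _.
  transitivity (\sum_(0 <= a < height b) \sum_(f <- T)
     (P a.+1 f.1 z.1 - P a f.1 z.1) * (P b.+1 f.2 z.2 - P b f.2 z.2)).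
    apply: eq_bigr => a _; rewrite big_map big_seq [RHS]big_seq.
    by apply: eq_bigr => f /hT[f1 f2] /=; rewrite (QE _ _ _ f1) (QE _ _ _ f2).
  rewrite exchange_big /=; apply: eq_bigr => f _.
  by rewrite -mulr_suml telescope_sumr// P0 subr0.
transitivity (\sum_(f <- T) \sum_(0 <= b < J.+2) fcoef (errop b f.1) z.1 * fcoef (colop b f.2) z.2).
  rewrite big_seq [RHS]big_seq; apply: eq_bigr => f /hT[f1 f2].
  rewrite [RHS]big_nat_recr//=.
  (* Column [J + 1] is empty: its height is [0] and [prevproj p 0] is the zero map, so [errop] has
     the coefficients of the identity there. *)
  have -> : fcoef (errop J.+1 f.1) z.1 = fcoef f.1 z.1.
    by rewrite /errop height_top; apply: etrans (EE _ _ _ f1) _; rewrite P0 subr0.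
  have -> : fcoef (colop J.+1 f.2) z.2 = fcoef f.2 z.2 - P J.+1 f.2 z.2.
    by rewrite /colop ltnn; exact: EE.
  transitivity (\sum_(0 <= b < J.+1) (fcoef f.1 z.1 - P (height b) f.1 z.1) *
      (P b.+1 f.2 z.2 - P b f.2 z.2) + fcoef f.1 z.1 * (fcoef f.2 z.2 - P J.+1 f.2 z.2)).
    (* The second factor is split into its details up to level [J] and the remainder
       [f.2 - P_J f.2]; only the details meet the projections of the first factor. *)
    have tel : \sum_(0 <= b < J.+1) (P b.+1 f.2 z.2 - P b f.2 z.2) = P J.+1 f.2 z.2.
      by rewrite telescope_sumr// P0 subr0.
    transitivity (\sum_(0 <= b < J.+1) fcoef f.1 z.1 * (P b.+1 f.2 z.2 - P b f.2 z.2) -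
        \sum_(0 <= b < J.+1) P (height b) f.1 z.1 * (P b.+1 f.2 z.2 - P b f.2 z.2) +
        fcoef f.1 z.1 * (fcoef f.2 z.2 - P J.+1 f.2 z.2)).
      by rewrite -mulr_sumr tel; ring.
    by congr (_ + _); rewrite -sumrB; apply: eq_bigr => b _; ring.
  congr (_ + _); apply: eq_big_nat => b /= bJ.
  by rewrite /colop -ltnS bJ; exact (esym (congr2 *%R (EE _ _ _ f1) (QE _ _ _ f2))).
by rewrite exchange_big /=; apply: eq_bigr => b _; rewrite big_map.
Qed.

Let C1 : 1 <= projC p. Proof. exact: projC_ge1. Qed.

Lemma colterm_bound (T : @tensor R) b M : tensor_in t t T -> (b <= J.+1)%N ->
  sqsum square (wt2 s 0) (tcoef (tensor_map (errop b) (colop b) T)) M <=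
  4 * projC p ^+ 2 * gam b ^+ 2 * nrm square (wt2 t t) (tcoef T) ^+ 2.
Proof.
move=> hT bJ; set D := nrm _ _ _ ^+ 2.
have hD M' : sqsum square (wt2 t t) (tcoef T) M' <= D.
  exact: (sqsum_le_nrm square_mono (wt2_ge0 t t) M' (tcoef_fin2 hT)).
have D0 : 0 <= D by exact: sqr_ge0.
have C0 : 0 <= projC p by exact: le_trans ler01 C1.
pose KA := projC p * 2 `^ ((height b)%:R * (2 * (s - t))).
pose KB := 4 * projC p * 2 `^ (b%:R * (2 * (0 - t))).
have KA0 : 0 <= KA by apply: mulr_ge0 => //; exact: powR_ge0.
have KB0 : 0 <= KB by apply: mulr_ge0; [exact: mulr_ge0|exact: powR_ge0].
have hA : bounded_op (errop b) t s KA by exact: (bounded_err hp pt tp s0 sp).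
have hB : bounded_op (colop b) t 0 KB.
  rewrite /colop; case: ifP => _; first exact: (bounded_Qdetail hp pt tp (lexx 0) p0).
  (* For the last index, [I - P_J] satisfies the bound with [projC p], enlarged here to the constant
     [4 * projC p] of the details. *)
  move=> I r a f hf B hB M'.
  have h := @bounded_err _ _ hp _ _ pt tp (lexx 0) p0 b I r a f hf B hB M'.
  apply: le_trans h _.
  have B0 : 0 <= B by apply: le_trans (hB 0%N); rewrite /sqsum big_geq.
  apply: ler_wpM2r => //; apply: ler_wpM2r; first exact: powR_ge0.
  by move: C0; lra.
apply: le_trans (tensor_map_bound KA0 KB0 hA hB hT hD M) _.
apply: ler_wpM2r => //; rewrite /KA /KB /gam.
rewrite -[X in _ <= _ * X]powR_mulrn ?powR_ge0// -powRrM.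
rewrite (_ : ((s - t) * (height b)%:R - t * b%:R) * 2 =
   (height b)%:R * (2 * (s - t)) + b%:R * (2 * (0 - t))); last by ring.
rewrite powRD; last by apply/implyP => _; rewrite pnatr_eq0.
by rewrite le_eqVlt; apply/orP; left; apply/eqP; ring.
Qed.

(** With the weights [gam b], the bound [gam b ^+ 2] of each term is divided by [gam b]; both
    factors of the weighted inequality then sum to [Gam]. *)
Lemma errcoef_bound_s0 (T : @tensor R) M : tensor_in t t T ->
  sqsum square (wt2 s 0) (errcoef T) M <=
  (2 * projC p * Gam * nrm square (wt2 t t) (tcoef T)) ^+ 2.
Proof.
move=> hT; have hT' : tensor_in p p T by exact: tensor_in_le hT.
set D := nrm _ _ _.
pose X b := tcoef (tensor_map (errop b) (colop b) T).
apply: (@le_trans _ _ (\sum_(z <- square M) Gam * \sum_(0 <= b < J.+2)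
    (wt2 s 0 z * X b z ^+ 2) / gam b)).
  apply: ler_sum => z _; rewrite errcoefE//.
  have := sqr_sum_weighted (index_iota 0 J.+2) (fun b => X b z) gam_gt0.
  move=> /(ler_wpM2l (wt2_ge0 s 0 z)) h; apply: le_trans h _.
  rewrite mulrCA -/Gam ler_wpM2l ?Gam_ge0// mulr_sumr; apply: ler_sum => b _.
  by rewrite mulrA.
rewrite -mulr_sumr exchange_big /=.
apply: (@le_trans _ _ (Gam * \sum_(0 <= b < J.+2) 4 * projC p ^+ 2 * gam b * D ^+ 2)).
  apply: ler_wpM2l; first exact: Gam_ge0.
  rewrite big_nat [leRHS]big_nat; apply: ler_sum => b /= bJ.
  rewrite -mulr_suml ler_pdivrMr ?gam_gt0//.
  have := colterm_bound M hT bJ; rewrite -/D -/(X b) /sqsum.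
  by rewrite (_ : 4 * projC p ^+ 2 * gam b * D ^+ 2 * gam b =
    4 * projC p ^+ 2 * gam b ^+ 2 * D ^+ 2)//; ring.
rewrite -mulr_suml -mulr_sumr -/Gam le_eqVlt; apply/orP; left; apply/eqP; ring.
Qed.

Let swap (T : @tensor R) : @tensor R := [seq (f.2, f.1) | f <- T].

Let tcoef_swap T n m : tcoef (swap T) (n, m) = tcoef T (m, n).
Proof. by rewrite /tcoef big_map; apply: eq_bigr => f _; rewrite mulrC. Qed.

Let sqsum_swap a b (x y : nat * nat -> R) M : (forall n m, x (n, m) = y (m, n)) ->
  sqsum square (wt2 a b) x M = sqsum square (wt2 b a) y M.
Proof.
move=> xy; rewrite /sqsum !sum_square exchange_big /=.
by apply: eq_bigr => n _; apply: eq_bigr => m _; rewrite /wt2 /= xy; congr (_ * _); exact: mulrC.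
Qed.

(** Exchanging the factors of every elementary tensor transposes the arrays. The norm with equal
    orders [t] is unchanged, and since the index set is symmetric the error array is transposed
    too. *)
Lemma errcoef_bound_0s (T : @tensor R) M : tensor_in t t T ->
  sqsum square (wt2 0 s) (errcoef T) M <=
  (2 * projC p * Gam * nrm square (wt2 t t) (tcoef T)) ^+ 2.
Proof.
move=> hT; have hS : tensor_in t t (swap T).
  by move=> f /mapP[g /hT[g1 g2] ->]; split; [exact g2|exact g1].
have hn : nrm square (wt2 t t) (tcoef (swap T)) = nrm square (wt2 t t) (tcoef T).
  rewrite /nrm /nrm2; congr (Num.sqrt (limn _)); apply/funext => M'.
  by apply: sqsum_swap => n m; exact: tcoef_swap.
rewrite -hn; apply: le_trans (errcoef_bound_s0 M hS).
rewrite le_eqVlt; apply/orP; left; apply/eqP; apply: sqsum_swap => n m.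
rewrite /errcoef tcoef_swap; congr (_ - _).
rewrite [RHS](eq_bigr (fun j => tcoef (tensor_map (Qdetail p j.2) (Qdetail p j.1) T) (n, m))).
  exact: (sum_sparse_sym (fun a b => tcoef (tensor_map (Qdetail p a) (Qdetail p b) T) (n, m))).
move=> j _; rewrite /tcoef !big_map; apply: eq_bigr => f _ /=; exact: mulrC.
Qed.

(** Iterated subtraction of lists, matching [represents_sub]: it turns representatives of [u] and of
    its details into representatives of the error. *)
Fixpoint sub_all (I : Type) (l : seq I) (V : I -> @tensor R) (T : @tensor R) : tensor :=
  if l is j :: l' then tensor_sub (sub_all l' V T) (V j) else T.

Lemma represents_sub_all a b (I : Type) (l : seq I) (v : I -> R * R -> R)
    (V : I -> nat -> @tensor R) u U :
  tensor_represents a b u U -> (forall j, tensor_represents a b (v j) (V j)) ->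
  tensor_represents a b (u \- (fun z => \sum_(j <- l) v j z))
    (fun n => sub_all l (fun j => V j n) (U n)).
Proof.
move=> hu hv; elim: l => [|j l IH].
  by apply: represents_ext hu => // z; rewrite /= big_nil subr0.
apply: represents_ext (represents_sub IH (hv j)) => // z /=.
by rewrite big_cons opprD addrA addrAC.
Qed.

Lemma tcoef_sub_all a b (I : Type) (l : seq I) (V : I -> @tensor R) T :
  (forall j, tensor_in a b (V j)) ->
  tcoef (sub_all l V T) = fun z => tcoef T z - \sum_(j <- l) tcoef (V j) z.
Proof.
move=> hV; elim: l => [|j l IH] /=.
  by apply/funext => z; rewrite big_nil subr0.
rewrite (tcoef_sub _ (hV j)) IH; apply/funext => z.
by rewrite big_cons opprD addrA addrAC.
Qed.

Lemma sparse_projE u : sparse_proj p lambda J u =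
  fun z => \sum_(j <- sparse_seq) tensor_op p (Qdetail p j.1) (Qdetail p j.2) u z.
Proof.
by apply/funext => z; rewrite /sparse_proj sparse_indexE -fsbig_seq// sparse_seq_uniq.
Qed.

Lemma sqrt_sum2_le (x y k : R) : 0 <= x -> 0 <= y -> x <= k -> y <= k ->
  Num.sqrt (x ^+ 2 + y ^+ 2) <= 2 * k.
Proof.
move=> x0 y0 xk yk; have k0 : 0 <= 2 * k by lra.
by rewrite -[2 * k]ger0_norm// -sqrtr_sqr ler_sqrt ?sqr_ge0//; nra.
Qed.

(** For the algebraic tensors [U n] approximating [u] the error is again a list, to which the bounds
    on [errcoef] apply; the cross norms on both sides then converge. The [4] is the [2] of those
    bounds times the [2] of [sqrt_sum2_le]. *)
Lemma sparse_error u : Hmix t u ->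
  Hiso s (u \- sparse_proj p lambda J u) /\
  Hiso_norm s (u \- sparse_proj p lambda J u) <= 4 * projC p * Gam * Hmix_norm t u.
Proof.
move=> hu; have [U hU] := hu.
have iU := tensor_represents_in hU.
have hUp : tensor_represents p p u U by exact: represents_le hU.
have iUp := tensor_represents_in hUp.
pose V j n := tensor_map (Qdetail p j.1) (Qdetail p j.2) (U n).
have hV j : tensor_represents p p (tensor_op p (Qdetail p j.1) (Qdetail p j.2) u) (V j).
  exact: tensor_op_QdetailP.
have iV j n : tensor_in p p (V j n) by have iVj := tensor_represents_in (hV j); exact: (iVj n).
rewrite sparse_projE.
set e := u \- _.
pose W n := sub_all sparse_seq (fun j => V j n) (U n).
(* The error is represented in [H^p (x) H^p], where [tensor_op] takes its values; since
   [0 <= s <= p], the same lists represent it in both spaces that define [Hiso s]. *)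
have hW : tensor_represents p p e W by exact: represents_sub_all hUp hV.
have hWs : tensor_represents s 0 e W by exact: represents_le hW.
have hW0 : tensor_represents 0 s e W by exact: represents_le hW.
have Hs : Htensor s 0 e by exists W.
have H0 : Htensor 0 s e by exists W.
have WE n : tcoef (W n) = errcoef (U n).
  by rewrite (tcoef_sub_all _ _ (fun j => iV j n)).
set K := 2 * projC p * Gam.
have K0 : 0 <= K.
  by apply: mulr_ge0; [apply: mulr_ge0 => //; exact: le_trans ler01 C1|exact: Gam_ge0].
have cU : K * cross_norm t t (U n) @[n --> \oo] --> K * Hmix_norm t u.
  apply: cvgM; first exact: cvg_cst.
  by rewrite /Hmix_norm Htensor_normE//; exact: represents_cross_norm.
have bnd a b : Htensor a b e -> tensor_represents a b e W ->
    (forall T M, tensor_in t t T -> sqsum square (wt2 a b) (errcoef T) M <=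
       (K * nrm square (wt2 t t) (tcoef T)) ^+ 2) ->
    Htensor_norm a b e <= K * Hmix_norm t u.
  move=> hab rab hb; rewrite (Htensor_normE hab).
  apply: (ler_cvg_to (represents_cross_norm rab) cU); near=> n.
  have iW := tensor_represents_in rab.
  rewrite (cross_normE (iW n)) (cross_normE (iU n)) WE.
  apply: nrm_le.
  - exact: square_mono.
  - exact: wt2_ge0.
  - by rewrite mulr_ge0 ?nrm_ge0.
  - by move=> M; exact: hb.
have b1 := bnd s 0 Hs hWs (fun T M => @errcoef_bound_s0 T M).
have b2 := bnd 0 s H0 hW0 (fun T M => @errcoef_bound_0s T M).
split; first by split.
have n1 : 0 <= Htensor_norm s 0 e by rewrite Htensor_normE// nrm_ge0.
have n2 : 0 <= Htensor_norm 0 s e by rewrite Htensor_normE// nrm_ge0.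
have -> : 4 * projC p * Gam * Hmix_norm t u = 2 * (K * Hmix_norm t u) by rewrite /K; ring.
exact: sqrt_sum2_le.
Unshelve. all: by end_near. Qed.

End SparseGrid.

Theorem theorem3p5 (R : realType) (p s t lambda : R)
    (hp : 2^-1 < p) (hs0 : 0 <= s) (hsp : s <= p)
    (hpt : p <= t) (htp : t <= 2 * p) :
  (0 <= lambda -> lambda < s / t ->
   exists C : R, 0 < C /\
     forall (J : nat) (u : R * R -> R), (1 <= J)%N -> Hmix t u ->
       Hiso s (u \- sparse_proj p lambda J u) /\
       Hiso_norm s (u \- sparse_proj p lambda J u)
         <= C * 2 `^ (- (J%:R * (t - s))) * Hmix_norm t u) /\
  (lambda = s / t -> lambda < 1 ->
   exists C : R, 0 < C /\
     forall (J : nat) (u : R * R -> R), (1 <= J)%N -> Hmix t u ->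
       Hiso s (u \- sparse_proj p lambda J u) /\
       Hiso_norm s (u \- sparse_proj p lambda J u)
         <= C * J%:R * 2 `^ (- (J%:R * (t - s))) * Hmix_norm t u).
Proof.
have t0 : 0 < t by move: hp hpt; lra.
have C1 : 1 <= projC p by exact: projC_ge1.
have Nu u : Hmix t u -> 0 <= Hmix_norm t u.
  by move=> hu; rewrite /Hmix_norm Htensor_normE// nrm_ge0.
split=> [l0 lst|lE l1].
  have l1 : lambda < 1.
    by apply: lt_le_trans lst _; rewrite ler_pdivrMr// mul1r; move: hsp hpt; lra.
  have d0 : 0 < decay s t lambda.
    rewrite /decay divr_gt0 ?subr_gt0//.
    by move: lst; rewrite ltr_pdivlMr// mulrC.
  (* The ratio of the geometric series depends on [s], [t] and [lambda] only, so the constant is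
     uniform in [J]. *)
  set q := 2 `^ (- decay s t lambda).
  have q1 : q < 1 by rewrite /q powR_lt1 ?ltr1n// oppr_lt0.
  have q0 : 0 <= q by exact: powR_ge0.
  have Q0 : 0 < (1 - q)^-1 by rewrite invr_gt0 subr_gt0.
  exists (4 * projC p * (1 - q)^-1); split.
    by apply: mulr_gt0 => //; move: C1; lra.
  move=> J u J1 hu.
  have [h1 h2] := sparse_error hp hs0 hsp hpt htp l0 l1 J hu; split=> //.
  apply: le_trans h2 _; apply: ler_wpM2r; first exact: Nu.
  rewrite -[leRHS]mulrA; apply: ler_wpM2l; first by move: C1; lra.
  rewrite /Gam mulrC.
  apply: (@le_trans _ _ (\sum_(0 <= b < J.+2) 2 `^ (- (J%:R * (t - s))) * q ^+ b)).
    by apply: ler_sum => b _; exact: (gam_le hsp hpt l0 l1 J b).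
  rewrite -mulr_sumr; apply: ler_wpM2l; first exact: powR_ge0.
  have geo n : (1 - q) * \sum_(0 <= b < n) q ^+ b = 1 - q ^+ n.
    elim: n => [|n IH]; first by rewrite big_geq// mulr0 expr0 subrr.
    by rewrite big_nat_recr//= mulrDr IH exprS; ring.
  rewrite -[leRHS]mul1r ler_pdivlMr ?subr_gt0// mulrC geo.
  by rewrite gerBl exprn_ge0.
have l0 : 0 <= lambda by rewrite lE divr_ge0// ltW.
have d0 : decay s t lambda = 0.
  by rewrite /decay lE [t * _]mulrC divfK ?gt_eqF// subrr mul0r.
(* [12] is [4 * 3]: the [J + 2] equal terms are at most [3 * J] in number, as [J >= 1]. *)
exists (12 * projC p); split; first by move: C1; lra.
move=> J u J1 hu.
have [h1 h2] := sparse_error hp hs0 hsp hpt htp l0 l1 J hu; split=> //.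
apply: le_trans h2 _; apply: ler_wpM2r; first exact: Nu.
have -> : 12 * projC p * J%:R * 2 `^ (- (J%:R * (t - s))) =
   4 * projC p * (3 * J%:R * 2 `^ (- (J%:R * (t - s)))) by ring.
apply: ler_wpM2l; first by move: C1; lra.
apply: (@le_trans _ _ (\sum_(0 <= b < J.+2) 2 `^ (- (J%:R * (t - s))))).
  apply: ler_sum => b _; apply: le_trans (gam_le hsp hpt l0 l1 J b) _.
  by rewrite d0 oppr0 powRr0 expr1n mulr1.
rewrite big_const_nat iter_addr_0 subn0 -[leLHS]mulr_natl; apply: ler_wpM2r; first exact: powR_ge0.
by rewrite -natrM ler_nat; clear -J1; lia.
Qed.
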